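(* For every $n\ge 3$, the Escher staircase built from $2n$ squares has no convex presentation.
   Context: For $n\ge3$, the Escher staircase is the square-tiled translation surface obtained from $2n$ unit squares labelled $1,\dots,2n$ (labels modulo $2n$) as follows: square $2k+1$ is attached by translations to square $2k+2$ along both of its horizontal sides (the top of each of these two squares is glued to the bottom of the other), and square $2k+1$ is attached to square $2k$ along both of its vertical sides (the right side of each of these two squares is glued to the left side of the other). A translation surface $M$ (a surface obtained from polygons by gluing edges in pairs by translations, up to cut-and-paste equivalence) has a convex presentation if $M$ is obtained from a single convex polygon $P\subset\mathbb{R}^2$ by identifying its edges in pairs by translations. A convex polygon may have vertices with internal angle $\pi$, but polygons have no spurious vertices: no edge is strictly contained in a larger straight boundary segment on which the edge identification map extends continuously. *)

(* Defs.v *)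
From Stdlib Require Import Relations.
From mathcomp Require Import all_boot all_order all_algebra.
From mathcomp Require Import reals.
From mathcomp Require Import ring lra zify.

Set Implicit Arguments.
Unset Strict Implicit.
Unset Printing Implicit Defensive.

Import Order.TTheory GRing.Theory Num.Theory.
Local Open Scope ring_scope.

(* Side labels, as in the words describing polygonal presentations of surfaces:
   [(l, true)] is the letter l and [(l, false)] the letter l^-1; a side labelled
   l is glued to the side labelled l^-1. *)
Definition letter : Type := (nat * bool)%type.

Definition inv (x : letter) : letter := (x.1, ~~ x.2).

Section Presentations.
Variable R : realType.

Definition point : Type := (R * R)%type.

Definition lerp (t : R) (a b : point) : point :=
  (a.1 + t * (b.1 - a.1), a.2 + t * (b.2 - a.2)).

Definition cross (u v : point) : R := u.1 * v.2 - u.2 * v.1.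

(* The cyclic list of vertices; each vertex carries the label of the side that
   leaves it. *)
Definition polygon : Type := seq (point * letter).

(* Indices of vertices and sides are read modulo [size P]. *)
Definition vtx (P : polygon) (i : nat) : point :=
  (nth (0, (0%N, true)) P (i %% size P)).1.

Definition lab (P : polygon) (i : nat) : letter :=
  (nth (0, (0%N, true)) P (i %% size P)).2.

Definition side_vec (P : polygon) (i : nat) : point := vtx P i.+1 - vtx P i.

(* The boundary curve: the point at parameter s in [0, 1] of side i. *)
Definition bd (P : polygon) (i : nat) (s : R) : point :=
  lerp s (vtx P i) (vtx P i.+1).

Definition on_bd (P : polygon) (x : point) : Prop :=
  exists i s, [/\ (i < size P)%N, 0 <= s <= 1 & x = bd P i s].

(* The boundary is a simple closed curve: injective on the circle obtained by
   joining the half-open sides. *)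
Definition simple_bd (P : polygon) : Prop :=
  (2 < size P)%N /\
  forall (i j : nat) (s t : R), (i < size P)%N -> (j < size P)%N ->
    0 <= s < 1 -> 0 <= t < 1 -> bd P i s = bd P j t -> i = j /\ s = t.

(* Signed crossing of the side a -> b with the ray from x in the direction
   (1, 0). Keeping the lower and dropping the upper endpoint of each side makes
   the total count the winding number for every x off the boundary. *)
Definition crossing (a b x : point) : int :=
  if (a.2 <= x.2 < b.2) && (0 < cross (b - a) (x - a)) then 1
  else if (b.2 <= x.2 < a.2) && (cross (b - a) (x - a) < 0) then -1
  else 0.

Definition winding (P : polygon) (x : point) : int :=
  \sum_(i < size P) crossing (vtx P i) (vtx P i.+1) x.

(* The closed region bounded by P. *)
Definition region (P : polygon) (x : point) : Prop :=
  on_bd P x \/ winding P x != 0.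

(* A polygon, listed counterclockwise. *)
Definition is_polygon (P : polygon) : Prop :=
  simple_bd P /\
  forall x, ~ on_bd P x -> winding P x = 0 \/ winding P x = 1.

Definition sides (S : seq polygon) : seq (letter * point) :=
  flatten [seq [seq (lab P i, side_vec P i) | i <- iota 0 (size P)] | P <- S].

(* Gluing by translations: no label is used twice, and the side glued to a side
   of vector v has vector -v, since both boundaries are run counterclockwise. *)
Definition glued (S : seq polygon) : Prop :=
  uniq [seq e.1 | e <- sides S] /\
  forall x v, (x, v) \in sides S -> (inv x, - v) \in sides S.

(* A finite family of polygons, each in its own copy of the plane, with its
   sides glued in pairs by translations: a presentation of a translation
   surface. *)
Definition presentation (S : seq polygon) : Prop :=
  (forall P, P \in S -> is_polygon P) /\ glued S.

Definition translate (v : point) (P : polygon) : polygon :=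
  [seq (c.1 + v, c.2) | c <- P].

Definition relabel (f : letter -> letter) (P : polygon) : polygon :=
  [seq (c.1, f c.2) | c <- P].

(* Insertion of a vertex on the side labelled l at parameter t, and of the
   identified point (at parameter 1 - t) on the side labelled l^-1: l becomes
   l l' and l^-1 becomes l'^-1 l^-1. *)
Definition split_side (l l' : nat) (t : R) (P : polygon) : polygon :=
  flatten [seq
    if lab P i == (l, true) then
      [:: (vtx P i, (l, true)); (bd P i t, (l', true))]
    else if lab P i == (l, false) then
      [:: (vtx P i, (l', false)); (bd P i (1 - t), (l, false))]
    else [:: (vtx P i, lab P i)]
  | i <- iota 0 (size P)].

(* The elementary operations. In [move_cut] the polygon a ... b ... is cut along
   the diagonal from a to b, whose two copies get the labels z and z^-1;
   read from right to left it is a pasting. *)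
Inductive move : seq polygon -> seq polygon -> Prop :=
| move_perm (S T : seq polygon) : perm_eq S T -> move S T
| move_rot (k : nat) (P : polygon) (S : seq polygon) :
    move (P :: S) (rot k P :: S)
| move_translate (v : point) (P : polygon) (S : seq polygon) :
    move (P :: S) (translate v P :: S)
| move_relabel (f : letter -> letter) (S : seq polygon) :
    injective f -> (forall x, f (inv x) = inv (f x)) ->
    move S (map (relabel f) S)
| move_split (l l' : nat) (t : R) (S : seq polygon) :
    0 < t < 1 -> move S (map (split_side l l' t) S)
| move_cut (a b : point) (x y z : letter) (s1 s2 : polygon)
    (S : seq polygon) :
    move ((((a, x) :: s1) ++ ((b, y) :: s2)) :: S)
         (rcons ((a, x) :: s1) (b, z) :: rcons ((b, y) :: s2) (a, inv z) :: S).

(* Requiring presentations at both ends forces the labels introduced by [move]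
   to be fresh. It also forces the diagonal of a cut to be interior: winding
   numbers add up under cutting, and those of the polygon and of both pieces
   are 0 or 1. *)
Definition cut_paste_step (S T : seq polygon) : Prop :=
  [/\ presentation S, presentation T & move S T].

Definition cut_paste : seq polygon -> seq polygon -> Prop :=
  clos_refl_sym_trans (seq polygon) cut_paste_step.

Definition convex_polygon (P : polygon) : Prop :=
  forall (x y : point) (t : R), region P x -> region P y -> 0 <= t <= 1 ->
    region P (lerp t x y).

(* The identification of side i with side k sends [bd P i s] to
   [bd P k (1 - s)]. So the last condition says that the identifications of
   sides i and i + 1 have the same value at their common vertex, i.e. that
   together they are continuous on the straight segment formed by these two
   sides. *)
Definition spurious (P : polygon) (i : nat) : Prop :=
  cross (side_vec P i) (side_vec P i.+1) = 0 /\
  exists k m : nat,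
    [/\ lab P k = inv (lab P i), lab P m = inv (lab P i.+1) &
        bd P k 0 = bd P m 1].

Definition has_convex_presentation (S : seq polygon) : Prop :=
  exists P : polygon,
    [/\ presentation [:: P], convex_polygon P,
        (forall i, ~ spurious P i) & cut_paste S [:: P]].

(* Squares are indexed by residues modulo 2n, in {0, ..., 2n - 1}: the square
   labelled 2n is square 0. *)
Definition vert (n j : nat) : nat :=
  if odd j then (j.+1 %% n.*2)%N else ((j + n.*2).-1 %% n.*2)%N.

Definition horiz (j : nat) : nat := if odd j then j.-1 else j.+1.

(* The letters 2j and 2j + 1 are the top and the right side of square j, their
   inverses the bottom of square [vert n j] and the left side of square
   [horiz j]; both maps are involutions. *)
Definition square (n j : nat) : polygon :=
  [:: ((0, 0), ((vert n j).*2, false));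
      ((1, 0), (j.*2.+1, true));
      ((1, 1), (j.*2, true));
      ((0, 1), ((horiz j).*2.+1, false))].

Definition escher (n : nat) : seq polygon :=
  [seq square n j | j <- iota 0 n.*2].

End Presentations.

Section EscherPresentation.
Variables (R : realType) (n : nat).

Lemma vertK (j : nat) : (j < n.*2)%N ->
  (vert n j < n.*2)%N /\ vert n (vert n j) = j.
Proof.
rewrite /vert => ltj; case: ifP => oj.
  have [ej|ne] := eqVneq j.+1 n.*2; last first.
    have lt1 : (j.+1 < n.*2)%N by lia.
    rewrite (modn_small lt1) /= oj /=; split=> //.
    by rewrite modnDr modn_small.
  rewrite ej modnn /=; split; first by lia.
  by rewrite modn_small; lia.
have [ej|j0] := posnP j.
  rewrite ej add0n modn_small; last by lia.
  have -> : odd (n.*2.-1) by lia.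
  by split; [lia|rewrite (_ : n.*2.-1.+1 = n.*2) ?modnn //; lia].
rewrite (_ : (j + n.*2).-1 = (j.-1 + n.*2)%N); last by lia.
rewrite modnDr modn_small; last by lia.
have -> : odd j.-1 by lia.
by split; [lia|rewrite modn_small; lia].
Qed.

Lemma horizK (j : nat) : (j < n.*2)%N ->
  (horiz j < n.*2)%N /\ horiz (horiz j) = j.
Proof.
rewrite /horiz => ltj; case: ifP => oj.
  have -> : odd j.-1 = false by lia.
  by split; lia.
by rewrite /= oj /=; split=> //; lia.
Qed.

Lemma square_is_polygon (j : nat) : is_polygon (square R n j).
Proof.
split.
  split=> // i k s t; rewrite /bd /lerp /vtx /square /=.
  case: i => [|[|[|[|//]]]] _; case: k => [|[|[|[|//]]]] _;
    move=> /andP[s0 s1] /andP[t0 t1] /= [] e1 e2;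
    first [by exfalso; lra | by split=> //; lra].
move=> [x y] _; rewrite /winding /square !big_ord_recl big_ord0 /crossing.
rewrite /vtx /cross /=.
have no (a b : R) : b <= a -> (a <= y < b) = false.
  move=> ba; apply/negP => /andP[ay yb].
  by have := lt_le_trans (le_lt_trans ay yb) ba; rewrite ltxx.
rewrite !(no 0 0) // !(no 1 1) // !(no 1 0) //= !addr0 !add0r.
rewrite (_ : _ - _ = 1 - x); last by ring.
rewrite (_ : _ * (y - 1) - _ = x); last by ring.
rewrite subr_gt0; case: (0 <= y < 1) => /=; last by left.
have [x1|x1] := ltP x 1; have [x0|x0] := ltP x 0; try by [left|right].
by have := lt_le_trans x0 (le_trans ler01 x1); rewrite ltxx.
Qed.

Lemma escher_glued : glued (escher R n).
Proof.
have oppE (a b : R) : - ((a, b) : point R) = (- a, - b) by [].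
pose f j : seq (letter * point R) :=
  [:: (((vert n j).*2, false), (1, 0)); ((j.*2.+1, true), (0, 1));
      ((j.*2, true), (-1, 0)); (((horiz j).*2.+1, false), (0, -1))].
have sidesE : sides (escher R n) = flatten [seq f j | j <- iota 0 n.*2].
  rewrite /sides /escher -map_comp; congr flatten; apply: eq_map => j /=.
  rewrite /f /side_vec /vtx /lab /square /=.
  by congr [:: (_, _); (_, _); (_, _); (_, _)]; congr pair => /=; lra.
have memE x v : reflect (exists2 j, (j < n.*2)%N & (x, v) \in f j)
                        ((x, v) \in sides (escher R n)).
  rewrite sidesE; apply: (iffP flatten_mapP) => -[j];
  by rewrite ?mem_iota /= ?add0n => jn xv; exists j; rewrite ?mem_iota.
split; last first.
  move=> x v /memE[j jn]; rewrite !inE => /or4P[] /eqP[-> ->]; apply/memE.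
  - exists (vert n j); first by case: (vertK jn).
    by rewrite !inE /inv /=; apply/or4P/Or43; rewrite oppE oppr0.
  - exists (horiz j); first by case: (horizK jn).
    rewrite !inE /inv /= (horizK jn).2; apply/or4P/Or44.
    by rewrite oppE oppr0.
  - exists (vert n j); first by case: (vertK jn).
    rewrite !inE /inv /= (vertK jn).2; apply/or4P/Or41.
    by rewrite oppE oppr0 opprK.
  - exists (horiz j); first by case: (horizK jn).
    rewrite !inE /inv /=; apply/or4P/Or42.
    by rewrite oppE oppr0 opprK.
rewrite sidesE map_flatten -map_comp.
have : forall j, j \in iota 0 n.*2 -> (j < n.*2)%N.
  by move=> j; rewrite mem_iota.
elim: (iota 0 n.*2) (iota_uniq 0 n.*2) => //= j s IHs /andP[js us] lts.
have jn : (j < n.*2)%N by apply: lts; rewrite inE eqxx.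
rewrite (IHs us); last by move=> k ks; apply: lts; rewrite inE ks orbT.
rewrite andbT.
have nin x : x \in map (@fst _ _) (f j) ->
    x \notin flatten [seq (map (@fst _ _) \o f) k | k <- s].
  move=> xj; apply/negP => /flatten_mapP[k ks].
  have kn : (k < n.*2)%N by apply: lts; rewrite inE ks orbT.
  suff: forall k, (k < n.*2)%N -> x \in map (@fst _ _) (f k) ->
    k = match x with (l, b) => if odd l then (if b then l./2 else horiz l./2)
                               else (if b then l./2 else vert n l./2) end.
    by move=> H /(H k kn) ek; move: js; rewrite (H j jn xj) -ek ks.
  move=> {kn ks xj}k kn; rewrite !inE => /or4P[] /eqP->;
    rewrite /= ?odd_double ?doubleK ?uphalf_double //=.
  - by rewrite (vertK kn).2.
  - by rewrite (horizK kn).2.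
rewrite !inE !negb_or !nin ?inE ?eqxx ?orbT //= !andbT !xpair_eqE /= !andbF /=.
by apply/and3P; split=> //; rewrite ?andbT; apply/eqP; lia.
Qed.

Lemma escher_presentation : presentation (escher R n).
Proof.
split; last exact: escher_glued.
by move=> P /mapP[j _ ->]; apply: square_is_polygon.
Qed.

End EscherPresentation.

(* Main.v *)
(** The staircase is a cyclic cover of degree n of the torus R^2 / <(1, 1), (1, -1)>
made of two unit squares, branched over the integral points: sheets can be numbered
in Z/n so that the number changes by 2 or -2, hence is not constant, around each
integral point. Such a description by a locally constant sheet number on each polygon
is preserved by cutting and pasting, so that it exists for every polygon P presenting
the staircase. Integral points (with respect to the position of P over the torus) are
then vertices of P. As n >= 3, at least three vertices of P lie over the same point of
the torus, and two of them differ by an even integral vector; if P is convex, their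
midpoint is a vertex as well and they lie on a straight part of the boundary. The two
sides of this part which start at integral points are glued to sides on the opposite
supporting line, with integral end points. If the strip between the two lines contained
an integral line in its interior, this line would meet P in a segment longer than a
period, hence in an integral point. So P lies in a strip of height 1 in a direction
(p, q). If p + q is even, points of the torus at height 3/2 are not covered by P. If
p + q is odd, the number of the sheet is periodic of period 2 (p, q) along the middle
line of the strip, and not all sheets are covered by P. *)

(* Two presentations are related only by a chain of elementary moves, so the cover has to be
   recorded polygon by polygon, in a form that each move can transport. A single sheet number cannot
   do this, since it has to jump somewhere around an integral point. Two numberings are therefore
   kept, [c.2] and its correction by the colour of the unit square. Each is locally constant off one
   of the two families of grid lines, and at a point that is not integral at least one of them is. A
   loop around an integral point compares them at four corners, which produces the change by twice
   [u]. As 2 is not 0 in Z/n, this change is nontrivial and the sheets 0, u, 2u are distinct. The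
   boundary is the second obstacle. The winding number is half-open there, which makes it additive
   under cutting at every point; sheet numbers are read through germs on the inside, also at side
   points and vertices. Sides and germs are connected by the fact that the winding number is 1 just
   to the left of a side and 0 just to its right. *)
Require Import Defs.
From mathcomp Require Import all_boot all_order all_algebra.
From mathcomp Require Import reals.
From mathcomp Require boolp classical_sets.
From mathcomp Require Import ring lra zify.

Set Implicit Arguments.
Unset Strict Implicit.
Unset Printing Implicit Defensive.

Import Order.TTheory GRing.Theory Num.Theory.
Local Open Scope ring_scope.

Local Notation inv := Defs.inv.
Local Notation "S `[ i ]" := (nth [::] S i) (at level 2, format "S `[ i ]").

(** * Neighbourhoods in the plane *)

Section Plane.
Variable R : realType.
Implicit Types (a b p q v x : point R) (Q : point R -> Prop).

Lemma crossE a b x :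
  cross (b - a) (x - a) =
  (b.1 - a.1) * (x.2 - a.2) - (b.2 - a.2) * (x.1 - a.1).
Proof. by []. Qed.

Definition near (e : R) q x : bool := (`|x.1 - q.1| < e) && (`|x.2 - q.2| < e).

Definition nearby q Q : Prop := exists2 e : R, 0 < e & forall x, near e q x -> Q x.

Lemma near_refl (e : R) q : 0 < e -> near e q q.
Proof. by move=> e0; rewrite /near !subrr normr0 e0. Qed.

Lemma nearP (e : R) q x :
  reflect [/\ q.1 - e < x.1, x.1 < q.1 + e, q.2 - e < x.2 & x.2 < q.2 + e]
          (near e q x).
Proof.
rewrite /near !ltr_norml; apply: (iffP idP).
  by case/andP => /andP[? ?] /andP[? ?]; split; lra.
by case=> ? ? ? ?; apply/andP; split; apply/andP; split; lra.
Qed.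

Lemma nearby_refl q Q : nearby q Q -> Q q.
Proof. by case=> e e0; apply; apply: near_refl. Qed.

Lemma nearbyW q Q Q' : (forall x, Q x -> Q' x) -> nearby q Q -> nearby q Q'.
Proof. by move=> QQ' [e e0 H]; exists e => // x /H /QQ'. Qed.

Lemma nearbyT q Q : (forall x, Q x) -> nearby q Q.
Proof. by move=> H; exists 1. Qed.

Lemma nearby_and q Q Q' :
  nearby q Q -> nearby q Q' -> nearby q (fun x => Q x /\ Q' x).
Proof.
move=> [e e0 H] [e' e'0 H']; exists (Num.min e e'); first by rewrite lt_min e0.
by move=> x /andP[]; rewrite !lt_min => /andP[? ?] /andP[? ?];
  split; [apply: H | apply: H']; apply/andP.
Qed.

Lemma nearby2 q Q Q' Q'' : (forall x, Q x -> Q' x -> Q'' x) ->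
  nearby q Q -> nearby q Q' -> nearby q Q''.
Proof.
by move=> H HQ HQ'; apply: nearbyW (nearby_and HQ HQ') => x [] /H.
Qed.

Lemma nearby_all (I : eqType) (s : seq I) q (Q : I -> point R -> Prop) :
  (forall i, i \in s -> nearby q (Q i)) ->
  nearby q (fun x => forall i, i \in s -> Q i x).
Proof.
elim: s => [|i s IHs] H; first exact: nearbyT.
have Hi := H i (mem_head _ _).
have Hs : nearby q (fun x => forall j, j \in s -> Q j x).
  by apply: IHs => j js; apply: H; rewrite inE js orbT.
apply: nearby2 Hi Hs => x Qi Qs j; rewrite inE => /orP[/eqP-> //|]; exact: Qs.
Qed.

Lemma nearby_nearby q Q : nearby q Q -> nearby q (fun p => nearby p Q).
Proof.
move=> [e e0 H]; exists (e / 2); first by lra.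
move=> p /nearP[? ? ? ?]; exists (e / 2); first by lra.
by move=> x /nearP[? ? ? ?]; apply/H/nearP; split; lra.
Qed.

Lemma nearby_trans v q Q : nearby (q + v) Q -> nearby q (fun x => Q (x + v)).
Proof.
move=> [e e0 H]; exists e => // x /nearP[? ? ? ?].
by apply: H; apply/nearP => /=; split; lra.
Qed.

Lemma nearby_affine (k l m : R) q : 0 < k * q.1 + l * q.2 + m ->
  nearby q (fun x => 0 < k * x.1 + l * x.2 + m).
Proof.
set c := (X in 0 < X) => c0.
have d0 : 0 < `|k| + `|l| + 1 by have := normr_ge0 k; have := normr_ge0 l; lra.
exists (c / (`|k| + `|l| + 1)); first by rewrite divr_gt0.
move=> x /andP[h1 h2]; set e := c / _ in h1 h2.
have ec : e * (`|k| + `|l| + 1) = c by rewrite /e mulfVK // gt_eqF.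
have e0 : 0 < e by rewrite divr_gt0.
have b1 : `|k * (x.1 - q.1)| <= `|k| * e by rewrite normrM ler_wpM2l // ltW.
have b2 : `|l * (x.2 - q.2)| <= `|l| * e by rewrite normrM ler_wpM2l // ltW.
move: b1 b2; rewrite !ler_norml => /andP[b1 _] /andP[b2 _].
have : c = k * q.1 + l * q.2 + m by [].
lra.
Qed.

Lemma nearby_cross_gt0 u a q : 0 < cross u (q - a) ->
  nearby q (fun x => 0 < cross u (x - a)).
Proof.
rewrite /cross /= => h.
have /(@nearby_affine) : 0 < (- u.2) * q.1 + u.1 * q.2 + (u.2 * a.1 - u.1 * a.2).
  by lra.
by apply: nearbyW => x hx; lra.
Qed.

Lemma nearby_cross_lt0 u a q : cross u (q - a) < 0 ->
  nearby q (fun x => cross u (x - a) < 0).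
Proof.
rewrite /cross /= => h.
have /(@nearby_affine) : 0 < u.2 * q.1 + (- u.1) * q.2 + - (u.2 * a.1 - u.1 * a.2).
  by lra.
by apply: nearbyW => x hx; lra.
Qed.

Lemma nearby_gt1 q (c : R) : c < q.1 -> nearby q (fun x => c < x.1).
Proof.
move=> h; have /(@nearby_affine) : 0 < 1 * q.1 + 0 * q.2 + - c by lra.
by apply: nearbyW => x hx; lra.
Qed.

Lemma nearby_lt1 q (c : R) : q.1 < c -> nearby q (fun x => x.1 < c).
Proof.
move=> h; have /(@nearby_affine) : 0 < (-1) * q.1 + 0 * q.2 + c by lra.
by apply: nearbyW => x hx; lra.
Qed.

Lemma nearby_gt2 q (c : R) : c < q.2 -> nearby q (fun x => c < x.2).
Proof.
move=> h; have /(@nearby_affine) : 0 < 0 * q.1 + 1 * q.2 + - c by lra.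
by apply: nearbyW => x hx; lra.
Qed.

Lemma nearby_lt2 q (c : R) : q.2 < c -> nearby q (fun x => x.2 < c).
Proof.
move=> h; have /(@nearby_affine) : 0 < 0 * q.1 + (-1) * q.2 + c by lra.
by apply: nearbyW => x hx; lra.
Qed.

(** The witness is [q] moved by a small multiple [t] of [u] turned left by a right angle; the cross
    product is then [t] times the squared length of [u]. *)
Lemma nearby_left u q Q : u != 0 -> nearby q Q ->
  exists x, Q x /\ 0 < cross u (x - q).
Proof.
move=> u0 [e e0 H].
have n0 : 0 < `|u.1| + `|u.2|.
  rewrite lt_neqAle eq_sym paddr_eq0 // !normr_eq0 addr_ge0 ?normr_ge0 // andbT.
  by apply: contra u0 => /andP[/eqP h1 /eqP h2]; case: u h1 h2 => /= ? ? -> ->.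
pose t := e / (2 * (`|u.1| + `|u.2|)).
have t0 : 0 < t by rewrite divr_gt0 // mulr_gt0.
have tE : t * (2 * (`|u.1| + `|u.2|)) = e by rewrite mulfVK // gt_eqF // mulr_gt0.
clearbody t.
exists (q.1 - t * u.2, q.2 + t * u.1); split.
  apply: H; rewrite /near /=.
  rewrite (_ : q.1 - t * u.2 - q.1 = - (t * u.2)); last by ring.
  rewrite (_ : q.2 + t * u.1 - q.2 = t * u.1); last by ring.
  rewrite normrN !normrM (gtr0_norm t0).
  have h1 := mulr_ge0 (ltW t0) (normr_ge0 u.1).
  have h2 := mulr_ge0 (ltW t0) (normr_ge0 u.2).
  by apply/andP; split; nra.
rewrite /cross /=.
rewrite (_ : _ - _ = t * (u.1 ^+ 2 + u.2 ^+ 2)); last by ring.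
rewrite mulr_gt0 //.
have : u.1 ^+ 2 = `|u.1| ^+ 2 by rewrite real_normK // num_real.
have : u.2 ^+ 2 = `|u.2| ^+ 2 by rewrite real_normK // num_real.
have := normr_ge0 u.1; have := normr_ge0 u.2 => h1 h2 -> ->.
have [h|h] := ltP 0 `|u.1|.
  have := exprn_gt0 2 h; have := exprn_ge0 2 h1; lra.
have := exprn_gt0 2 (_ : 0 < `|u.2|); have := exprn_ge0 2 h2 => ? /(_ ltac:(lra)); lra.
Qed.

Lemma nearby_right u q Q : u != 0 -> nearby q Q ->
  exists x, Q x /\ cross u (x - q) < 0.
Proof.
move=> u0 /(nearby_left (u := - u)); rewrite oppr_eq0 => /(_ u0)[x [Qx h]].
by exists x; split=> //; move: h; rewrite /cross /=; lra.
Qed.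

End Plane.

(** * Winding numbers *)

Section Winding.
Variable R : realType.
Implicit Types (a b p q v x y : point R) (P : polygon R).

Definition on_seg a b x : Prop := exists2 s : R, 0 <= s <= 1 & x = lerp s a b.

Lemma point_eq x y : x.1 = y.1 -> x.2 = y.2 -> x = y.
Proof. by case: x y => [? ?] [? ?] /= -> ->. Qed.

Lemma crossing_anti a b x : crossing b a x = - crossing a b x.
Proof.
have e : cross (a - b) (x - b) = - cross (b - a) (x - a).
  by rewrite !crossE; ring.
rewrite /crossing e oppr_gt0 oppr_lt0.
have nb : ~~ ((a.2 <= x.2 < b.2) && (b.2 <= x.2 < a.2)).
  by apply/negP => /andP[/andP[? ?] /andP[? ?]]; lra.
case: (a.2 <= x.2 < b.2) nb; case: (b.2 <= x.2 < a.2) => //= _.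
- by case: ifP; rewrite ?oppr0.
- by case: ifP; rewrite ?opprK ?oppr0.
Qed.

Lemma crossing_up a b x : a.2 < b.2 ->
  crossing a b x = ((a.2 <= x.2 < b.2) && (0 < cross (b - a) (x - a)))%:Z.
Proof.
move=> ab; rewrite /crossing; case: ifP => //= _.
by case: ifP => // /andP[/andP[h1 h2] _]; exfalso; lra.
Qed.

Lemma crossing_horizontal a b x : a.2 = b.2 -> crossing a b x = 0.
Proof.
move=> ab; rewrite /crossing ab.
by have [] := ltP x.2 b.2; rewrite ?andbF //= => h; rewrite ?[b.2 <= _]leNgt ?h.
Qed.

Lemma lerp_cross s a b : cross (b - a) (lerp s a b - a) = 0.
Proof. by rewrite crossE /=; ring. Qed.

Lemma cross_lerp s a b x : cross (b - a) (x - lerp s a b) = cross (b - a) (x - a).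
Proof. by rewrite /cross /=; ring. Qed.

(** This detects a vertex [v] on the open ray from [p] in the direction (1, 0), and only for [x]
    lower than [p]: the rays from such [x] pass under [v], where a side ending at [v] may be gained
    or lost. *)
Definition passes p v x : int := (((v.2 == p.2) && (p.1 < v.1)) && (x.2 < p.2))%:Z.

(* Moving [x] below the height of [p] changes the contribution of the side by
   terms located at its endpoints, which cancel around a closed curve. *)
Lemma crossing_near a b p : ~ on_seg a b p ->
  nearby p (fun x =>
    crossing a b x = crossing a b p + (passes p b x - passes p a x)).
Proof.
wlog ab : a b / a.2 <= b.2.
  move=> H nab; have [|ba] := leP a.2 b.2; first by move/H; apply.
  have nba : ~ on_seg b a p.
    move=> [s /andP[s0 s1] e]; apply: nab; exists (1 - s); first by lra.
    by rewrite e; apply: point_eq => /=; ring.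
  apply: nearbyW (H b a (ltW ba) nba) => x e.
  by rewrite (crossing_anti b a) e (crossing_anti b a p); ring.
move=> nab; have [e2|ne] := eqVneq a.2 b.2.
  have [ep|np] := eqVneq a.2 p.2; last first.
    apply: nearbyT => x; rewrite !crossing_horizontal // /passes -e2.
    by rewrite (negPf np).
  suff e1 : (p.1 < b.1) = (p.1 < a.1).
    apply: nearbyT => x; rewrite !crossing_horizontal // /passes -e2 ep e1.
    by rewrite subrr.
  have [d0|d0] := eqVneq a.1 b.1; first by rewrite d0.
  pose s := (p.1 - a.1) / (b.1 - a.1).
  have sE : s * (b.1 - a.1) = p.1 - a.1.
    by rewrite /s mulfVK // subr_eq0 eq_sym.
  have H : ~ (0 <= s <= 1).
    move=> s01; apply: nab; exists s => //; apply: point_eq => /=.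
      by rewrite sE; ring.
    by rewrite -e2 -ep; ring.
  clearbody s; apply/idP/idP => h; rewrite ltNge; apply/negP => h'; apply: H;
    apply/andP; split.
  - have [k|k] := ltP a.1 b.1; first by nra.
    by nra.
  - by nra.
  - by nra.
  - by nra.
have {ne}ab : a.2 < b.2 by rewrite lt_neqAle ne.
have nx : a.2 <= p.2 <= b.2 -> cross (b - a) (p - a) != 0.
  move=> /andP[h1 h2]; apply/eqP; rewrite crossE => h; apply: nab.
  exists ((p.2 - a.2) / (b.2 - a.2)).
    rewrite divr_ge0 ?subr_ge0 ?(ltW ab) //=.
    by rewrite ler_pdivrMr ?subr_gt0 // mul1r; lra.
  have b0 : b.2 - a.2 != 0 by rewrite subr_eq0 gt_eqF.
  apply: point_eq => /=; last by field.
  apply: (mulfI b0); apply/eqP; rewrite -subr_eq0; apply/eqP.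
  rewrite (_ : _ - _ = - ((b.1 - a.1) * (p.2 - a.2) - (b.2 - a.2) * (p.1 - a.1))).
    by rewrite h oppr0.
  by field.
have [h|h] := ltP p.2 a.2.
  apply: nearbyW (nearby_lt2 h) => x hx; rewrite !crossing_up // /passes.
  rewrite [a.2 <= x.2]leNgt hx [a.2 <= p.2]leNgt h.
  have pb : (b.2 == p.2) = false by rewrite gt_eqF // (lt_trans h).
  by rewrite (gt_eqF h) pb.
have [k|k] := ltP b.2 p.2.
  apply: nearbyW (nearby_gt2 k) => x hx; rewrite !crossing_up // /passes.
  rewrite [x.2 < b.2]ltNge (ltW hx) [p.2 < b.2]ltNge (ltW k).
  by rewrite (lt_eqF k) (lt_eqF (lt_trans ab k)) /= !andbF.
have {}nx := nx (introT andP (conj h k)).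
have [c0|c0] := ltP 0 (cross (b - a) (p - a)); last first.
  have {nx}c0 : cross (b - a) (p - a) < 0 by rewrite lt_neqAle nx.
  apply: nearbyW (nearby_cross_lt0 c0) => x hx; rewrite !crossing_up // /passes.
  rewrite !ltNge (ltW hx) (ltW c0) !andbF /=.
  move: c0; rewrite crossE => c0.
  have -> : ((b.2 == p.2) && ~~ (b.1 <= p.1)) = false.
    by apply/negP => /andP[/eqP e]; rewrite -ltNge => ?; rewrite -e in c0; nra.
  have -> // : ((a.2 == p.2) && ~~ (a.1 <= p.1)) = false.
  by apply/negP => /andP[/eqP e]; rewrite -ltNge => ?; rewrite -e in c0; nra.
have [e|nea] := eqVneq a.2 p.2.
  have pb : p.2 < b.2 by rewrite -e.
  apply: nearby2 (nearby_cross_gt0 c0) (nearby_lt2 pb) => x hx hx2.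
  rewrite !crossing_up // /passes hx c0 !andbT hx2 pb e lexx eqxx (gt_eqF pb) /=.
  have -> : p.1 < a.1 by move: c0; rewrite crossE e; nra.
  by rewrite /= leNgt; case: (x.2 < p.2).
have ap : a.2 < p.2 by rewrite lt_neqAle nea.
have [e|neb] := eqVneq b.2 p.2.
  apply: nearby2 (nearby_cross_gt0 c0) (nearby_gt2 ap) => x hx hx2.
  rewrite !crossing_up // /passes hx c0 !andbT (ltW hx2) (ltW ap) e ltxx eqxx /=.
  rewrite (negPf nea) /=.
  have -> : p.1 < b.1 by move: c0; rewrite crossE -e; nra.
  by rewrite subr0 add0r.
have pb : p.2 < b.2 by rewrite lt_neqAle eq_sym neb.
apply: nearby2 (nearby_cross_gt0 c0) (nearby_and (nearby_gt2 ap) (nearby_lt2 pb)).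
move=> x hx [hx1 hx2].
rewrite !crossing_up // /passes hx c0 (ltW hx1) hx2 (ltW ap) pb.
by rewrite (negPf nea) (negPf neb).
Qed.

(** The winding number gains 1 when a side is crossed from right to left. A side that is not
    horizontal shows this in its own crossing. A horizontal side is never counted, and its jump is
    carried by the [passes] terms of its end points, whence the constant -1 for a side running to
    the right. *)
Lemma crossing_near_side a b (s : R) : a != b -> 0 < s < 1 ->
  exists C : int, nearby (lerp s a b) (fun x => cross (b - a) (x - a) != 0 ->
    crossing a b x = C + (passes (lerp s a b) b x - passes (lerp s a b) a x)
                     + (0 < cross (b - a) (x - a))%R%:Z).
Proof.
wlog ab : a b s / a.2 <= b.2.
  move=> H nab s01; have [ab|ba] := leP a.2 b.2; first exact: H.
  have [||C HC] := H b a (1 - s) (ltW ba); first by rewrite eq_sym.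
    by lra.
  have e : lerp (1 - s) b a = lerp s a b by apply: point_eq => /=; ring.
  rewrite e in HC; exists (- C - 1); apply: nearbyW HC => x hx n0.
  have ex : cross (a - b) (x - b) = - cross (b - a) (x - a).
    by rewrite !crossE; ring.
  rewrite (crossing_anti b a) hx ?ex ?oppr_eq0 // oppr_gt0.
  by case: ltgtP n0 => //= _ _; ring.
set p := lerp s a b; move=> nab /andP[s0 s1].
have [e2|ne] := eqVneq a.2 b.2.
  have p2 : p.2 = a.2 by rewrite /p /= -e2; ring.
  have n1 : a.1 != b.1.
    by apply: contra nab => /eqP e1; apply/eqP/point_eq.
  have cE x : cross (b - a) (x - a) = (b.1 - a.1) * (x.2 - p.2).
    by rewrite crossE -e2 p2; ring.
  exists (if a.1 < b.1 then -1 else 0); apply: nearbyT => x; rewrite cE => n0.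
  rewrite crossing_horizontal // /passes p2 e2 eqxx /=.
  have np : x.2 != b.2.
    by apply: contra n0 => /eqP e; rewrite p2 e2 e subrr mulr0.
  have := n1; rewrite neq_lt => /orP[h|h].
    have -> : p.1 < b.1 by rewrite /p /=; nra.
    have -> : p.1 < a.1 = false by apply/negbTE; rewrite -leNgt /p /=; nra.
    rewrite h pmulr_rgt0 ?subr_gt0 //=.
    by move: np; rewrite neq_lt; have [] := ltgtP x.2 b.2.
  have -> : p.1 < b.1 = false by apply/negbTE; rewrite -leNgt /p /=; nra.
  have -> : p.1 < a.1 by rewrite /p /=; nra.
  rewrite ltNge (ltW h) nmulr_rgt0 ?subr_lt0 //=.
  by move: np; rewrite neq_lt; have [] := ltgtP x.2 b.2.
have {ne}ab : a.2 < b.2 by rewrite lt_neqAle ne.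
have ap : a.2 < p.2 by rewrite /p /=; nra.
have pb : p.2 < b.2 by rewrite /p /=; nra.
exists 0; apply: nearby2 (nearby_gt2 ap) (nearby_lt2 pb) => x h1 h2 _.
rewrite crossing_up // (ltW h1) h2 /passes (lt_eqF ap) (gt_eqF pb) /=.
by rewrite subrr !add0r.
Qed.

Lemma sum_passes P p x :
  \sum_(i < size P) (passes p (vtx P i.+1) x - passes p (vtx P i) x) = 0.
Proof.
rewrite -(big_mkord xpredT
  (fun i => passes p (vtx P i.+1) x - passes p (vtx P i) x)).
by rewrite telescope_sumr // /vtx modnn mod0n subrr.
Qed.

Lemma winding_near P p : ~ on_bd P p ->
  nearby p (fun x => winding P x = winding P p).
Proof.
move=> np.
have /nearby_all : forall i : 'I_(size P), i \in enum 'I_(size P) ->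
    nearby p (fun x => crossing (vtx P i) (vtx P i.+1) x =
      crossing (vtx P i) (vtx P i.+1) p
      + (passes p (vtx P i.+1) x - passes p (vtx P i) x)).
  move=> i _; apply: crossing_near => -[s s01 e]; apply: np.
  by exists i, s.
apply: nearbyW => x H; rewrite /winding.
rewrite (eq_bigr _ (fun i _ => H i (mem_enum _ i))) big_split /=.
by rewrite sum_passes addr0.
Qed.

Definition ev (Q : R -> Prop) : Prop :=
  exists2 e : R, 0 < e & forall t, 0 < t < e -> Q t.

Lemma ev_and Q Q' : ev Q -> ev Q' -> ev (fun t => Q t /\ Q' t).
Proof.
move=> [e e0 H] [e' e'0 H']; exists (Num.min e e'); first by rewrite lt_min e0.
by move=> t /andP[t0]; rewrite lt_min => /andP[? ?]; split; [apply: H|apply: H'];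
  apply/andP.
Qed.

Lemma evW (Q Q' : R -> Prop) : (forall t, 0 < t -> Q t -> Q' t) -> ev Q -> ev Q'.
Proof.
by move=> QQ' [e e0 H]; exists e => // t /andP[t0 te]; apply: QQ' => //;
  apply: H; apply/andP.
Qed.

Lemma ev_all (I : eqType) (s : seq I) (Q : I -> R -> Prop) :
  (forall i, i \in s -> ev (Q i)) -> ev (fun t => forall i, i \in s -> Q i t).
Proof.
elim: s => [|i s IHs] H; first by exists 1.
have Hi := H i (mem_head _ _).
have Hs : ev (fun t => forall j, j \in s -> Q j t).
  by apply: IHs => j js; apply: H; rewrite inE js orbT.
by apply: evW (ev_and Hi Hs) => t _ [Qi Qs] j; rewrite inE => /orP[/eqP-> //|];
  apply: Qs.
Qed.

Lemma ev_quad0 (c k l : R) : 0 < c -> ev (fun t => 0 < c + k * t + l * t ^+ 2).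
Proof.
move=> c0; have d0 : 0 < `|k| + `|l| + 1.
  by have := normr_ge0 k; have := normr_ge0 l; lra.
exists (Num.min 1 (c / (`|k| + `|l| + 1))); first by rewrite lt_min ltr01 divr_gt0.
move=> t /andP[t0]; rewrite lt_min => /andP[t1].
rewrite ltr_pdivlMr // => h.
have := normr_ge0 l; have := ler_norm (- k); have := ler_norm (- l).
rewrite !normrN => h1 h2 h3.
have tt : t ^+ 2 <= t by rewrite expr2; nra.
have t2 : 0 <= t ^+ 2 by rewrite sqr_ge0.
have : - l * t ^+ 2 <= `|l| * t by nra.
have : - k * t <= `|k| * t by nra.
lra.
Qed.

Lemma ev_quad1 (k l : R) : 0 < k -> ev (fun t => 0 < k * t + l * t ^+ 2).
Proof.
move=> k0; apply: evW (ev_quad0 l 0 k0) => t t0; rewrite mul0r addr0 => h.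
by rewrite expr2 mulrA -mulrDl mulr_gt0.
Qed.

(** [crossing] keeps lower end points and does not count points on a side, so a step to the right
    and slightly up changes no crossing. The square makes the upward part negligible whatever the
    slope of a side, and no line contains an arc of this parabola. *)
Definition bump x (t : R) : point R := (x.1 + t, x.2 + t ^+ 2).

Lemma cross_bump a b x t : cross (b - a) (bump x t - a) =
  cross (b - a) (x - a) + - (b.2 - a.2) * t + (b.1 - a.1) * t ^+ 2.
Proof. by rewrite !crossE /=; ring. Qed.

Lemma crossing_bump a b x : ev (fun t => crossing a b (bump x t) = crossing a b x).
Proof.
wlog ab : a b / a.2 <= b.2.
  move=> H; have [ab|ba] := leP a.2 b.2; first exact: H.
  by apply: evW (H b a (ltW ba)) => t _; rewrite !(crossing_anti b a) => ->.
have [e2|ne] := eqVneq a.2 b.2.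
  by exists 1 => // t _; rewrite !crossing_horizontal.
have {ne}ab : a.2 < b.2 by rewrite lt_neqAle ne.
have t2 (t : R) : 0 < t -> 0 < t ^+ 2 by move=> ?; rewrite exprn_gt0.
have [xa|ax] := ltP x.2 a.2.
  have h0 : 0 < a.2 - x.2 by lra.
  apply: evW (ev_quad0 0 (-1) h0) => t _; rewrite mul0r addr0 => h.
  rewrite !crossing_up // [a.2 <= x.2]leNgt xa [a.2 <= _]leNgt.
  by have -> : (bump x t).2 < a.2 by rewrite /=; lra.
have [bx|xb] := leP b.2 x.2.
  exists 1 => // t /andP[t0 _].
  rewrite !crossing_up // [x.2 < b.2]ltNge bx [_ < b.2]ltNge /=.
  have -> : b.2 <= x.2 + t ^+ 2 by have := t2 t t0; lra.
  by rewrite !andbF.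
have h0 : 0 < b.2 - x.2 by lra.
have h := evW _ (ev_quad0 0 (-1) h0).
have {h}H : ev (fun t => a.2 <= (bump x t).2 < b.2).
  apply: h => t t0; rewrite mul0r addr0 => h; have := t2 t t0 => ?.
  by apply/andP; split; rewrite /=; lra.
have [c0|c0] := ltP 0 (cross (b - a) (x - a)).
  apply: evW (ev_and H (ev_quad0 (- (b.2 - a.2)) (b.1 - a.1) c0)) => t _ [h1 h2].
  by rewrite !crossing_up // h1 cross_bump h2 c0 ax xb.
have k0 : 0 < b.2 - a.2 by rewrite subr_gt0.
apply: evW (ev_and H (ev_quad1 (- (b.1 - a.1)) k0)) => t _ [h1 h2].
rewrite !crossing_up // h1 ax xb [0 < cross _ (x - a)]ltNge c0 /=.
by have -> // : (0 < cross (b - a) (bump x t - a)) = false;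
  apply/negbTE; rewrite -leNgt cross_bump; lra.
Qed.

Lemma off_seg_bump a b x : a != b -> ev (fun t => ~ on_seg a b (bump x t)).
Proof.
move=> nab.
suff : ev (fun t => cross (b - a) (bump x t - a) != 0).
  by apply: evW => t _ /eqP n0 [s _ e]; apply: n0; rewrite e lerp_cross.
(* For small positive t a quadratic has the sign of its first nonzero coefficient; here the last two
   coefficients vanish together only if [a = b]. *)
have pos (c k l : R) : 0 < c \/ c = 0 /\ (0 < k \/ k = 0 /\ 0 < l) ->
    ev (fun t => 0 < c + k * t + l * t ^+ 2).
  case=> [/ev_quad0//|[-> [/(ev_quad1 l)|[-> l0]]]].
    by apply: evW => t _; rewrite add0r.
  by exists 1 => // t /andP[t0 _]; rewrite mul0r !add0r mulr_gt0 // exprn_gt0.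
set c := cross (b - a) (x - a); set k := - (b.2 - a.2); set l := b.1 - a.1.
have [H|H] : (0 < c \/ c = 0 /\ (0 < k \/ k = 0 /\ 0 < l)) \/
             (0 < - c \/ - c = 0 /\ (0 < - k \/ - k = 0 /\ 0 < - l)).
- have [?|?|->] := ltgtP c 0; [by right; left; lra|by left; left|].
  have [?|?|k0] := ltgtP k 0; [by right; right; split; lra|by left; right; lra|].
  have [?|?|l0] := ltgtP l 0; last 1 first.
  + by case/eqP: nab; apply: point_eq; rewrite /k /l in k0 l0; lra.
  + by right; right; split; [lra|right; lra].
  + by left; right; split; [lra|right; lra].
- apply: evW (pos _ _ _ H) => t _ h; rewrite cross_bump -/c -/k -/l.
  by rewrite gt_eqF.
- apply: evW (pos _ _ _ H) => t _ h; rewrite cross_bump -/c -/k -/l.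
  by rewrite lt_eqF //; lra.
Qed.

Lemma line_param a b p : a != b -> cross (b - a) (p - a) = 0 ->
  let u := b - a in let D := u.1 ^+ 2 + u.2 ^+ 2 in
  0 < D /\ exists s, p = lerp s a b.
Proof.
move=> nab c u D.
have u2 : u.1 != 0 \/ u.2 != 0.
  have [e1|] := eqVneq u.1 0; last by left.
  have [e2|] := eqVneq u.2 0; last by right.
  by case/eqP: nab; apply: point_eq; move: e1 e2 => /=; lra.
have D0 : 0 < D.
  by case: u2 => h; [apply: ltr_wpDr|apply: ltr_wpDl]; rewrite ?sqr_ge0 //;
    rewrite lt_neqAle eq_sym sqrf_eq0 h sqr_ge0.
split=> //; pose s := (u.1 * (p.1 - a.1) + u.2 * (p.2 - a.2)) / D.
have sD : s * D = u.1 * (p.1 - a.1) + u.2 * (p.2 - a.2).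
  by rewrite /s mulfVK // gt_eqF.
exists s; move: c; rewrite crossE => c; have D1 := lt0r_neq0 D0.
have e1 : D * p.1 = D * (a.1 + s * (b.1 - a.1)).
  rewrite [RHS](_ : _ = D * a.1 + (s * D) * (b.1 - a.1)); last by ring.
  rewrite sD /D /u /=; have := congr1 (fun z => (b.2 - a.2) * z) c.
  by move=> /= ?; lra.
have e2 : D * p.2 = D * (a.2 + s * (b.2 - a.2)).
  rewrite [RHS](_ : _ = D * a.2 + (s * D) * (b.2 - a.2)); last by ring.
  rewrite sD /D /u /=; have := congr1 (fun z => (b.1 - a.1) * z) c.
  by move=> /= ?; lra.
by apply: point_eq; apply: (mulfI D1).
Qed.

Lemma off_seg_near a b p : a != b -> ~ on_seg a b p ->
  nearby p (fun x => ~ on_seg a b x).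
Proof.
move=> nab np; pose u := b - a; pose D := u.1 ^+ 2 + u.2 ^+ 2.
have [c|c|c] := ltgtP 0 (cross u (p - a)).
- by apply: nearbyW (nearby_cross_gt0 c) => x h [s _ e]; move: h;
    rewrite e lerp_cross ltxx.
- by apply: nearbyW (nearby_cross_lt0 c) => x h [s _ e]; move: h;
    rewrite e lerp_cross ltxx.
have [D0 [s pE]] := line_param nab (esym c); rewrite -/u -/D in D0.
have dotE x r : x = lerp r a b -> u.1 * (x.1 - a.1) + u.2 * (x.2 - a.2) = r * D.
  by move=> ->; rewrite /D /u /=; ring.
have sD := esym (dotE p s pE).
have [s0|s0] := ltP s 0.
  have h : 0 < - u.1 * p.1 + - u.2 * p.2 + (u.1 * a.1 + u.2 * a.2).
    have : s * D < 0 by rewrite nmulr_rlt0.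
    by rewrite sD; lra.
  apply: nearbyW (nearby_affine h) => x hx [t /andP[t0 _] /dotE e].
  have : 0 <= t * D by rewrite mulr_ge0 // ltW.
  by rewrite -e; lra.
have [s1|s1] := leP s 1; first by case: np; exists s; rewrite ?s0.
have h : 0 < u.1 * p.1 + u.2 * p.2 + (- u.1 * a.1 - u.2 * a.2 - D).
  have : 0 < (s - 1) * D by rewrite mulr_gt0 // subr_gt0.
  by rewrite mulrBl sD; lra.
apply: nearbyW (nearby_affine h) => x hx [t /andP[_ t1] /dotE e].
have : 0 <= (1 - t) * D by rewrite mulr_ge0 ?subr_ge0 // ltW.
by rewrite mulrBl -e; lra.
Qed.

Lemma vtx_neq P i : simple_bd P -> (i < size P)%N -> vtx P i != vtx P i.+1.
Proof.
move=> [sz H] iP; apply/eqP => e.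
have jP : (i.+1 %% size P < size P)%N by rewrite ltn_mod; lia.
have [|||e'] := H i (i.+1 %% size P)%N 0 0 iP jP; rewrite ?lexx ?ltr01 //.
  rewrite /bd /lerp !mul0r !addr0 -!surjective_pairing {}e.
  by rewrite /vtx modn_mod.
have [h|h] := eqVneq i.+1 (size P); first by move: e'; rewrite h modnn; lia.
by rewrite modn_small in e'; lia.
Qed.

(* [winding P] at [x] is its value at an interior or exterior point next to [x],
   on the parabola [bump x]. *)
Lemma winding01 P x : is_polygon P -> winding P x = 0 \/ winding P x = 1.
Proof.
move=> [sP H].
have H1 : ev (fun t => forall i, i \in enum 'I_(size P) ->
    crossing (vtx P i) (vtx P i.+1) (bump x t) =
    crossing (vtx P i) (vtx P i.+1) x).
  by apply: ev_all => i _; apply: crossing_bump.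
have H2 : ev (fun t => forall i, i \in enum 'I_(size P) ->
    ~ on_seg (vtx P i) (vtx P i.+1) (bump x t)).
  by apply: ev_all => i _; apply: off_seg_bump; apply: vtx_neq.
have [e e0 He] := ev_and H1 H2.
have [|h1 h2] := He (e / 2); first by apply/andP; split; lra.
have -> : winding P x = winding P (bump x (e / 2)).
  by apply: eq_bigr => i _; rewrite h1 // mem_enum.
apply: H => -[i [s [iP s01 E]]]; apply: (h2 (Ordinal iP)); first exact: mem_enum.
by exists s.
Qed.

Lemma bd_other_side P i j (s : R) : simple_bd P -> (i < size P)%N ->
  (j < size P)%N -> 0 < s < 1 -> j != i ->
  ~ on_seg (vtx P j) (vtx P j.+1) (bd P i s).
Proof.
move=> [sz H] iP jP /andP[s0 s1] /eqP ji [t /andP[t0 t1] e].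
have s01 : 0 <= s < 1 by rewrite ltW.
(* Simplicity is stated for half-open sides, so the end point t = 1 is read as the point of
   parameter 0 of the following side. *)
move: t1; rewrite le_eqVlt => /orP[/eqP e1|t1].
  have kP : (j.+1 %% size P < size P)%N by rewrite ltn_mod; lia.
  have [||_ s0'] := H i (j.+1 %% size P)%N s 0 iP kP s01; rewrite ?lexx ?ltr01 //.
    rewrite e e1 /bd /lerp !mul0r !addr0 !mul1r.
    apply: point_eq; rewrite /= /vtx modn_mod; ring.
  by rewrite s0' ltxx in s0.
by case: (H i j s t iP jP s01 _ e) => [|ij _]; [rewrite t0 t1|case: ji].
Qed.

(** Near the side the winding number is some constant W on the right and W + 1 on the left. Both
    values lie in {0, 1} by [winding01], hence W = 0. *)
Lemma winding_near_side P i (s : R) : is_polygon P -> (i < size P)%N ->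
  0 < s < 1 ->
  nearby (bd P i s) (fun x =>
    let c := cross (side_vec P i) (x - vtx P i) in
    (0 < c -> winding P x = 1 /\ ~ on_bd P x) /\
    (c < 0 -> winding P x = 0 /\ ~ on_bd P x)).
Proof.
move=> PP iP s01; set p := bd P i s.
have sP : simple_bd P by case: PP.
pose i0 := Ordinal iP.
have nab := vtx_neq sP iP.
have [C HC] := crossing_near_side nab s01.
have /nearby_all HO : forall j : 'I_(size P),
    j \in [seq j <- enum 'I_(size P) | j != i0] ->
    nearby p (fun x => crossing (vtx P j) (vtx P j.+1) x =
      crossing (vtx P j) (vtx P j.+1) p
      + (passes p (vtx P j.+1) x - passes p (vtx P j) x)).
  move=> j; rewrite mem_filter => /andP[ji _].
  by apply: crossing_near; apply: bd_other_side.
have /nearby_all HS : forall j : 'I_(size P),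
    j \in [seq j <- enum 'I_(size P) | j != i0] ->
    nearby p (fun x => ~ on_seg (vtx P j) (vtx P j.+1) x).
  move=> j; rewrite mem_filter => /andP[ji _].
  by apply: off_seg_near; [apply: vtx_neq|apply: bd_other_side].
have HW : nearby p (fun x => cross (side_vec P i) (x - vtx P i) != 0 ->
    winding P x = C + (\sum_(j < size P | j != i0) crossing (vtx P j) (vtx P j.+1) p)
                + (0 < cross (side_vec P i) (x - vtx P i))%R%:Z).
  apply: nearby2 HC HO => x h1 h2 n0.
  rewrite /winding (bigD1 i0) //= h1 // (eq_bigr _ (fun j ji => h2 j _)).
    have := sum_passes P p x; rewrite (bigD1 i0) //= => e.
    move/eqP: e; rewrite addr_eq0 => /eqP->.
    by rewrite [X in _ + X]big_split /=; ring.
  by move=> j ji; rewrite mem_filter ji mem_enum.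
set W := C + _ in HW.
have {}W0 : W = 0.
  have n0 : side_vec P i != 0 by rewrite subr_eq0 eq_sym.
  have aE x : cross (side_vec P i) (x - p) = cross (side_vec P i) (x - vtx P i).
    exact: cross_lerp.
  have [x [hx]] := nearby_left n0 HW; rewrite aE => cx.
  have [y [hy]] := nearby_right n0 HW; rewrite aE => cy.
  have := hx (lt0r_neq0 cx); have := hy (ltr0_neq0 cy).
  rewrite cx ltNge (ltW cy) /= addr0.
  move=> ey ex; have := winding01 x PP; have := winding01 y PP.
  by rewrite ex ey; clearbody W; clear; lia.
rewrite {}W0 in HW; apply: nearby2 HW (nearby_and HS HC) => x hx [hS _] /=.
have off : cross (side_vec P i) (x - vtx P i) != 0 -> ~ on_bd P x.
  move=> n0 [j [t [jP t01 e]]]; have [ji|ji] := eqVneq j i.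
    by move/eqP: n0; apply; rewrite e ji lerp_cross.
  apply: (hS (Ordinal jP)); last by exists t.
  by rewrite mem_filter mem_enum andbT; apply: contra ji => /eqP [->].
split=> c0; split.
- by rewrite hx ?lt0r_neq0 // c0.
- by apply: off; rewrite lt0r_neq0.
- by rewrite hx ?ltr0_neq0 // ltNge ltW.
- by apply: off; rewrite ltr0_neq0.
Qed.

End Winding.

(** * Polygons as lists of labelled oriented edges *)

Section Edges.
Variable R : realType.
Implicit Types (a b p q v x z : point R) (P Q s : polygon R) (l : letter).

(* Source, label and target. *)
Definition edge : Type := (point R * letter * point R)%type.
Implicit Types (e : edge) (E : seq edge).

Definition start z s : point R := if s is c :: _ then c.1 else z.

(** A path with prescribed final point [z]. Unlike the cyclic list [edges], such lists can be
    concatenated, as is needed when a polygon is cut along a diagonal. *)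
Fixpoint open_edges s z : seq edge :=
  if s is c :: s' then (c, start z s') :: open_edges s' z else [::].

Definition edges P : seq edge := open_edges P (start 0 P).

Lemma size_open_edges s z : size (open_edges s z) = size s.
Proof. by elim: s => //= c s ->. Qed.

Lemma size_edges P : size (edges P) = size P.
Proof. exact: size_open_edges. Qed.

Lemma open_edges_cat s s' z :
  open_edges (s ++ s') z = open_edges s (start z s') ++ open_edges s' z.
Proof. by elim: s => //= c [|d s] ->. Qed.

Lemma nth_open_edges d0 c0 s z i : (i < size s)%N ->
  nth d0 (open_edges s z) i =
  (nth c0 s i, if (i.+1 < size s)%N then (nth c0 s i.+1).1 else z).
Proof.
elim: s i => //= c s IHs [_|i]; first by case: s {IHs}.
by rewrite ltnS => iS; rewrite -[LHS]/(nth d0 (open_edges s z) i) IHs.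
Qed.

Lemma nth_edges d0 P i : (i < size P)%N ->
  nth d0 (edges P) i = (vtx P i, lab P i, vtx P i.+1).
Proof.
move=> iP; rewrite /edges (nth_open_edges d0 (0, (0%N, true))) //.
rewrite /vtx /lab modn_small // -surjective_pairing.
case: ifP => h; first by rewrite modn_small.
have -> : i.+1 = size P by lia.
by rewrite modnn; case: P iP {h}.
Qed.

Lemma edgesE P : edges P = [seq (vtx P i, lab P i, vtx P i.+1) | i <- iota 0 (size P)].
Proof.
apply: (@eq_from_nth _ (0, (0%N, true), 0)); rewrite size_edges ?size_map ?size_iota //.
by move=> i iP; rewrite nth_edges // (nth_map 0%N) ?size_iota // nth_iota.
Qed.

Lemma edgesP P e :
  reflect (exists2 i, (i < size P)%N & e = (vtx P i, lab P i, vtx P i.+1))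
          (e \in edges P).
Proof.
rewrite edgesE; apply: (iffP mapP) => -[i].
  by rewrite mem_iota /= => iP ->; exists i.
by move=> iP ->; exists i => //; rewrite mem_iota.
Qed.

Definition wind E x : int := \sum_(e <- E) crossing e.1.1 e.2 x.

Lemma windingE P x : winding P x = wind (edges P) x.
Proof. by rewrite /wind edgesE big_map -{1}[size P]subn0 big_mkord. Qed.

Lemma wind_cat E E' x : wind (E ++ E') x = wind E x + wind E' x.
Proof. exact: big_cat. Qed.

Lemma wind_perm E E' x : perm_eq E E' -> wind E x = wind E' x.
Proof. exact: perm_big. Qed.

Definition side_of e : letter * point R := (e.1.2, e.2 - e.1.1).

Lemma sidesE (S : seq (polygon R)) :
  sides S = flatten [seq [seq side_of e | e <- edges P] | P <- S].
Proof.
rewrite /sides; congr flatten; apply: eq_map => P.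
by rewrite edgesE -map_comp.
Qed.

Lemma side_mem (S : seq (polygon R)) i e :
  (i < size S)%N -> e \in edges (nth [::] S i) -> side_of e \in sides S.
Proof.
move=> iS eS; rewrite sidesE; apply/flatten_mapP; exists (nth [::] S i).
  exact: mem_nth.
exact: map_f.
Qed.

Lemma side_memP (S : seq (polygon R)) w : w \in sides S ->
  exists i e, [/\ (i < size S)%N, e \in edges (nth [::] S i) & w = side_of e].
Proof.
rewrite sidesE => /flatten_mapP[P PS /mapP[e eP ->]].
exists (index P S), e; rewrite index_mem PS nth_index //.
Qed.

Lemma edges_rot k P : perm_eq (edges (rot k P)) (edges P).
Proof.
rewrite -{2}(cat_take_drop k P) /rot.
case: (take k P) => [|c s]; first by rewrite cats0.
case: (drop k P) => [|d t]; first by rewrite cats0.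
rewrite /edges !open_edges_cat.
exact: (permEl (perm_catC (open_edges (d :: t) c.1) (open_edges (c :: s) d.1))).
Qed.

Definition shift_edge v e : edge := (e.1.1 + v, e.1.2, e.2 + v).

Lemma edges_translate v P : edges (translate v P) = map (shift_edge v) (edges P).
Proof.
have H s z : open_edges (translate v s) (z + v) = map (shift_edge v) (open_edges s z).
  by elim: s => //= c [|d s] ->.
case: P => // c s; exact: (H (c :: s) c.1).
Qed.

Definition relabel_edge (f : letter -> letter) e : edge := (e.1.1, f e.1.2, e.2).

Lemma edges_relabel f P : edges (relabel f P) = map (relabel_edge f) (edges P).
Proof.
have H s z : open_edges (relabel f s) z = map (relabel_edge f) (open_edges s z).
  by elim: s => //= c [|d s] ->.
case: P => // c s; exact: (H (c :: s) c.1).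
Qed.

Lemma crossing_shift a b x v : crossing (a + v) (b + v) (x + v) = crossing a b x.
Proof.
rewrite /crossing (_ : b + v - (a + v) = b - a); last first.
  by apply: point_eq => /=; ring.
rewrite (_ : x + v - (a + v) = x - a); last by apply: point_eq => /=; ring.
by rewrite !lerD2r !ltrD2r.
Qed.

Lemma wind_shift E v x : wind (map (shift_edge v) E) (x + v) = wind E x.
Proof. by rewrite /wind big_map; apply: eq_bigr => e _; exact: crossing_shift. Qed.

Definition cut_edge (m m' : nat) (t : R) e : seq edge :=
  let c := lerp t e.1.1 e.2 in let c' := lerp (1 - t) e.1.1 e.2 in
  if e.1.2 == (m, true) then [:: (e.1.1, (m, true), c); (c, (m', true), e.2)]
  else if e.1.2 == (m, false) then
    [:: (e.1.1, (m', false), c'); (c', (m, false), e.2)]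
  else [:: e].

Lemma edges_split m m' t P :
  edges (split_side m m' t P) = flatten [seq cut_edge m m' t e | e <- edges P].
Proof.
pose g e := [seq d.1 | d <- cut_edge m m' t e].
have -> : split_side m m' t P = flatten [seq g e | e <- edges P].
  rewrite /split_side edgesE -map_comp; congr flatten; apply: eq_map => i /=.
  by rewrite /g /cut_edge /=; case: ifP => // _; case: ifP.
have st s z z' : start z' (flatten [seq g e | e <- open_edges s z]) = start z' s.
  by case: s => //= c s; rewrite /g /cut_edge; case: ifP => // _; case: ifP.
rewrite {1}/edges st /edges; move: (start 0 P) => z0.
elim: P => //= c s IHs; rewrite -{}IHs /g /cut_edge /=.
case: ifP => _ /=; first by rewrite st.
by case: ifP => _ /=; rewrite st // -surjective_pairing.
Qed.

(** With lower end points kept and upper ones dropped, the height intervals of the two halves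
    partition that of the whole side, so this holds at every [x]. *)
Lemma crossing_split (t : R) a b x : 0 < t < 1 ->
  crossing a (lerp t a b) x + crossing (lerp t a b) b x = crossing a b x.
Proof.
move=> t01; set c := lerp t a b.
wlog ab : a b t t01 @c / a.2 <= b.2.
  move=> H; have [ab|ba] := leP a.2 b.2; first exact: H.
  have t01' : 0 < 1 - t < 1 by lra.
  have := H b a (1 - t) t01' (ltW ba).
  have -> : lerp (1 - t) b a = c by apply: point_eq => /=; ring.
  rewrite (crossing_anti c b) (crossing_anti a c) (crossing_anti a b).
  by rewrite -opprD addrC => /oppr_inj.
case/andP: t01 => t0 t1; have [e|ne] := eqVneq a.2 b.2.
  by rewrite !crossing_horizontal // /c /= e; ring.
have {ne}ab : a.2 < b.2 by rewrite lt_neqAle ne.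
have ac : a.2 < c.2 by rewrite /c /=; nra.
have cb : c.2 < b.2 by rewrite /c /=; nra.
rewrite !crossing_up //.
have -> : (0 < cross (c - a) (x - a)) = (0 < cross (b - a) (x - a)).
  rewrite (_ : cross (c - a) _ = t * cross (b - a) (x - a)) ?pmulr_rgt0 //.
  by rewrite /cross /c /=; ring.
have -> : (0 < cross (b - c) (x - c)) = (0 < cross (b - a) (x - a)).
  rewrite (_ : cross (b - c) _ = (1 - t) * cross (b - a) (x - a)).
    by rewrite pmulr_rgt0 // subr_gt0.
  by rewrite /cross /c /=; ring.
have [h|h] := leP a.2 x.2; last first.
  by rewrite [c.2 <= x.2]leNgt (lt_trans h ac).
have [h'|h'] := ltP x.2 c.2; first by rewrite (lt_trans h' cb) /= addr0.
by rewrite /= add0r.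
Qed.

Lemma winding_split m m' (t : R) P x : 0 < t < 1 ->
  winding (split_side m m' t P) x = winding P x.
Proof.
move=> t01; rewrite !windingE edges_split /wind big_flatten big_map.
apply: eq_bigr => e _; rewrite /cut_edge.
case: ifP => _; first by rewrite big_cons big_seq1 /= crossing_split.
have t01' : 0 < 1 - t < 1 by lra.
case: ifP => _; first by rewrite big_cons big_seq1 /= crossing_split.
by rewrite big_seq1.
Qed.

Lemma edges_cut a b (y z : letter) s1 s2 :
  [/\ edges (((a, y) :: s1) ++ ((b, z) :: s2)) =
        open_edges ((a, y) :: s1) b ++ open_edges ((b, z) :: s2) a,
      forall w, edges (rcons ((a, y) :: s1) (b, w)) =
        rcons (open_edges ((a, y) :: s1) b) (b, w, a) &
      forall w, edges (rcons ((b, z) :: s2) (a, w)) =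
        rcons (open_edges ((b, z) :: s2) a) (a, w, b)].
Proof.
split=> [|w|w]; first by rewrite {1}/edges open_edges_cat.
  by rewrite /edges -!cats1 open_edges_cat.
by rewrite /edges -!cats1 open_edges_cat.
Qed.

(** The diagonal is run once in each direction and its two crossings cancel. *)
Lemma winding_cut a b (x y z : letter) s1 s2 p :
  winding (((a, x) :: s1) ++ ((b, y) :: s2)) p =
  winding (rcons ((a, x) :: s1) (b, z)) p +
  winding (rcons ((b, y) :: s2) (a, inv z)) p.
Proof.
have [e1 e2 e3] := edges_cut a b x y s1 s2.
rewrite !windingE e1 e2 e3 -!cats1 !wind_cat /wind !big_seq1 /=.
by rewrite (crossing_anti a b p); ring.
Qed.

Lemma on_bdE P x : on_bd P x <-> exists2 e, e \in edges P & on_seg e.1.1 e.2 x.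
Proof.
split=> [[i [s [iP s01 ->]]]|[e /edgesP[i iP ->] [s s01 ->]]]; last by exists i, s.
by exists (vtx P i, lab P i, vtx P i.+1); [apply/edgesP; exists i|exists s].
Qed.

End Edges.

(** * Branched covers of the torus *)

Section Structures.
Variables (R : realType) (A : zmodType) (u : A).
Implicit Types (a b p q v x z : point R) (P Q : polygon R) (S T : seq (polygon R)).
Implicit Types (l : letter) (e : edge R) (d : bool) (K : A).

(* The lattice spanned by (1, 1) and (1, -1): the period lattice of the torus
   made of two unit squares which the staircase covers. *)
Definition lattice v : Prop := exists k m : int, v = ((k + m)%:~R, (k - m)%:~R).

Lemma lattice0 : lattice 0.
Proof. by exists 0, 0; apply: point_eq => /=; rewrite ?addr0 ?subr0. Qed.

Lemma latticeN v : lattice v -> lattice (- v).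
Proof.
by move=> [k [m ->]]; exists (- k), (- m); apply: point_eq => /=;
  rewrite -mulrNz; congr intr; ring.
Qed.

Lemma latticeD v w : lattice v -> lattice w -> lattice (v + w).
Proof.
move=> [k [m ->]] [k' [m' ->]]; exists (k + k'), (m + m').
by apply: point_eq => /=; rewrite -intrD; congr intr; ring.
Qed.

Lemma latticeB v w : lattice v -> lattice w -> lattice (v - w).
Proof. by move=> Lv /latticeN; apply: latticeD. Qed.

Definition colour x : bool := (2 %| Num.floor x.1 + Num.floor x.2)%Z.

Lemma colour_shift v x : lattice v -> colour (x + v) = colour x.
Proof.
move=> [k [m ->]]; rewrite /colour /= !floorDrz ?intr_int // !intrKfloor.
apply/idP/idP => h.
  have : (2 %| Num.floor x.1 + (k + m) + (Num.floor x.2 + (k - m)) - 2 * k)%Z.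
    by rewrite rpredB // dvdz_mulr.
  by congr (_ %| _)%Z; ring.
have : (2 %| Num.floor x.1 + Num.floor x.2 + 2 * k)%Z by rewrite rpredD // dvdz_mulr.
by congr (_ %| _)%Z; ring.
Qed.

Definition coord d x : R := if d then x.2 else x.1.

(** The point lies on no horizontal grid line ([d] true) or on no vertical one ([d] false): this is
    where [sheet d] is expected to be locally constant. *)
Definition regular d x : Prop := coord d x \isn't a Num.int.

Lemma regular_shift d v x : lattice v -> regular d (x + v) <-> regular d x.
Proof.
move=> [k [m ->]]; have cE : coord d (x + ((k + m)%:~R, (k - m)%:~R)) =
    coord d x + (if d then k - m else k + m)%:~R by case: d.
by rewrite /regular cE rpredDr ?intr_int.
Qed.

Lemma nonint_floor (r : R) : r \isn't a Num.int ->
  (Num.floor r)%:~R < r < (Num.floor r + 1)%:~R.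
Proof.
move=> nr; rewrite floorD1_gt andbT lt_neqAle floor_le andbT.
by apply: contra nr => /eqP <-; rewrite intr_int.
Qed.

Lemma floor_between (m : int) (r : R) : m%:~R < r < (m + 1)%:~R ->
  Num.floor r = m /\ r \isn't a Num.int.
Proof.
move=> /andP[h1 h2].
have e : Num.floor r = m by apply: floor_def; rewrite (ltW h1).
by split=> //; apply/negP; rewrite intrEfloor e lt_eqF.
Qed.

Lemma nearby_regular d p : regular d p -> nearby p
  (fun x => regular d x /\ Num.floor (coord d x) = Num.floor (coord d p)).
Proof.
move=> /nonint_floor /andP[h1 h2].
suff : nearby p (fun x => (Num.floor (coord d p))%:~R < coord d x <
                          (Num.floor (coord d p) + 1)%:~R).
  by apply: nearbyW => x /floor_between [].
case: d h1 h2 => h1 h2.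
  by apply: nearby2 (nearby_gt2 h1) (nearby_lt2 h2) => x ? ?; apply/andP.
by apply: nearby2 (nearby_gt1 h1) (nearby_lt1 h2) => x ? ?; apply/andP.
Qed.

(* The position of a polygon with respect to the lattice, and the sheet of the
   cover above each of its points. *)
Definition chart : Type := (point R * (point R -> A))%type.
Implicit Types (c : chart) (C : nat -> chart).

(* The sheets of the cover are numbered so that [sheet true] is constant when
   crossing vertical sides of the unit squares and [sheet false] when crossing
   horizontal ones. *)
Definition sheet c d x : A := c.2 x - u *+ (~~ d && colour (x + c.1)).

(** The point [p] need not belong to [E]: germs are also taken at boundary points of a polygon,
    where only nearby points of its inside count. *)
Definition germ (E : point R -> Prop) (f : point R -> A) p K : Prop :=
  nearby p (fun x => E x -> f x = K).

(** By the half-open convention this contains a part of the boundary, and the insides of the two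
    pieces of a cut partition the inside of the polygon, diagonal included. *)
Definition inside P x : Prop := winding P x = 1.

Definition tame P c : Prop := forall d p, regular d (p + c.1) ->
  exists K, germ (inside P) (sheet c d) p K.

(** Only open sides are tested, since the end points may be branch points; agreement at regular end
    points follows by [matched_end]. *)
Definition matched P c e Q c' e' : Prop := forall t : R, 0 < t < 1 ->
  let p := lerp t e.1.1 e.2 in let p' := lerp (1 - t) e'.1.1 e'.2 in
  lattice (p + c.1 - (p' + c'.1)) /\
  forall d, regular d (p + c.1) ->
  exists K, germ (inside P) (sheet c d) p K /\ germ (inside Q) (sheet c' d) p' K.

(* The surface presented by [S] as a cover of the torus, branched over the integral
   points. *)
Definition structure S C : Prop :=
  [/\ forall i, (i < size S)%N -> tame S`[i] (C i),
      forall i j e e', (i < size S)%N -> (j < size S)%N ->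
        e \in edges S`[i] -> e' \in edges S`[j] -> e'.1.2 = inv e.1.2 ->
        matched S`[i] (C i) e S`[j] (C j) e' &
      forall z K, exists i x,
        [/\ (i < size S)%N, inside S`[i] x, (C i).2 x = K &
            lattice (x + (C i).1 - z)]].

Lemma matched_sym P c e Q c' e' : matched P c e Q c' e' -> matched Q c' e' P c e.
Proof.
move=> H t t01; have t01' : 0 < 1 - t < 1 by lra.
have [/=] := H (1 - t) t01'; rewrite (_ : 1 - (1 - t) = t); last by ring.
set p := lerp _ _ _; set q := lerp _ _ _ => L HK.
have {}L : lattice (q + c'.1 - (p + c.1)) by rewrite -opprB; apply: latticeN.
split=> // d; rewrite -(subrK (p + c.1) (q + c'.1)) addrC => /(regular_shift _ _ L).
by move=> /HK [K [? ?]]; exists K.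
Qed.

Lemma invK : involutive inv.
Proof. by case=> l d; rewrite /inv /= negbK. Qed.

Lemma structureP S C :
  (forall i, (i < size S)%N -> tame S`[i] (C i)) ->
  (forall i j e e' l, (i < size S)%N -> (j < size S)%N ->
     e \in edges S`[i] -> e' \in edges S`[j] -> e.1.2 = (l.1, true) ->
     e'.1.2 = (l.1, false) -> matched S`[i] (C i) e S`[j] (C j) e') ->
  (forall z K, exists i x, [/\ (i < size S)%N, inside S`[i] x, (C i).2 x = K &
      lattice (x + (C i).1 - z)]) ->
  structure S C.
Proof.
move=> HT HM HU; split=> // i j e e' iS jS eS e'S.
case E: e.1.2 => [l []] E'; first exact: (HM i j e e' (l, true)).
by apply: matched_sym; exact: (HM j i e' e (l, true)).
Qed.

Definition shift_chart v c : chart := (c.1 - v, fun x => c.2 (x - v)).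

Lemma sheet_shift v c d x : sheet (shift_chart v c) d (x + v) = sheet c d x.
Proof. by rewrite /sheet /= addrK [c.1 - v]addrC addrA addrK. Qed.

Lemma germ_shift P Q v c d p K : (forall x, winding Q (x + v) = winding P x) ->
  germ (inside P) (sheet c d) p K ->
  germ (inside Q) (sheet (shift_chart v c) d) (p + v) K.
Proof.
move=> H; rewrite -{1}(addrK v p) => /nearby_trans; apply: nearbyW => x.
move=> h Qx; rewrite -(subrK v x) sheet_shift; apply: h; move: Qx.
by rewrite /inside -{1}(subrK v x) H.
Qed.

Lemma lerp_shift (t : R) a b v : lerp t (a + v) (b + v) = lerp t a b + v.
Proof. by apply: point_eq => /=; ring. Qed.

(** This treats together the operations that keep each polygon up to order, translation and labels:
    polygon [j] of [T] comes from polygon [f j] of [S] by the translation [v j], and [L] relates new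
    labels to old ones. *)
Lemma structure_transfer S T C (f : nat -> nat) (v : nat -> point R)
    (L : letter -> letter -> Prop) :
  (forall l l' m m', L l l' -> L m m' -> m = inv l -> m' = inv l') ->
  (forall j, (j < size T)%N -> (f j < size S)%N) ->
  (forall i, (i < size S)%N -> exists2 j, (j < size T)%N & f j = i) ->
  (forall j, (j < size T)%N ->
     forall x, winding T`[j] (x + v j) = winding S`[f j] x) ->
  (forall j, (j < size T)%N -> forall e, e \in edges T`[j] ->
     exists e', [/\ e' \in edges S`[f j], e.1.1 = e'.1.1 + v j,
                    e.2 = e'.2 + v j & L e.1.2 e'.1.2]) ->
  structure S C -> exists C', structure T C'.
Proof.
move=> HL fT fS HW HE [HR HG HU].
have sK x w o : x + w + (o - w) = x + o :> point R by rewrite addrA addrAC addrK.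
exists (fun j => shift_chart (v j) (C (f j))); split.
- move=> j jT d p; rewrite /= addrA addrAC => h.
  have [K HK] := HR _ (fT _ jT) d (p - v j) h.
  by exists K; rewrite -[p](subrK (v j)); apply: germ_shift HK; apply: HW.
- move=> i j e e' iT jT /(HE i iT)[e0 [e0S E1 E2 EL]].
  move=> /(HE j jT)[e0' [e0'S E1' E2' EL']] ee t t01 /=.
  have [] := HG _ _ _ _ (fT _ iT) (fT _ jT) e0S e0'S (HL _ _ _ _ EL EL' ee) t t01.
  rewrite E1 E2 E1' E2' !lerp_shift /=.
  set p := lerp _ _ _; set p' := lerp _ _ _ => L1 L2.
  rewrite !sK; split=> // d /L2[K [h1 h2]].
  by exists K; split; [apply: germ_shift h1|apply: germ_shift h2]; apply: HW.
- move=> z K; have [i [x [iS ix xK Lx]]] := HU z K.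
  have [j jT fj] := fS _ iS; exists j, (x + v j); split=> //=.
  + by rewrite /inside HW // fj.
  + by rewrite addrK fj.
  + by rewrite sK fj.
Qed.

End Structures.

(** * Invariance under cutting and pasting *)

Section Moves.
Variables (R : realType) (A : zmodType) (u : A).
Implicit Types (a b p q v x z : point R) (P Q : polygon R) (S T : seq (polygon R)).
Implicit Types (l : letter) (e : edge R) (d : bool) (K : A).
Implicit Types (c : chart R A) (C : nat -> chart R A).

Lemma edge_neq P e : simple_bd P -> e \in edges P -> e.2 - e.1.1 != 0.
Proof.
move=> sP /edgesP[i iP -> /=]; rewrite subr_eq0 eq_sym; exact: vtx_neq.
Qed.

Lemma near_edge P e (t : R) : is_polygon P -> e \in edges P -> 0 < t < 1 ->
  nearby (lerp t e.1.1 e.2) (fun x =>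
    (0 < cross (e.2 - e.1.1) (x - e.1.1) -> inside P x /\ ~ on_bd P x) /\
    (cross (e.2 - e.1.1) (x - e.1.1) < 0 -> winding P x = 0 /\ ~ on_bd P x)).
Proof. by move=> PP /edgesP[i iP ->] t01; exact: winding_near_side. Qed.

(** Points of the inside accumulate at every interior point of a side, so a germ along [inside P]
    has only one possible value there. *)
Lemma near_edge_inside P e (t : R) (G : point R -> Prop) :
  is_polygon P -> e \in edges P -> 0 < t < 1 ->
  nearby (lerp t e.1.1 e.2) G -> exists x, G x /\ inside P x.
Proof.
move=> PP eP t01 HG; have sP : simple_bd P by case: PP.
have [x [[Gx [+ _]]]] :=
  nearby_left (edge_neq sP eP) (nearby_and HG (near_edge PP eP t01)).
by rewrite cross_lerp => H /H [? _]; exists x.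
Qed.

Lemma nearby_lerp (t : R) a b (G : point R -> Prop) : nearby (lerp t a b) G ->
  exists2 eps : R, 0 < eps & forall s, `|s - t| < eps -> G (lerp s a b).
Proof.
move=> [r r0 H]; pose D := `|b.1 - a.1| + `|b.2 - a.2| + 1.
have h1 := normr_ge0 (b.1 - a.1); have h2 := normr_ge0 (b.2 - a.2).
have D0 : 0 < D by rewrite /D; lra.
exists (r / D) => [|s]; first exact: divr_gt0.
rewrite ltr_pdivlMr // => hs; have h3 := normr_ge0 (s - t).
apply: H; rewrite /near /=.
rewrite (_ : _ - (a.1 + _) = (s - t) * (b.1 - a.1)); last by ring.
rewrite (_ : _ - (a.2 + _) = (s - t) * (b.2 - a.2)); last by ring.
by rewrite !normrM /D in hs *; apply/andP; split; nra.
Qed.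

Lemma germ_open (E : point R -> Prop) (f : point R -> A) p K :
  germ E f p K -> nearby p (fun q => germ E f q K).
Proof. exact: nearby_nearby. Qed.

(** A germ at an end point persists at the nearby points of the open side, where [matched] provides
    a common value for the two polygons. *)
Lemma matched_end P c e Q c' e' d K K' : is_polygon P -> is_polygon Q ->
  e \in edges P -> e' \in edges Q -> matched u P c e Q c' e' ->
  regular d (e.2 + c.1) ->
  germ (inside P) (sheet u c d) e.2 K -> germ (inside Q) (sheet u c' d) e'.1.1 K' ->
  K = K'.
Proof.
move=> PP PQ eP eQ M rd gK gK'.
have l1 a b : b = lerp 1 a b by apply: point_eq => /=; ring.
have l0 a b : a = lerp 0 a b by apply: point_eq => /=; ring.
have N : nearby e.2 (fun q => germ (inside P) (sheet u c d) q K /\ regular d (q + c.1)).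
  apply: nearby2 (germ_open gK) (nearby_trans (nearby_regular rd)) => q h [].
  by split.
have N' := germ_open gK'.
rewrite (l1 e.1.1 e.2) in N; rewrite (l0 e'.1.1 e'.2) in N'.
have [r r0 H] := nearby_lerp N; have [r' r'0 H'] := nearby_lerp N'.
pose m := Num.min (Num.min r r') 1.
have m0 : 0 < m by rewrite !lt_min r0 r'0 ltr01.
have [m1 [m2 m3]] : m <= r /\ m <= r' /\ m <= 1 by rewrite !ge_min !lexx !orbT.
have t01 : 0 < 1 - m / 2 < 1 by lra.
have [|g1 g2] := H (1 - m / 2); first by rewrite ltr_norml; lra.
have g3 : germ (inside Q) (sheet u c' d) (lerp (1 - (1 - m / 2)) e'.1.1 e'.2) K'.
  by apply: H'; rewrite ltr_norml; lra.
have [_ /(_ d g2)[L [g4 g5]]] := M _ t01.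
have [x [[h1 h2] /[dup] /h1 <- /h2 ->]] := near_edge_inside PP eP t01 (nearby_and g1 g4).
have t01' : 0 < 1 - (1 - m / 2) < 1 by lra.
by have [y [[h3 h4] /[dup] /h3 <- /h4 ->]] := near_edge_inside PQ eQ t01' (nearby_and g3 g5).
Qed.

Lemma germ_sub (E E' : point R -> Prop) (f : point R -> A) p K :
  (forall x, E' x -> E x) -> germ E f p K -> germ E' f p K.
Proof. by move=> H; apply: nearbyW => x h /H /h. Qed.

Lemma matched_inside P P' Q Q' c c' e e' : (forall x, inside P' x -> inside P x) ->
  (forall x, inside Q' x -> inside Q x) ->
  matched u P c e Q c' e' -> matched u P' c e Q' c' e'.
Proof.
move=> HP HQ M t t01; have [L H] := M t t01; split=> // d /H [K [h1 h2]].
by exists K; split; [apply: germ_sub h1|apply: germ_sub h2].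
Qed.

(* The converse passage to larger polygons is possible since a germ at a side is
   determined by the points on the left of this side. *)
Lemma matched_extend P P' Q Q' c c1 c' c1' e e' :
  is_polygon P -> is_polygon Q -> e \in edges P -> e' \in edges Q ->
  lattice (c1.1 - c.1) -> lattice (c1'.1 - c'.1) ->
  (forall x, inside P x -> inside P' x) -> (forall x, inside Q x -> inside Q' x) ->
  (forall d x, inside P x -> sheet u c1 d x = sheet u c d x) ->
  (forall d x, inside Q x -> sheet u c1' d x = sheet u c' d x) ->
  tame u P' c1 -> tame u Q' c1' ->
  matched u P c e Q c' e' -> matched u P' c1 e Q' c1' e'.
Proof.
move=> PP PQ eP eQ L L' HP HQ sP sQ tP tQ M t t01 p p'; have [L0 H] := M t t01.
have t01' : 0 < 1 - t < 1 by lra.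
have eL : lattice (p + c1.1 - (p' + c1'.1)).
  have -> : p + c1.1 - (p' + c1'.1) =
      (c1.1 - c.1) - (c1'.1 - c'.1) + (p + c.1 - (p' + c'.1)).
    by apply: point_eq => /=; ring.
  by apply: latticeD L0; apply: latticeB.
split=> // d rd.
have rd0 : regular d (p + c.1).
  have e1 : p + c1.1 = p + c.1 + (c1.1 - c.1) by apply: point_eq => /=; ring.
  by move: rd; rewrite e1 => /(regular_shift _ _ L).
have rd' : regular d (p' + c1'.1).
  have e1 : p + c1.1 = p' + c1'.1 + (p + c1.1 - (p' + c1'.1)).
    by apply: point_eq => /=; ring.
  by move: rd; rewrite e1 => /(regular_shift _ _ eL).
have [K [h1 h2]] := H d rd0.
have [K1 g1] := tP _ _ rd; have [K1' g1'] := tQ _ _ rd'.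
have eK : K1 = K.
  have [x [[k1 k2] ix]] := near_edge_inside PP eP t01 (nearby_and g1 h1).
  by rewrite -(k1 (HP _ ix)) sP // k2.
have eK' : K1' = K.
  have [x [[k1 k2] ix]] := near_edge_inside PQ eQ t01' (nearby_and g1' h2).
  by rewrite -(k1 (HQ _ ix)) sQ // k2.
by exists K; rewrite -{1}eK -eK'.
Qed.

Lemma matched_subside P c Q c' e e' e1 e1' (r s : R) : 0 <= r < s -> s <= 1 ->
  e1.1.1 = lerp r e.1.1 e.2 -> e1.2 = lerp s e.1.1 e.2 ->
  e1'.1.1 = lerp (1 - s) e'.1.1 e'.2 -> e1'.2 = lerp (1 - r) e'.1.1 e'.2 ->
  matched u P c e Q c' e' -> matched u P c e1 Q c' e1'.
Proof.
move=> /andP[r0 rs] s1 E1 E2 E3 E4 M t /andP[t0 t1].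
have t01 : 0 < r + t * (s - r) < 1 by apply/andP; split; nra.
have := M _ t01; rewrite E1 E2 E3 E4.
have -> : lerp t (lerp r e.1.1 e.2) (lerp s e.1.1 e.2) =
    lerp (r + t * (s - r)) e.1.1 e.2 by apply: point_eq => /=; ring.
have -> // : lerp (1 - t) (lerp (1 - s) e'.1.1 e'.2) (lerp (1 - r) e'.1.1 e'.2) =
    lerp (1 - (r + t * (s - r))) e'.1.1 e'.2 by apply: point_eq => /=; ring.
Qed.

Lemma structure_perm S T : perm_eq S T ->
  (exists C, structure u S C) -> exists C, structure u T C.
Proof.
rewrite perm_sym => /(perm_iotaP [::])[Is pIs eT] [C HC].
have sz : size Is = size T by rewrite eT size_map.
have nT j : (j < size T)%N -> T`[j] = S`[nth 0%N Is j].
  by move=> jT; rewrite {1}eT (nth_map 0%N) // sz.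
apply: (@structure_transfer _ _ u S T C (fun j => nth 0%N Is j) (fun=> 0) eq _ _ _ _ _ HC).
- by move=> l l' m m' -> ->.
- move=> j; rewrite -sz => jT.
  by have := mem_nth 0%N jT; rewrite (perm_mem pIs) mem_iota.
- move=> i iS; have iI : i \in Is by rewrite (perm_mem pIs) mem_iota.
  by exists (index i Is); rewrite ?nth_index // -sz index_mem.
- by move=> j jT x; rewrite addr0 nT.
- by move=> j jT e; rewrite nT // => eS; exists e; rewrite !addr0.
Qed.

Lemma structure_head v P Q S : (forall x, winding Q (x + v) = winding P x) ->
  (forall e, e \in edges Q -> exists2 e', e' \in edges P & e = shift_edge v e') ->
  (exists C, structure u (P :: S) C) -> exists C, structure u (Q :: S) C.
Proof.
move=> HW HE [C HC].
apply: (@structure_transfer _ _ u (P :: S) (Q :: S) C id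
  (fun j => if j is 0%N then v else 0) eq _ _ _ _ _ HC) => //.
- by move=> l l' m m' -> ->.
- by move=> i iS; exists i.
- by case=> [|j] _ x //=; rewrite addr0.
- move=> [|j] _ e /=; last by move=> eS; exists e; rewrite !addr0.
  by move=> /HE[e' eP ->]; exists e'.
Qed.

Lemma structure_rot k P S : (exists C, structure u (P :: S) C) <->
  (exists C, structure u (rot k P :: S) C).
Proof.
have s0 e : e = shift_edge 0 e by case: e => [[? ?] ?]; rewrite /shift_edge /= !addr0.
split; apply: (structure_head (v := 0)).
- by move=> x; rewrite addr0 !windingE; apply/wind_perm/edges_rot.
- by move=> e; rewrite (perm_mem (edges_rot k P)) => eP; exists e.
- by move=> x; rewrite addr0 !windingE; apply/wind_perm; rewrite perm_sym edges_rot.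
- by move=> e; rewrite -(perm_mem (edges_rot k P)) => eP; exists e.
Qed.

Lemma structure_translate v P S : (exists C, structure u (P :: S) C) <->
  (exists C, structure u (translate v P :: S) C).
Proof.
split.
  apply: (structure_head (v := v)).
    by move=> x; rewrite !windingE edges_translate wind_shift.
  by move=> e; rewrite edges_translate => /mapP[e' ? ->]; exists e'.
apply: (structure_head (v := - v)).
  by move=> x; rewrite !windingE edges_translate -{2}(subrK v x) wind_shift.
move=> e eP; exists (shift_edge v e); first by rewrite edges_translate map_f.
by case: e eP => [[? ?] ?] _; rewrite /shift_edge /= !addrK.
Qed.

Lemma structure_relabel f S : injective f -> (forall l, f (inv l) = inv (f l)) ->
  (exists C, structure u S C) <-> (exists C, structure u (map (relabel f) S) C).
Proof.
move=> fI fV.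
have nE i : (map (relabel f) S)`[i] = relabel f S`[i].
  have [iS|iS] := ltnP i (size S); first by rewrite (nth_map [::]).
  by rewrite !nth_default ?size_map.
have wE P x : winding (relabel f P) x = winding P x.
  by rewrite !windingE edges_relabel /wind big_map.
split=> -[C HC].
  apply: (@structure_transfer _ _ u _ _ C id (fun=> 0) (fun l l' => l = f l')
    _ _ _ _ _ HC); rewrite ?size_map.
  - by move=> l l' m m' -> ->; rewrite -fV => /fI.
  - by [].
  - by move=> i iS; exists i.
  - by move=> j jS x; rewrite addr0 nE wE.
  - move=> j jS e; rewrite nE edges_relabel => /mapP[e' e'S ->].
    by exists e'; rewrite !addr0.
apply: (@structure_transfer _ _ u _ _ C id (fun=> 0) (fun l l' => l' = f l)
    _ _ _ _ _ HC); rewrite ?size_map.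
- by move=> l l' m m' -> -> ->.
- by [].
- by move=> i iS; exists i.
- by move=> j jS x; rewrite addr0 nE wE.
- move=> j jS e eS; exists (relabel_edge f e).
  by rewrite !addr0 nE edges_relabel map_f.
Qed.

Lemma flatten_map_inj (I J : eqType) (g : I -> seq J) (s : seq I) (i0 : I)
    (i j : nat) (y : J) :
  uniq (flatten (map g s)) -> (i < size s)%N -> (j < size s)%N ->
  y \in g (nth i0 s i) -> y \in g (nth i0 s j) -> i = j.
Proof.
elim: s i j => //= x s IHs i j; rewrite cat_uniq => /and3P[_ /hasPn H us].
have no k : (k < size s)%N -> y \in g (nth i0 s k) -> y \notin g x.
  move=> ks yk; apply: H; apply/flatten_mapP; exists (nth i0 s k) => //.
  exact: mem_nth.
case: i => [|i]; case: j => [|j] //=; rewrite ?ltnS.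
- by move=> _ js yx /(no j js) /negP.
- by move=> iS _ /(no i iS) /negP.
- by move=> iS jS yi yj; congr _.+1; apply: IHs yi yj.
Qed.

Lemma flatten_map_uniq (I J : eqType) (g : I -> seq J) (s : seq I) (x : I) :
  uniq (flatten (map g s)) -> x \in s -> uniq (g x).
Proof.
elim: s => //= y s IHs; rewrite cat_uniq inE => /and3P[u1 _ u2].
by case/orP => [/eqP ->|/(IHs u2)].
Qed.

Lemma label_inj S i j e e' : glued S -> (i < size S)%N -> (j < size S)%N ->
  e \in edges S`[i] -> e' \in edges S`[j] -> e.1.2 = e'.1.2 -> i = j /\ e = e'.
Proof.
move=> [+ _] iS jS eS e'S ee; rewrite sidesE map_flatten -map_comp => uS.
set g := (X in map X S) in uS.
have gE P : g P = [seq w.1.2 | w <- edges P] by rewrite /g /= -map_comp.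
have ij : i = j.
  by apply: (flatten_map_inj (i0 := [::]) (y := e.1.2) uS iS jS);
    rewrite gE ?ee; apply/mapP; [exists e|exists e'].
split=> //; rewrite -ij in e'S.
have := flatten_map_uniq uS (mem_nth [::] iS).
rewrite gE; elim: (edges _) eS e'S => //= w s IHs; rewrite !inE => + + /andP[nw us].
have no y : y \in s -> y.1.2 != w.1.2.
  by move=> ys; apply: contra nw => /eqP <-; apply: map_f.
case/orP => [/eqP E1|es]; case/orP => [/eqP E2|es'].
- by rewrite E1.
- by have := no _ es'; rewrite -ee E1 eqxx.
- by have := no _ es; rewrite ee E2 eqxx.
- exact: IHs.
Qed.

Lemma glued_partner S i e : glued S -> (i < size S)%N -> e \in edges S`[i] ->
  exists j e', [/\ (j < size S)%N, e' \in edges S`[j], e'.1.2 = inv e.1.2 &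
    e'.2 - e'.1.1 = - (e.2 - e.1.1)].
Proof.
move=> [_ H] iS /(side_mem iS) /H /side_memP[j [e' [jS eS]]].
by move=> /[dup] /(congr1 fst) /= h1 /(congr1 snd) /= h2; exists j, e'.
Qed.

End Moves.

(** * Splitting a side, cutting along a diagonal, and the inverse operations *)

Section CutAndPaste.
Variables (R : realType) (A : zmodType) (u : A).
Implicit Types (a b p q v x z : point R) (P Q : polygon R) (S T : seq (polygon R)).
Implicit Types (l : letter) (e : edge R) (d : bool) (K : A).
Implicit Types (c : chart R A) (C : nat -> chart R A).

Section Split.
Variables (m m' : nat) (t : R) (S : seq (polygon R)).
Hypotheses (t01 : 0 < t < 1) (pS : presentation S).
Let T := map (split_side m m' t) S.
Hypothesis pT : presentation T.

Let nT i : (i < size S)%N -> T`[i] = split_side m m' t S`[i].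
Proof. by move=> iS; rewrite (nth_map [::]). Qed.

Let szT : size T = size S. Proof. exact: size_map. Qed.

Let cut_mem i e e1 : (i < size S)%N -> e \in edges S`[i] ->
  e1 \in cut_edge m m' t e -> e1 \in edges T`[i].
Proof.
by move=> iS eS e1e; rewrite nT // edges_split; apply/flatten_mapP; exists e.
Qed.

Let all_edges := flatten [seq edges P | P <- S].

Let all_mem i e : (i < size S)%N -> e \in edges S`[i] -> e \in all_edges.
Proof. by move=> iS eS; apply/flatten_mapP; exists S`[i]; rewrite ?mem_nth. Qed.

Let cut_true e : e.1.2 = (m, true) -> cut_edge m m' t e =
  [:: (e.1.1, (m, true), lerp t e.1.1 e.2); (lerp t e.1.1 e.2, (m', true), e.2)].
Proof. by rewrite /cut_edge => ->; rewrite eqxx. Qed.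

Let cut_false e : e.1.2 = (m, false) -> cut_edge m m' t e =
  [:: (e.1.1, (m', false), lerp (1 - t) e.1.1 e.2);
      (lerp (1 - t) e.1.1 e.2, (m, false), e.2)].
Proof. by rewrite /cut_edge => ->; rewrite eqxx xpair_eqE andbF. Qed.

Let labels e := [seq e'.1.2 | e' <- cut_edge m m' t e].

Let uniq_labels : uniq (flatten (map labels all_edges)).
Proof.
have [_ [+ _]] := pT; rewrite sidesE map_flatten -map_comp => uT.
move: uT; congr is_true; congr uniq; rewrite /T /all_edges -map_comp.
elim: (S) => //= P s ->; rewrite map_cat flatten_cat; congr (_ ++ _).
by rewrite -map_comp edges_split map_flatten -map_comp.
Qed.

(** Labels of [T] are not repeated. A side of [S] already labelled [m'] would stay whole, while the
    side labelled [m] with the same sign, which is [e] or its partner, would produce that label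
    again. *)
Lemma split_fresh i j e e' : (i < size S)%N -> (j < size S)%N ->
  e \in edges S`[i] -> e' \in edges S`[j] -> e.1.2.1 = m ->
  m' != m /\ e'.1.2.1 != m'.
Proof.
move=> iS jS eS e'S em; have gS : glued S by case: pS.
have eE : e.1.2 = (m, e.1.2.2) by rewrite -em -surjective_pairing.
have mm : m' != m.
  apply/eqP => mm; have := flatten_map_uniq uniq_labels (all_mem iS eS).
  by rewrite /labels; case: (e.1.2.2) eE => [/cut_true|/cut_false] ->;
    rewrite /= mm inE eqxx.
split=> //; apply/eqP => e'm.
have [k [w [kS wS wm]]] : exists k w, [/\ (k < size S)%N, w \in edges S`[k] &
    w.1.2 = (m, e'.1.2.2)].
  have [eb|nb] := eqVneq e.1.2.2 e'.1.2.2; first by exists i, e; rewrite -eb.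
  have [k [w [kS wS wl _]]] := glued_partner gS iS eS.
  exists k, w; split=> //; rewrite wl /inv em; congr (_, _).
  by move: nb; case: (_.2); case: (_.2).
have e'E : e'.1.2 = (m', e'.1.2.2) by rewrite -e'm -surjective_pairing.
have e'all := all_mem jS e'S; have wall := all_mem kS wS.
have l1 : e'.1.2 \in labels e'.
  have nc : cut_edge m m' t e' = [:: e'].
    by rewrite /cut_edge e'E !xpair_eqE (negPf mm).
  by rewrite /labels nc mem_head.
have l2 : e'.1.2 \in labels w.
  rewrite /labels [X in X \in _]e'E.
  by case: (e'.1.2.2) wm => [/cut_true|/cut_false] ->; rewrite !inE eqxx ?orbT.
have ij : index e' all_edges = index w all_edges.
  by apply: (flatten_map_inj (i0 := e') (y := e'.1.2) uniq_labels);
    rewrite ?index_mem ?nth_index.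
have ew : e' = w by rewrite -[e'](nth_index e' e'all) ij nth_index.
by move: mm; rewrite -e'm ew wm eqxx.
Qed.

Let cutE e e1 : e1 \in cut_edge m m' t e ->
  [\/ e.1.2 = (m, true) /\ (e1 = (e.1.1, (m, true), lerp t e.1.1 e.2)
         \/ e1 = (lerp t e.1.1 e.2, (m', true), e.2)),
      e.1.2 = (m, false) /\ (e1 = (e.1.1, (m', false), lerp (1 - t) e.1.1 e.2)
         \/ e1 = (lerp (1 - t) e.1.1 e.2, (m, false), e.2)) |
      e.1.2.1 <> m /\ e1 = e].
Proof.
rewrite /cut_edge; case: eqP => [h|n1].
  by rewrite !inE => /orP[] /eqP ->; apply: Or31; split; auto.
case: eqP => [h|n2].
  by rewrite !inE => /orP[] /eqP ->; apply: Or32; split; auto.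
rewrite mem_seq1 => /eqP ->; apply: Or33; split=> // h.
by move: n1 n2; rewrite (surjective_pairing e.1.2) h; case: (e.1.2.2).
Qed.

Lemma structure_split : (exists C, structure u S C) -> exists C, structure u T C.
Proof.
move=> [C [HR HG HU]]; exists C.
have wE i x : (i < size S)%N -> winding T`[i] x = winding S`[i] x.
  by move=> iS; rewrite nT // winding_split.
have inE' i x : (i < size S)%N -> inside T`[i] x -> inside S`[i] x.
  by move=> iS; rewrite /inside wE.
have [t0 t1] := andP t01.
apply: structureP; rewrite ?szT.
- move=> i iS d p rd; have [K h] := HR i iS d p rd.
  by exists K; apply: germ_sub h => x; apply: inE'.
- move=> i j e1 e1' l iS jS e1T e1'T E1 E1'.
  move: e1T; rewrite nT // edges_split => /flatten_mapP[e eS /cutE He].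
  move: e1'T; rewrite nT // edges_split => /flatten_mapP[e' e'S /cutE He'].
  suff : matched u S`[i] (C i) e1 S`[j] (C j) e1'.
    by rewrite -nT // -nT //; apply: matched_inside => x; apply: inE'.
  have main : e'.1.2 = inv e.1.2 -> matched u S`[i] (C i) e S`[j] (C j) e'.
    exact: HG.
  have l1 (p q : point R) : q = lerp 1 p q by apply: point_eq => /=; ring.
  have l0 (p q : point R) : p = lerp 0 p q by apply: point_eq => /=; ring.
  case: He => [[el He]|[el He]|[ne e1E]]; last 2 first.
  + by case: He => e1E; move: E1; rewrite e1E.
  + rewrite {}e1E in E1 *.
    case: He' => [[el' He']|[el' He']|[ne' e1E']].
    * by case: He' => e1E; move: E1'; rewrite e1E.
    * have [_ fr] := split_fresh jS iS e'S eS (congr1 fst el').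
      case: He' => e1E; move: E1'; rewrite e1E /= => -[lE].
        by move: fr; rewrite E1 -lE eqxx.
      by case: ne; rewrite E1 -lE.
    * by rewrite e1E' in E1' *; apply: main; rewrite E1 E1'.
  + have [mm fr] := split_fresh iS jS eS e'S (congr1 fst el).
    case: He' => [[el' He']|[el' He']|[ne' e1E']].
    * by case: He' => e1E; move: E1'; rewrite e1E.
    * have M : matched u S`[i] (C i) e S`[j] (C j) e' by apply: main; rewrite el el'.
      case: He He' => e1E [] e1E'; move: E1 E1'; rewrite e1E e1E' /= => -[h1] [h2].
      - by move: mm; rewrite h1 h2 eqxx.
      - by apply: (@matched_subside _ _ _ _ _ _ _ _ _ _ _ 0 t); rewrite ?lexx ?subr0 //= ltW.
      - by apply: (@matched_subside _ _ _ _ _ _ _ _ _ _ _ t 1); rewrite ?subrr ?(ltW t0) //=.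
      - by move: mm; rewrite h1 h2 eqxx.
    * rewrite e1E' in E1'; case: He => e1E; move: E1; rewrite e1E /= => -[lE].
        by case: ne'; rewrite E1' -lE.
      by move: fr; rewrite E1' -lE eqxx.
- move=> z K; have [i [x [iS ix xK Lx]]] := HU z K.
  by exists i, x; split=> //; rewrite /inside wE.
Qed.

Lemma structure_unsplit : (exists C, structure u T C) -> exists C, structure u S C.
Proof.
move=> [C [HR HG HU]]; rewrite szT in HR HG HU; exists C.
have wE i x : (i < size S)%N -> winding T`[i] x = winding S`[i] x.
  by move=> iS; rewrite nT // winding_split.
have inE' i x : (i < size S)%N -> inside S`[i] x -> inside T`[i] x.
  by move=> iS; rewrite /inside wE.
have [t0 t1] := andP t01.
have tS i : (i < size S)%N -> tame u S`[i] (C i).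
  move=> iS d p rd; have [K h] := HR i iS d p rd.
  by exists K; apply: germ_sub h => x; apply: inE'.
have PT i : (i < size S)%N -> is_polygon T`[i].
  by move=> iS; apply: pT.1; apply: mem_nth; rewrite szT.
apply: structureP => //.
- move=> i j e e' l iS jS eS e'S E1 E2.
  have sub e1 e1' : e1 \in cut_edge m m' t e -> e1' \in cut_edge m m' t e' ->
      e1'.1.2 = inv e1.1.2 -> matched u S`[i] (C i) e1 S`[j] (C j) e1'.
    move=> c1 c1' ee.
    apply: matched_inside (HG _ _ _ _ iS jS (cut_mem iS eS c1) (cut_mem jS e'S c1') ee);
      by move=> x; apply: inE'.
  have [lm|lm] := eqVneq l.1 m; last first.
    by apply: sub; rewrite ?E1 ?E2 // /cut_edge ?E1 ?E2 !xpair_eqE (negPf lm) /= mem_seq1.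
  rewrite {}lm in E1 E2.
  have c1 : (e.1.1, (m, true), lerp t e.1.1 e.2) \in cut_edge m m' t e.
    by rewrite cut_true // mem_head.
  have c2 : (lerp t e.1.1 e.2, (m', true), e.2) \in cut_edge m m' t e.
    by rewrite cut_true // !inE eqxx orbT.
  have c1' : (e'.1.1, (m', false), lerp (1 - t) e'.1.1 e'.2) \in cut_edge m m' t e'.
    by rewrite cut_false // mem_head.
  have c2' : (lerp (1 - t) e'.1.1 e'.2, (m, false), e'.2) \in cut_edge m m' t e'.
    by rewrite cut_false // !inE eqxx orbT.
  have M1 := sub _ _ c1 c2' erefl; have M2 := sub _ _ c2 c1' erefl.
  have gS : glued S by case: pS.
  have vec : e'.2 - e'.1.1 = - (e.2 - e.1.1).
    have [k [w [kS wS wl wv]]] := glued_partner gS iS eS.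
    have wl' : w.1.2 = e'.1.2 by rewrite wl E1 E2.
    by have [_ <-] := label_inj gS kS jS wS e'S wl'.
  move=> s /andP[s0 s1].
  have v1 : e'.2.1 = e'.1.1.1 - (e.2.1 - e.1.1.1).
    by have /= := congr1 fst vec; lra.
  have v2 : e'.2.2 = e'.1.1.2 - (e.2.2 - e.1.1.2).
    by have /= := congr1 snd vec; lra.
  (* The side vectors being opposite, the difference of identified points does not depend on the
     parameter, so one parameter on the first half suffices. *)
  have L : lattice (lerp s e.1.1 e.2 + (C i).1 - (lerp (1 - s) e'.1.1 e'.2 + (C j).1)).
    have [|+ _] := M1 (1 / 2); first by lra.
    congr lattice; apply: point_eq => /=; rewrite ?v1 ?v2; ring.
  split=> // d rd.
  have [st|st|st] := ltgtP s t.
  + have r01 : 0 < s / t < 1 by rewrite divr_gt0 //= ltr_pdivrMr // mul1r.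
    have rE : s / t * t = s by rewrite mulfVK // gt_eqF.
    have [_] := M1 _ r01; rewrite /=.
    have -> : lerp (s / t) e.1.1 (lerp t e.1.1 e.2) = lerp s e.1.1 e.2.
      by rewrite -[in RHS]rE; apply: point_eq => /=; ring.
    have -> : lerp (1 - s / t) (lerp (1 - t) e'.1.1 e'.2) e'.2 = lerp (1 - s) e'.1.1 e'.2.
      by rewrite -[in RHS]rE; apply: point_eq => /=; ring.
    exact.
  + have d0 : 0 < 1 - t by lra.
    pose r := (s - t) / (1 - t).
    have r01 : 0 < r < 1 by rewrite /r divr_gt0 ?subr_gt0 //= ltr_pdivrMr // mul1r; lra.
    have rE : s = r * (1 - t) + t by rewrite /r mulfVK ?gt_eqF //; ring.
    have [_] := M2 _ r01; rewrite /=.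
    have -> : lerp r (lerp t e.1.1 e.2) e.2 = lerp s e.1.1 e.2.
      by rewrite rE; apply: point_eq => /=; ring.
    have -> : lerp (1 - r) e'.1.1 (lerp (1 - t) e'.1.1 e'.2) = lerp (1 - s) e'.1.1 e'.2.
      by rewrite rE; apply: point_eq => /=; ring.
    exact.
  (* The splitting point is an end point of both halves, hence not covered by [M1] or [M2]; the
     germs there are compared by [matched_end]. *)
  + rewrite st in L rd *.
    have rd' : regular d (lerp (1 - t) e'.1.1 e'.2 + (C j).1).
      by move: rd; rewrite -{1}(subrK (lerp (1 - t) e'.1.1 e'.2 + (C j).1)
        (lerp t e.1.1 e.2 + (C i).1)) addrC => /(regular_shift _ _ L).
    have [K h] := HR i iS _ _ rd; have [K' h'] := HR j jS _ _ rd'.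
    have MT := HG _ _ _ _ iS jS (cut_mem iS eS c1) (cut_mem jS e'S c2') erefl.
    have KK := matched_end (PT i iS) (PT j jS) (cut_mem iS eS c1) (cut_mem jS e'S c2')
      MT rd h h'.
    exists K; split; first by apply: germ_sub h => x; apply: inE'.
    by rewrite KK; apply: germ_sub h' => x; apply: inE'.
- move=> z K; have [i [x [iS ix xK Lx]]] := HU z K.
  by exists i, x; split=> //; rewrite /inside -wE.
Qed.

End Split.

Section Cut.
Variables (a b : point R) (y z w : letter) (s1 s2 : polygon R) (S : seq (polygon R)).
Let P : polygon R := ((a, y) :: s1) ++ ((b, z) :: s2).
Let P1 : polygon R := rcons ((a, y) :: s1) (b, w).
Let P2 : polygon R := rcons ((b, z) :: s2) (a, inv w).
Hypotheses (pS : presentation (P :: S)) (pT : presentation (P1 :: P2 :: S)).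

Let PP : is_polygon P. Proof. by apply: pS.1; rewrite mem_head. Qed.
Let PP1 : is_polygon P1. Proof. by apply: pT.1; rewrite mem_head. Qed.
Let PP2 : is_polygon P2. Proof. by apply: pT.1; rewrite !inE eqxx orbT. Qed.

Let wP x : winding P x = winding P1 x + winding P2 x.
Proof. exact: winding_cut. Qed.

Let inP x : inside P x <-> inside P1 x \/ inside P2 x.
Proof.
have := winding01 x PP; rewrite /inside wP.
have [->|->] := winding01 x PP1; have [->|->] := winding01 x PP2.
- by move=> _; split=> // -[].
- by move=> _; split=> // _; right.
- by move=> _; split=> // _; left.
- by case.
Qed.

Let in12 x : inside P1 x -> inside P2 x -> False.
Proof. by move=> h1 h2; have := winding01 x PP; rewrite wP h1 h2 => -[]. Qed.

Let E1 : edges P1 = rcons (open_edges ((a, y) :: s1) b) (b, w, a).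
Proof. by have [_ H _] := edges_cut a b y z s1 s2; exact: H. Qed.

Let E2 : edges P2 = rcons (open_edges ((b, z) :: s2) a) (a, inv w, b).
Proof. by have [_ _ H] := edges_cut a b y z s1 s2; exact: H. Qed.

Let E : edges P = open_edges ((a, y) :: s1) b ++ open_edges ((b, z) :: s2) a.
Proof. by have [H _ _] := edges_cut a b y z s1 s2. Qed.

Lemma structure_cut : (exists C, structure u (P :: S) C) ->
  exists C, structure u (P1 :: P2 :: S) C.
Proof.
move=> [C [HR HG HU]].
(* Both pieces inherit the chart of [P], as the predecessors of 0 and 1 are 0; the other polygons
   are shifted by one place. *)
pose C' i := C i.-1; exists C'.
have sz j : (j < size (P1 :: P2 :: S))%N -> (j.-1 < size (P :: S))%N by case: j => [|[|]].
have inS j x : inside (P1 :: P2 :: S)`[j] x -> inside (P :: S)`[j.-1] x.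
  case: j => [|[|j]] //= h; apply/inP; [by left|by right].
have tR j : (j < size (P1 :: P2 :: S))%N -> tame u (P1 :: P2 :: S)`[j] (C' j).
  move=> /sz jT d p /(HR _ jT) [K h]; exists K; apply: germ_sub h => x.
  exact: inS.
have gT : glued (P1 :: P2 :: S) by case: pT.
have old j e : (j < size (P1 :: P2 :: S))%N -> e \in edges (P1 :: P2 :: S)`[j] ->
    [\/ e \in edges (P :: S)`[j.-1], j = 0%N /\ e = (b, w, a)
      | j = 1%N /\ e = (a, inv w, b)].
  case: j => [|[|j]] _ /=; last by move=> ?; apply: Or31.
    rewrite E1 mem_rcons in_cons => /orP[/eqP ->|h]; first by apply: Or32.
    by apply: Or31; rewrite E mem_cat h.
  rewrite E2 mem_rcons in_cons => /orP[/eqP ->|h]; first by apply: Or33.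
  by apply: Or31; rewrite E mem_cat h orbT.
have d0 : (0 < size (P1 :: P2 :: S))%N by [].
have d1 : (1 < size (P1 :: P2 :: S))%N by [].
have e0 : (b, w, a) \in edges (P1 :: P2 :: S)`[0] by rewrite /= E1 mem_rcons mem_head.
have e1 : (a, inv w, b) \in edges (P1 :: P2 :: S)`[1] by rewrite /= E2 mem_rcons mem_head.
have M : matched u P1 (C' 0%N) (b, w, a) P2 (C' 1%N) (a, inv w, b).
  move=> t t01 /=.
  have -> : lerp (1 - t) a b = lerp t b a by apply: point_eq => /=; ring.
  split; first by rewrite subrr; apply: lattice0.
  move=> d /(HR 0%N isT) [K h]; exists K.
  by split; apply: germ_sub h => x h; apply/inP; [left|right].
split=> //.
- move=> i j e e' iT jT eT e'T ee.
  have [eS|[i0 eE]|[i1 eE]] := old i e iT eT.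
  + have [e'S|[j0 eE']|[j1 eE']] := old j e' jT e'T.
    * by apply: matched_inside (HG _ _ _ _ (sz _ iT) (sz _ jT) eS e'S ee) => x; apply: inS.
    * have el : e.1.2 = inv w by rewrite -[e.1.2]invK -ee eE'.
      have [i1 eE] := label_inj gT iT d1 eT e1 el.
      by rewrite i1 eE j0 eE'; apply: matched_sym.
    * have el : e.1.2 = w by rewrite -[e.1.2]invK -ee eE' /= invK.
      have [i1 eE] := label_inj gT iT d0 eT e0 el.
      by rewrite i1 eE j1 eE'.
  + have el : e'.1.2 = inv w by rewrite ee eE.
    have [j1 eE'] := label_inj gT jT d1 e'T e1 el.
    by rewrite i0 eE j1 eE'.
  + have el : e'.1.2 = w by rewrite ee eE /= invK.
    have [j0 eE'] := label_inj gT jT d0 e'T e0 el.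
    by rewrite i1 eE j0 eE'; apply: matched_sym.
- move=> x0 K; have [i [x [iS ix xK Lx]]] := HU x0 K.
  case: i iS ix xK Lx => [|i] iS ix xK Lx; last by exists i.+2, x.
  by case/inP: ix => h; [exists 0%N, x|exists 1%N, x].
Qed.

(** The old sides of the two pieces have disjoint ranges of indices on the simple boundary of [P],
    so that they share at most the points [a] and [b]. *)
Lemma on_both x : on_bd P1 x -> on_bd P2 x -> on_seg a b x.
Proof.
have oa : on_seg a b a by exists 0; [lra|apply: point_eq => /=; ring].
have ob : on_seg a b b by exists 1; [lra|apply: point_eq => /=; ring].
have flip : on_seg b a x -> on_seg a b x.
  by move=> [s s01 ->]; exists (1 - s); [lra|apply: point_eq => /=; ring].
move=> /on_bdE[e]; rewrite E1 mem_rcons in_cons => /orP[/eqP -> /flip //|eP xe].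
move=> /on_bdE[e']; rewrite E2 mem_rcons in_cons => /orP[/eqP -> //|e'P xe'].
pose k := (size s1).+1.
have sP : size P = (k + (size s2).+1)%N by rewrite size_cat.
have [_ inj] : simple_bd P by case: PP.
have vk : vtx P k = b.
  rewrite /vtx modn_small; last by rewrite sP; lia.
  by rewrite nth_cat ltnn subnn.
have v0 : vtx P (size P) = a by rewrite /vtx modnn.
have bd0 i : bd P i 0 = vtx P i by apply: point_eq => /=; ring.
have first_ : x = b \/ exists i (s : R), [/\ (i < k)%N, 0 <= s < 1 & x = bd P i s].
  have [i ik eE] : exists2 i, (i < k)%N & e = (vtx P i, lab P i, vtx P i.+1).
    exists (index e (open_edges ((a, y) :: s1) b)).
      by rewrite -index_mem size_open_edges in eP.
    rewrite -(nth_edges e); last first.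
      by rewrite -index_mem size_open_edges in eP; rewrite sP; apply: ltn_addr.
    by rewrite E nth_cat index_mem eP nth_index.
  case: xe => s /andP[s0]; rewrite le_eqVlt => /orP[/eqP ->|s1'] xE; last first.
    by right; exists i, s; rewrite s0 s1' xE eE.
  have {}xE : x = vtx P i.+1 by rewrite xE eE; apply: point_eq => /=; ring.
  have [h|h] := eqVneq i.+1 k; first by left; rewrite xE h vk.
  by right; exists i.+1, 0; rewrite lexx ltr01 bd0; split=> //; lia.
have second : x = a \/ exists j (s : R), [/\ (k <= j < size P)%N, 0 <= s < 1 & x = bd P j s].
  have [j jk eE] : exists2 j, (k <= j < size P)%N & e' = (vtx P j, lab P j, vtx P j.+1).
    have lt : (index e' (open_edges ((b, z) :: s2) a) < (size s2).+1)%N.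
      by rewrite -index_mem size_open_edges in e'P.
    exists (k + index e' (open_edges ((b, z) :: s2) a))%N.
      by rewrite leq_addr sP ltn_add2l.
    rewrite -(nth_edges e); last by rewrite sP ltn_add2l.
    rewrite E nth_cat size_open_edges ltnNge leq_addr /= addKn.
    by rewrite nth_index.
  case: xe' => s /andP[s0]; rewrite le_eqVlt => /orP[/eqP ->|s1'] xE; last first.
    by right; exists j, s; rewrite s0 s1' xE eE.
  have {}xE : x = vtx P j.+1 by rewrite xE eE; apply: point_eq => /=; ring.
  have [h|h] := eqVneq j.+1 (size P); first by left; rewrite xE h v0.
  by right; exists j.+1, 0; rewrite lexx ltr01 bd0; split=> //; lia.
case: first_ => [->//|[i [s [ik s01 xi]]]]; case: second => [->//|[j [r [jk r01 xj]]]].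
have iP : (i < size P)%N by rewrite sP; lia.
have jP : (j < size P)%N by lia.
have [ij _] := inj i j s r iP jP s01 r01 (etrans (esym xi) xj).
by move: jk; rewrite -ij; lia.
Qed.

(** The pasted polygon takes the position of the first piece. By the matching of the diagonal, that
    of the second piece differs from it by a lattice vector, which [colour] does not see. *)
Lemma structure_paste : (exists C, structure u (P1 :: P2 :: S) C) ->
  exists C, structure u (P :: S) C.
Proof.
move=> [C [HR HG HU]].
have eD1 : (b, w, a) \in edges P1 by rewrite E1 mem_rcons mem_head.
have eD2 : (a, inv w, b) \in edges P2 by rewrite E2 mem_rcons mem_head.
have M : matched u P1 (C 0%N) (b, w, a) P2 (C 1%N) (a, inv w, b) by exact: (HG 0%N 1%N).
have lt t : lerp (1 - t) a b = lerp t b a by apply: point_eq => /=; ring.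
have L12 : lattice ((C 0%N).1 - (C 1%N).1).
  have [|+ _] := M (1 / 2); first by lra.
  by rewrite /= lt opprD addrACA subrr add0r.
have e01 x : x + (C 0%N).1 = x + (C 1%N).1 + ((C 0%N).1 - (C 1%N).1).
  by apply: point_eq => /=; ring.
pose c0 : chart R A :=
  ((C 0%N).1, fun x => if winding P1 x == 1 then (C 0%N).2 x else (C 1%N).2 x).
have sh1 d x : inside P1 x -> sheet u c0 d x = sheet u (C 0%N) d x.
  by rewrite /inside /sheet /= => ->; rewrite eqxx.
have sh2 d x : inside P2 x -> sheet u c0 d x = sheet u (C 1%N) d x.
  move=> i2; rewrite /sheet /=; case: eqP => [/in12 /(_ i2)//|_].
  by rewrite e01 colour_shift.
have t1 : tame u P1 (C 0%N) by exact: (HR 0%N).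
have t2 : tame u P2 (C 1%N) by exact: (HR 1%N).
have tP : tame u P c0.
  move=> d p rd1.
  have rd2 : regular d (p + (C 1%N).1).
    by move: rd1; rewrite /= e01 => /(regular_shift _ _ L12).
  have [K1 g1] := t1 d p rd1; have [K2 g2] := t2 d p rd2.
  have both : K1 = K2 -> exists K, germ (inside P) (sheet u c0 d) p K.
    move=> eK; exists K1; rewrite -{}eK in g2.
    by apply: nearby2 g1 g2 => x h1 h2 /inP[] ix; [rewrite sh1 ?h1|rewrite sh2 ?h2].
  have one : nearby p (fun x => ~ inside P2 x) ->
      exists K, germ (inside P) (sheet u c0 d) p K.
    move=> N; exists K1; apply: nearby2 g1 N => x h1 n2 /inP[] ix //.
    by rewrite sh1 ?h1.
  have two : nearby p (fun x => ~ inside P1 x) ->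
      exists K, germ (inside P) (sheet u c0 d) p K.
    move=> N; exists K2; apply: nearby2 g2 N => x h2 n1 /inP[] ix //.
    by rewrite sh2 ?h2.
  (* On the diagonal the germs of the two pieces agree, by [matched] at interior points and by
     [matched_end] at the end points. *)
  have [[s /andP[s0 s1'] pE]|nd] := boolp.EM (on_seg b a p).
    apply: both; move: s0 s1'; rewrite !le_eqVlt => /orP[/eqP s0|s0] /orP[/eqP s1'|s1'].
    - by move/eqP: s1'; rewrite -s0 eq_sym oner_eq0.
    - have pb : p = b by rewrite pE -s0; apply: point_eq => /=; ring.
      rewrite pb in g1 g2 rd2; apply/esym.
      by apply: (matched_end PP2 PP1 eD2 eD1 (matched_sym M) rd2 g2 g1).
    - have pa : p = a by rewrite pE s1'; apply: point_eq => /=; ring.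
      rewrite pa in g1 g2 rd1.
      exact: (matched_end PP1 PP2 eD1 eD2 M rd1 g1 g2).
    - have s01 : 0 < s < 1 by rewrite s0.
      have [_] := M s s01; rewrite /= lt -pE => /(_ d rd1) [K [h1 h2]].
      have eE1 : exists x, (sheet u (C 0%N) d x = K1 /\ sheet u (C 0%N) d x = K).
        rewrite pE in g1 h1.
        have [x [[k1 k2] ix]] := near_edge_inside PP1 eD1 s01 (nearby_and g1 h1).
        by exists x; split; [apply: k1|apply: k2].
      have eE2 : exists x, (sheet u (C 1%N) d x = K2 /\ sheet u (C 1%N) d x = K).
        have s01' : 0 < 1 - s < 1 by lra.
        rewrite pE -lt in g2 h2.
        have [x [[k1 k2] ix]] := near_edge_inside PP2 eD2 s01' (nearby_and g2 h2).
        by exists x; split; [apply: k1|apply: k2].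
      by case: eE1 => x [<- ->]; case: eE2 => x' [<- ->].
  (* Off the diagonal, [p] misses one of the two boundaries by [on_both]. The winding number of that
     piece is constant near [p], so one of the pieces can be ignored there. *)
  have [b1|/winding_near N] := boolp.EM (on_bd P1 p); last first.
    have [w1|w1] := winding01 p PP1.
      by apply: two; apply: nearbyW N => x; rewrite /inside => ->; rewrite w1.
    by apply: one; apply: nearbyW N => x e1; apply: in12; rewrite /inside e1.
  have [b2|/winding_near N] := boolp.EM (on_bd P2 p); last first.
    have [w2|w2] := winding01 p PP2.
      by apply: one; apply: nearbyW N => x; rewrite /inside => ->; rewrite w2.
    by apply: two; apply: nearbyW N => x e2 h1; apply: (in12 h1); rewrite /inside e2.
  case: nd; have [s s01 ->] := on_both b1 b2.
  by exists (1 - s); [lra|apply: point_eq => /=; ring].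
pose C' i := if i is j.+1 then C j.+2 else c0; exists C'.
have tT i : (i < size (P :: S))%N -> tame u (P :: S)`[i] (C' i).
  by case: i => [|i] // iS; exact: (HR i.+2).
have back i e : (i < size (P :: S))%N -> e \in edges (P :: S)`[i] ->
    exists j, [/\ (j < size (P1 :: P2 :: S))%N, e \in edges (P1 :: P2 :: S)`[j],
      lattice ((C' i).1 - (C j).1),
      (forall x, inside (P1 :: P2 :: S)`[j] x -> inside (P :: S)`[i] x) &
      forall d x, inside (P1 :: P2 :: S)`[j] x -> sheet u (C' i) d x = sheet u (C j) d x].
  case: i => [|i] iS /=.
    rewrite E mem_cat => /orP[] eP.
      exists 0%N; rewrite /= E1 mem_rcons in_cons eP orbT subrr; split=> //.
        exact: lattice0.
      by move=> x ix; apply/inP; left.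
    exists 1%N; rewrite /= E2 mem_rcons in_cons eP orbT; split=> //.
    by move=> x ix; apply/inP; right.
  by move=> eS; exists i.+2; rewrite subrr; split=> //; apply: lattice0.
have PT j : (j < size (P1 :: P2 :: S))%N -> is_polygon (P1 :: P2 :: S)`[j].
  by move=> jT; apply: pT.1; apply: mem_nth.
split=> //.
- move=> i j e e' iS jS eS e'S ee.
  have [i' [iT eT Li Ii Si]] := back i e iS eS.
  have [j' [jT e'T Lj Ij Sj]] := back j e' jS e'S.
  exact: (matched_extend (PT _ iT) (PT _ jT) eT e'T Li Lj Ii Ij Si Sj (tT _ iS)
    (tT _ jS) (HG _ _ _ _ iT jT eT e'T ee)).
- move=> x0 K; have [i [x [iS ix xK Lx]]] := HU x0 K.
  case: i iS ix xK Lx => [|[|i]] iS ix xK Lx; last by exists i.+1, x.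
    exists 0%N, x; split=> //; first by apply/inP; left.
    by rewrite /= (eqP (introT eqP ix)) eqxx.
  exists 0%N, x; split=> //=; first by apply/inP; right.
    by case: eqP => // /in12 /(_ ix).
  have -> : x + (C 0%N).1 - x0 = x + (C 1%N).1 - x0 + ((C 0%N).1 - (C 1%N).1).
    by apply: point_eq => /=; ring.
  exact: latticeD.
Qed.

End Cut.

End CutAndPaste.

Section Invariance.
Variables (R : realType) (A : zmodType) (u : A).

Lemma structure_step (S T : seq (polygon R)) : cut_paste_step S T ->
  (exists C, structure u S C) <-> (exists C, structure u T C).
Proof.
case=> pS pT ST; case: ST pS pT => {S T}.
- by move=> S T ST _ _; split; apply: structure_perm; rewrite // perm_sym.
- by move=> k P S _ _; exact: structure_rot.
- by move=> v P S _ _; exact: structure_translate.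
- by move=> f S fI fV _ _; exact: structure_relabel.
- move=> m m' t S t01 pS pT; split; first exact: structure_split.
  exact: structure_unsplit.
- move=> a b x y z s1 s2 S pS pT; split; first exact: structure_cut.
  exact: structure_paste.
Qed.

Lemma structure_cut_paste (S T : seq (polygon R)) : cut_paste S T ->
  (exists C, structure u S C) <-> (exists C, structure u T C).
Proof.
elim=> {S T} [S T /structure_step//|//|S T _ [H1 H2]|S T U _ [H1 H2] _ [H3 H4]].
  by split.
by split=> [/H1 /H3|/H4 /H2].
Qed.

End Invariance.

(** * The cover defined by the staircase *)

Section Staircase.
Variables (R : realType) (m : nat).
Let n := m.+3.
Implicit Types (x z : point R) (K : 'Z_n) (j k : nat).

Lemma lattice_int (k l : int) : (2 %| k + l)%Z -> lattice ((k%:~R, l%:~R) : point R).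
Proof.
move=> /dvdzP[q e]; exists q, (k - q).
by apply: point_eq; congr intr; rewrite /=; lia.
Qed.

Lemma inside_square j x :
  inside (square R n j) x <-> 0 <= x.1 < 1 /\ 0 <= x.2 < 1.
Proof.
rewrite /inside windingE /edges /square /wind /= !big_cons big_nil /=.
rewrite (crossing_horizontal x (a := (0, 0))) // (crossing_horizontal x (a := (1, 1))) //.
rewrite (crossing_anti (0, 0) (0, 1)) !crossing_up ?ltr01 // !crossE /=.
rewrite (_ : _ - _ * (x.1 - 1) = 1 - x.1); last by ring.
rewrite (_ : _ - _ * (x.1 - 0) = - x.1); last by ring.
rewrite subr_gt0 oppr_gt0 !add0r addr0.
case: (0 <= x.2 < 1) => /=; last by split=> // -[].
have [h1|h1] := ltP x.1 1; have [h0|h0] := ltP x.1 0; rewrite /=; split=> //; try by case.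
Qed.

(** Squares 2k and 2k + 1, glued along both vertical sides, form sheet k, the first over the unit
    square at the origin and the second over its right neighbour. Horizontal sides lead from 2k + 1
    to 2k + 2, on the next sheet, whence the choice [u = 1]. *)
Let chart_of j : chart R 'Z_n := ((((odd j)%:R, 0) : point R), fun=> (j./2)%:R).

Let value d j : 'Z_n := (j./2)%:R - 1 *+ (~~ d && ~~ odd j).

Lemma sheet_square d j x : inside (square R n j) x ->
  sheet (1 : 'Z_n) (chart_of j) d x = value d j.
Proof.
move=> /inside_square [/andP[h1 h2] /andP[h3 h4]].
rewrite /sheet /value /colour /=; congr (_ - _ *+ (_ && _)).
rewrite addr0 floorDrz ?rpredMn ?rpred1 //.
have -> : Num.floor x.1 = 0 by apply: floor_def; rewrite h1 add0r.
have -> : Num.floor x.2 = 0 by apply: floor_def; rewrite h3 add0r.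
by rewrite addr0 add0r; case: (odd j); rewrite /= ?mulr1n ?mulr0n ?floor1 ?floor0.
Qed.

Lemma odd_vert j : (j < n.*2)%N -> odd (vert n j) = ~~ odd j.
Proof.
move=> jN; rewrite /vert; case: ifP => oj.
  by have [->|?] := eqVneq j.+1 n.*2; rewrite ?modnn ?modn_small //; lia.
have [->|j0] := posnP j; first by rewrite add0n modn_small; lia.
by rewrite (_ : (j + n.*2).-1 = (j.-1 + n.*2)%N) ?modnDr ?modn_small; lia.
Qed.

(** The colour correction lowers square 2k + 2 from k + 1 to k, the value of square 2k + 1. Where
    the staircase closes up, from 2n - 1 to 0, this reads 0 - 1 = n - 1 in Z/n. *)
Lemma value_vert j : (j < n.*2)%N -> value false (vert n j) = value false j.
Proof.
have n0 : (n%:R : 'Z_n) = 0 by exact: pchar_Zp.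
have main i : (i < n.*2)%N -> odd i -> value false (vert n i) = value false i.
  move=> iN oi; rewrite /value /vert oi /= mulr0n subr0.
  have [h|h] := eqVneq i.+1 n.*2.
    rewrite h modnn /= mulr1n sub0r; apply/eqP; rewrite eq_sym -addr_eq0 natr1.
    have -> : (i./2).+1 = n by lia.
    by rewrite n0.
  rewrite modn_small; last by lia.
  rewrite /= oi /= mulr1n.
  have -> : uphalf i = (i./2).+1 by lia.
  by rewrite -natr1 addrK.
move=> jN; have [oj|ej] := boolP (odd j); first exact: main.
have [vN vv] := vertK jN; have := main _ vN; rewrite odd_vert // ej vv.
by move=> ->.
Qed.

Let germ_value j p d :
  germ (inside (square R n j)) (sheet (1 : 'Z_n) (chart_of j) d) p (value d j).
Proof. by apply: nearbyT => x; exact: sheet_square. Qed.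

Lemma matched_right i j (l l' : letter) : (j < n.*2)%N -> i = horiz j ->
  matched (1 : 'Z_n) (square R n i) (chart_of i) ((1, 0), l, (1, 1))
                     (square R n j) (chart_of j) ((0, 1), l', (0, 0)).
Proof.
move=> jN ij t t01 /=; have [hN hh] := horizK jN.
have oi : odd i = ~~ odd j by rewrite ij /horiz; case: ifP; lia.
have ej : i./2 = j./2 by rewrite ij /horiz; case: ifP; lia.
split.
  rewrite (_ : _ - _ = ((1 + (odd i)%:Z - (odd j)%:Z)%:~R, 0%:~R)).
    by apply: lattice_int; rewrite oi; case: (odd j).
  by apply: point_eq; rewrite /= ?intrD ?mulrNz; ring.
have v : value true j = value true i by rewrite /value ej.
case=> [_|]; first by exists (value true j); rewrite {1}v.
rewrite /regular /= subrr mulr0 addr0 => /negP[].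
by rewrite rpredD ?rpred1 // rpredMn ?rpred1.
Qed.

Lemma matched_top i j (l l' : letter) : (j < n.*2)%N -> i = vert n j ->
  matched (1 : 'Z_n) (square R n i) (chart_of i) ((1, 1), l, (0, 1))
                     (square R n j) (chart_of j) ((0, 0), l', (1, 0)).
Proof.
move=> jN ij t t01 /=; have oi : odd i = ~~ odd j by rewrite ij odd_vert.
split.
  rewrite (_ : _ - _ = (((odd i)%:Z - (odd j)%:Z)%:~R, 1%:~R)).
    by apply: lattice_int; rewrite oi; case: (odd j).
  by apply: point_eq; rewrite /= ?intrD ?mulrNz; ring.
have v : value false j = value false i by rewrite ij value_vert.
case=> [|_]; last by exists (value false j); rewrite {1}v.
rewrite /regular /= subrr mulr0 !addr0 => /negP[].
exact: rpred1.
Qed.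

Lemma structure_escher : exists C, structure (1 : 'Z_n) (escher R n) C.
Proof.
exists chart_of; have szE : size (escher R n) = n.*2 by rewrite size_map size_iota.
have nE j : (j < n.*2)%N -> (escher R n)`[j] = square R n j.
  by move=> jN; rewrite (nth_map 0%N) ?size_iota // nth_iota.
apply: structureP; rewrite ?szE.
- by move=> j jN d p _; rewrite nE //; exists (value d j); apply: germ_value.
- move=> i j e e' l iN jN; rewrite !nE // /edges /square /= !inE.
  case/or4P=> /eqP -> /=; case/or4P=> /eqP -> /=;
    move=> /[dup] /(congr1 fst) /= E1 /(congr1 snd) //= _;
    move=> /[dup] /(congr1 fst) /= E2 /(congr1 snd) //= _.
  + by move: E1; rewrite -E2; lia.
  + by apply: matched_right => //; lia.
  + by apply: matched_top => //; lia.
  + by move: E1; rewrite -E2; lia.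
- move=> z K.
  pose b := ~~ colour z.
  have KN : (K < n)%N by exact: ltn_ord.
  (* The colour of [z] selects one of the squares 2K and 2K + 1 of sheet K; the point is [z] reduced
     modulo 1. *)
  exists (b + K.*2)%N, (z.1 - (Num.floor z.1)%:~R, z.2 - (Num.floor z.2)%:~R).
  have jN : (b + K.*2 < n.*2)%N by case: (b); lia.
  split=> //.
  + rewrite nE //; apply/inside_square => /=.
    have /andP[h1 h2] := floor_itv z.1; have /andP[h3 h4] := floor_itv z.2.
    by rewrite !intrD in h2 h4; split; lra.
  + by rewrite /= half_bit_double natr_Zp.
  + rewrite /= oddD odd_double addbF oddb.
    rewrite (_ : _ - _ = ((b%:Z - Num.floor z.1)%:~R, (- Num.floor z.2)%:~R)).
      apply: lattice_int; rewrite /b /colour; case: (boolP (2 %| _)%Z) => /= h; lia.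
    by apply: point_eq; rewrite /= ?intrD ?mulrNz; case: (b) => /=; ring.
Qed.

End Staircase.

(** * Monodromy around integral points *)

(** Connectedness of [0, 1]: the supremum of the [t] such that the value at 0 is kept up to [t] has
    to be 1. A relation is used because a germ is not given as a function of its point. *)
Lemma segment_const (R : realType) (V : Type) (T : R -> V -> Prop) :
  (forall t, 0 <= t <= 1 -> exists K, exists2 e : R, 0 < e &
     forall s, 0 <= s <= 1 -> `|s - t| < e -> T s K) ->
  (forall t K K', 0 <= t <= 1 -> T t K -> T t K' -> K = K') ->
  exists K, forall t, 0 <= t <= 1 -> T t K.
Proof.
move=> loc uni; have h0 : 0 <= (0 : R) <= 1 by rewrite lexx ler01.
have [K [e0 e00 H0]] := loc 0 h0; exists K.
pose Z : classical_sets.set R := fun t => 0 <= t <= 1 /\ forall s, 0 <= s <= t -> T s K.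
have Z0 : Z 0.
  split=> // s /andP[s0 s0']; have -> : s = 0 by apply/eqP; rewrite eq_le s0 s0'.
  by apply: H0; rewrite ?subrr ?normr0.
have supZ : classical_sets.has_sup Z.
  by split; [exists 0 | exists 1 => t [/andP[]]].
have ubZ t : Z t -> t <= sup Z by apply: sup_upper_bound.
have c0 : 0 <= sup Z := ubZ 0 Z0.
have c1 : sup Z <= 1 by apply: sup_le_ub => [|t [/andP[]] //]; exists 0.
have c01 : 0 <= sup Z <= 1 by rewrite c0 c1.
have [Kc [e e0' Hc]] := loc _ c01.
have [t [t01 tT] tc] := sup_adherent e0' supZ.
have tle : t <= sup Z by apply: ubZ.
have [t0 t1] := andP t01.
have KK : Kc = K.
  apply: (uni t) => //; last by apply: tT; rewrite lexx t0.
  by apply: Hc => //; rewrite ltr_norml; apply/andP; split; lra.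
have nearK s : 0 <= s <= 1 -> s < sup Z + e -> T s K.
  move=> /andP[s0 s1] se; have [st|ts] := leP s t; first by apply: tT; rewrite s0 st.
  by rewrite -KK; apply: Hc; rewrite ?s0 // ltr_norml; apply/andP; split; lra.
have [h|h] := leP 1 (sup Z + e / 2).
  by move=> s s01; apply: nearK => //; case/andP: s01 => _ ?; lra.
have /ubZ : Z (sup Z + e / 2).
  split=> [|s /andP[s0 s1]]; first by apply/andP; split; lra.
  by apply: nearK; [apply/andP; split|]; lra.
by move=> ?; exfalso; lra.
Qed.

Lemma even_pred (k : int) : (2 %| k - 1)%Z = ~~ (2 %| k)%Z.
Proof. lia. Qed.

Section Branching.
Variables (R : realType) (A : zmodType) (u : A).
Implicit Types (a b p q v x z : point R) (P Q : polygon R) (S : seq (polygon R)).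
Implicit Types (e : edge R) (d : bool) (K : A) (c : chart R A).

Lemma germ_const (E : point R -> Prop) (f : point R -> A) a b :
  (forall t, 0 <= t <= 1 -> exists K, germ E f (lerp t a b) K) ->
  (forall t (G : point R -> Prop), 0 <= t <= 1 -> nearby (lerp t a b) G ->
     exists x, G x /\ E x) ->
  exists K, forall t, 0 <= t <= 1 -> germ E f (lerp t a b) K.
Proof.
move=> loc dense.
apply: (@segment_const R A (fun t K => germ E f (lerp t a b) K)).
  move=> t /loc [K /germ_open /nearby_lerp [r r0 H]].
  by exists K, r => // s _; apply: H.
move=> t K K' t01 g g'; have [x [[h h'] Ex]] := dense t _ t01 (nearby_and g g').
by rewrite -(h Ex) (h' Ex).
Qed.

Definition integral x : Prop := forall d, coord d x \is a Num.int.

Lemma sheet_corner c (E : point R -> Prop) q K K' :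
  (forall G, nearby q G -> exists x, G x /\ E x) ->
  (forall d, regular d (q + c.1)) ->
  germ E (sheet u c true) q K -> germ E (sheet u c false) q K' ->
  K' = K - u *+ colour (q + c.1).
Proof.
move=> dense rd g g'.
have N d := nearby_trans (nearby_regular (rd d)).
have [x [[[h h'] [[_ f2] [_ f1]]] Ex]] :=
  dense _ (nearby_and (nearby_and g g') (nearby_and (N true) (N false))).
rewrite -(h' Ex) -(h Ex) /sheet /= subr0; congr (_ - _ *+ _).
by rewrite /colour; rewrite /= in f1 f2; rewrite f1 f2.
Qed.

(* Around an integral point the sheet changes by [u *+ 2] or [- u *+ 2]: this is
   read off by going around a small square with sides in the four directions. *)
Lemma monodromy c (E : point R -> Prop) p : integral (p + c.1) -> u *+ 2 != 0 ->
  nearby p (fun q => forall d, regular d (q + c.1) ->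
    exists K, germ E (sheet u c d) q K) ->
  nearby p (fun q => forall G, nearby q G -> exists x, G x /\ E x) -> False.
Proof.
move=> ip u2 HK HE; have [r r0 H] := nearby_and HK HE.
(* As h < r, the four corners stay in the neighbourhood; as h < 1, they fall in the four unit
   squares around the integral point, off all grid lines. *)
pose h := Num.min r 1 / 2.
have hr : h < r by rewrite /h; case: (leP r 1) => ?; lra.
have h0 : 0 < h by rewrite /h; case: (leP r 1) => ?; lra.
have h1 : h < 1 by rewrite /h; case: (leP r 1) => ?; lra.
clearbody h.
have /intrP[k1 k1E] := ip false; have /intrP[k2 k2E] := ip true.
rewrite /= in k1E k2E.
have fl (k : int) (y o : R) : y + o = k%:~R ->
    (Num.floor (y + h + o) = k /\ y + h + o \isn't a Num.int) /\
    (Num.floor (y - h + o) = k - 1 /\ y - h + o \isn't a Num.int).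
  by move=> e; split; apply: floor_between; rewrite ?intrD ?mulrNz; apply/andP; split; lra.
have [[f1 i1] [g1 j1]] := fl _ _ _ k1E; have [[f2 i2] [g2 j2]] := fl _ _ _ k2E.
pose NE : point R := (p.1 + h, p.2 + h); pose NW : point R := (p.1 - h, p.2 + h).
pose SE : point R := (p.1 + h, p.2 - h); pose SW : point R := (p.1 - h, p.2 - h).
have const d (a b : point R) : (forall t, 0 <= t <= 1 -> near r p (lerp t a b)) ->
    (forall t, regular d (lerp t a b + c.1)) ->
    exists K, germ E (sheet u c d) a K /\ germ E (sheet u c d) b K.
  move=> nr rd; have [t t01|t G t01 nG|K HKK] := @germ_const E (sheet u c d) a b.
  - by have [HH _] := H _ (nr t t01); apply: HH.
  - by have [_ HH] := H _ (nr t t01); apply: HH.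
  - exists K; split.
      have -> : a = lerp 0 a b by apply: point_eq => /=; ring.
      by apply: HKK; rewrite lexx ler01.
    have -> : b = lerp 1 a b by apply: point_eq => /=; ring.
    by apply: HKK; rewrite lexx ler01.
have [KN [gN1 gN2]] : exists K, germ E (sheet u c true) NE K /\ germ E (sheet u c true) NW K.
  apply: const => [t /andP[t0 t1]|t]; first by apply/nearP; split=> /=; nra.
  by rewrite /regular /= subrr mulr0 addr0.
have [KS [gS1 gS2]] : exists K, germ E (sheet u c true) SE K /\ germ E (sheet u c true) SW K.
  apply: const => [t /andP[t0 t1]|t]; first by apply/nearP; split=> /=; nra.
  by rewrite /regular /= subrr mulr0 addr0.
have [KE [gE1 gE2]] : exists K, germ E (sheet u c false) NE K /\ germ E (sheet u c false) SE K.
  apply: const => [t /andP[t0 t1]|t]; first by apply/nearP; split=> /=; nra.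
  by rewrite /regular /= subrr mulr0 addr0.
have [KW [gW1 gW2]] : exists K, germ E (sheet u c false) NW K /\ germ E (sheet u c false) SW K.
  apply: const => [t /andP[t0 t1]|t]; first by apply/nearP; split=> /=; nra.
  by rewrite /regular /= subrr mulr0 addr0.
have dense q : near r p q -> forall G, nearby q G -> exists x, G x /\ E x.
  by move=> nq; have [_] := H _ nq.
have nNE : near r p NE by apply/nearP; split=> /=; lra.
have nNW : near r p NW by apply/nearP; split=> /=; lra.
have nSE : near r p SE by apply/nearP; split=> /=; lra.
have nSW : near r p SW by apply/nearP; split=> /=; lra.
have c1 : KE = KN - u *+ colour (NE + c.1).
  by apply: (sheet_corner (dense _ nNE) _ gN1 gE1); case.
have c2 : KW = KN - u *+ colour (NW + c.1).
  by apply: (sheet_corner (dense _ nNW) _ gN2 gW1); case.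
have c3 : KE = KS - u *+ colour (SE + c.1).
  by apply: (sheet_corner (dense _ nSE) _ gS1 gE2); case.
have c4 : KW = KS - u *+ colour (SW + c.1).
  by apply: (sheet_corner (dense _ nSW) _ gS2 gW2); case.
move: c1 c2 c3 c4; rewrite /colour /= f1 f2 g1 g2.
rewrite addrA [k1 - 1 + k2]addrAC [k1 - 1 + (k2 - 1)]addrA [k1 - 1 + k2]addrAC.
rewrite !even_pred negbK.
(* Colours alternate around the point. Eliminating [KE] and [KW] leaves KN - u = KS and KN = KS - u,
   whichever colour comes first. *)
have aux (a b : A) : a - u = b -> a = b - u -> u *+ 2 = 0.
  move=> <- ab; apply/esym/oppr_inj/(addrI a).
  by rewrite oppr0 addr0 mulr2n opprD addrA -ab.
move=> -> -> h3 h4; case/eqP: u2; move: h3 h4.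
case: (2 %| k1 + k2)%Z => /=; rewrite !mulr1n !mulr0n !subr0 => h3 h4.
  exact: (aux KN KS).
exact: (aux KN KS).
Qed.

Lemma integral_on_bd P c p : u *+ 2 != 0 -> tame u P c -> inside P p ->
  integral (p + c.1) -> on_bd P p.
Proof.
move=> u2 tP iP ip; apply: boolp.contrapT => /winding_near N.
have {}N : nearby p (inside P) by apply: nearbyW N => x; rewrite /inside => ->.
apply: (@monodromy c (inside P) p ip u2).
  by apply: nearbyT => q d /tP.
by apply: nearbyW N => q iq G /nearby_refl Gq; exists q.
Qed.

(** The half-disc on the left of [e] and that of its partner, brought back by the gluing translation
    [v], form a disc around [p] cut along the side. The chart [c'] describes both halves, [matched]
    makes them agree along the side, and [monodromy] applies with the complement of the line as
    [E]. *)
Lemma integral_not_in_side P c e e' (t : R) : u *+ 2 != 0 -> is_polygon P ->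
  tame u P c -> e \in edges P -> e' \in edges P ->
  e'.2 - e'.1.1 = - (e.2 - e.1.1) -> matched u P c e P c e' -> 0 < t < 1 ->
  ~ integral (lerp t e.1.1 e.2 + c.1).
Proof.
move=> u2 PP tP eP e'P vec M t01; set p := lerp t e.1.1 e.2 => ip.
have t01' : 0 < 1 - t < 1 by lra.
pose p' := lerp (1 - t) e'.1.1 e'.2; pose v := p' - p.
have v1 : e'.2.1 = e'.1.1.1 - (e.2.1 - e.1.1.1) by have /= := congr1 fst vec; lra.
have v2 : e'.2.2 = e'.1.1.2 - (e.2.2 - e.1.1.2) by have /= := congr1 snd vec; lra.
have vE s : lerp (1 - s) e'.1.1 e'.2 = lerp s e.1.1 e.2 + v.
  by rewrite /v /p' /p; apply: point_eq; rewrite /= ?v1 ?v2; ring.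
have Lv : lattice v.
  have [+ _] := M t t01; rewrite -/p -/p' -opprB => /latticeN; rewrite opprK.
  by congr lattice; rewrite /v opprD addrACA subrr addr0.
have n0 : e.2 - e.1.1 != 0 by apply: edge_neq eP; case: PP.
have nab : e.1.1 != e.2 by rewrite eq_sym -subr_eq0.
pose f x := cross (e.2 - e.1.1) (x - e.1.1).
pose c' : chart R A := (c.1, fun x => if 0 < f x then c.2 x else c.2 (x + v)).
pose E x := f x != 0.
have sR d x : f x < 0 -> sheet u c' d x = sheet u c d (x + v).
  move=> h; rewrite /sheet /= ltNge (ltW h) /= (addrAC x v).
  by rewrite (colour_shift _ Lv).
have sL d x : 0 < f x -> sheet u c' d x = sheet u c d x.
  by move=> h; rewrite /sheet /= h.
have NL : nearby p (fun x => 0 < f x -> inside P x).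
  by apply: nearbyW (near_edge PP eP t01) => x [h _] /h [].
have NR : nearby p (fun x => f x < 0 -> inside P (x + v)).
  have : nearby (p + v) (fun x => 0 < cross (e'.2 - e'.1.1) (x - e'.1.1) -> inside P x).
    by rewrite /p -vE; apply: nearbyW (near_edge PP e'P t01') => x [h _] /h [].
  move/nearby_trans; apply: nearbyW => x h fx; apply: h.
  rewrite -(cross_lerp (1 - t)) vE -/p.
  rewrite (_ : cross _ _ = - f x) ?oppr_gt0 //.
  by rewrite vec /f /cross /p /=; ring.
have NS : nearby p (fun x => f x = 0 -> exists2 s : R, 0 < s < 1 & x = lerp s e.1.1 e.2).
  pose w := e.2 - e.1.1; pose D := w.1 ^+ 2 + w.2 ^+ 2.
  have f0 : cross (e.2 - e.1.1) (p - e.1.1) = 0 by exact: lerp_cross.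
  have [D0 _] := line_param nab f0; rewrite -/w -/D in D0.
  have dotE x s : x = lerp s e.1.1 e.2 ->
      w.1 * (x.1 - e.1.1.1) + w.2 * (x.2 - e.1.1.2) = s * D.
    by move=> ->; rewrite /D /w /=; ring.
  have pD := dotE p t erefl; have [t0 t1] := andP t01.
  have h1 : 0 < w.1 * p.1 + w.2 * p.2 + (- w.1 * e.1.1.1 - w.2 * e.1.1.2).
    by have := mulr_gt0 t0 D0; rewrite -pD; lra.
  have h2 : 0 < - w.1 * p.1 + - w.2 * p.2 + (w.1 * e.1.1.1 + w.2 * e.1.1.2 + D).
    have : 0 < (1 - t) * D by rewrite mulr_gt0 // subr_gt0.
    by rewrite mulrBl -pD; lra.
  apply: nearby2 (nearby_affine h1) (nearby_affine h2) => x k1 k2 fx.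
  have [_ [s xE]] := line_param nab fx; exists s => //; have sD := dotE x s xE.
  have l1 : 0 < s * D by rewrite -sD; lra.
  have l2 : 0 < (1 - s) * D by rewrite mulrBl -sD; lra.
  by rewrite !pmulr_lgt0 // in l1 l2; rewrite l1; lra.
have ip' : integral (p + c'.1) by [].
apply: (@monodromy c' E p ip' u2); last first.
  apply: nearbyT => q G nG; have [] := ltgtP 0 (f q) => fq.
  - by exists q; split; [apply: nearby_refl|rewrite /E gt_eqF].
  - by exists q; split; [apply: nearby_refl|rewrite /E lt_eqF].
  - have [x [Gx cx]] := nearby_left n0 nG; exists x; split=> //.
    rewrite /E (_ : f x = cross (e.2 - e.1.1) (x - q)) ?gt_eqF //.
    by move: fq; rewrite /f /cross /=; lra.
apply: nearby2 (nearby_and (nearby_nearby NL) (nearby_nearby NR)) NS.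
move=> q [NLq NRq] NSq d rd.
have rd' : regular d (q + v + c.1).
  by rewrite -addrA [v + _]addrC addrA; apply/(regular_shift _ _ Lv).
have left_ K : germ (inside P) (sheet u c d) q K ->
    nearby q (fun x => 0 < f x -> sheet u c' d x = K).
  by move=> g; apply: nearby2 g NLq => x h1 h2 fx; rewrite sL // h1 //; apply: h2.
have right_ K : germ (inside P) (sheet u c d) (q + v) K ->
    nearby q (fun x => f x < 0 -> sheet u c' d x = K).
  move=> /nearby_trans g; apply: nearby2 g NRq => x h1 h2 fx.
  by rewrite sR // h1 //; apply: h2.
have [fq|fq|fq] := ltgtP 0 (f q).
- have [K g] := tP d q rd; exists K.
  by apply: nearby2 (left_ _ g) (nearby_cross_gt0 fq) => x h1 h2 _; apply: h1.
- have [K g] := tP d _ rd'; exists K.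
  by apply: nearby2 (right_ _ g) (nearby_cross_lt0 fq) => x h1 h2 _; apply: h1.
- have [s s01 qE] := NSq (esym fq).
  have [_ /(_ d)] := M s s01; rewrite vE -qE => /(_ rd) [K [g1 g2]].
  exists K; apply: nearby2 (left_ _ g1) (right_ _ g2) => x h1 h2.
  by rewrite /E neq_lt => /orP[]; [apply: h2|apply: h1].
Qed.

End Branching.

(** * Convex presentations *)

Section Convex.
Variables (R : realType) (P : polygon R).
Hypotheses (PP : is_polygon P) (cP : convex_polygon P).
Implicit Types (x y z p : point R) (e : edge R).

Lemma region_inside x : inside P x -> region P x.
Proof. by move=> h; right; rewrite h. Qed.

Lemma region_edge e : e \in edges P -> region P e.1.1 /\ region P e.2.
Proof.
move=> eP; split; left; apply/on_bdE; exists e => //.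
  by exists 0; [rewrite lexx ler01|apply: point_eq => /=; ring].
by exists 1; [rewrite lexx ler01|apply: point_eq => /=; ring].
Qed.

(** Were [x] on the right, the segment from the midpoint of the side to [x] would start with points
    off the boundary of winding number 0, against convexity. *)
Lemma left_of_edge e x : e \in edges P -> region P x ->
  0 <= cross (e.2 - e.1.1) (x - e.1.1).
Proof.
move=> eP xP; rewrite leNgt; apply/negP => cx.
have h01 : 0 < (1 / 2 : R) < 1 by lra.
pose p := lerp (1 / 2) e.1.1 e.2.
have pP : region P p.
  left; apply/on_bdE; exists e => //; exists (1 / 2) => //.
  by case/andP: h01 => /ltW -> /ltW ->.
have N := near_edge PP eP h01; rewrite -/p in N.
have l0 : p = lerp 0 p x by apply: point_eq => /=; ring.
rewrite l0 in N; have [r r0 H] := nearby_lerp N.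
pose t := Num.min r 1 / 2.
have [t0 [t1 tr]] : 0 < t /\ t < 1 /\ t < r.
  by rewrite /t; case: (leP r 1) => ?; split; [lra|split; lra|lra|split; lra].
have [|_ K] := H t; first by rewrite subr0 gtr0_norm.
have [|w0 nb] := K.
  rewrite (_ : cross _ _ = t * cross (e.2 - e.1.1) (x - e.1.1)) ?pmulr_rlt0 //.
  by rewrite /p /cross /=; field.
have t01 : 0 <= t <= 1 by rewrite (ltW t0) (ltW t1).
by case: (cP pP xP t01) => // /eqP.
Qed.

Lemma left_of_edge_exists e : e \in edges P ->
  exists x, region P x /\ 0 < cross (e.2 - e.1.1) (x - e.1.1).
Proof.
move=> eP; have h01 : 0 < (1 / 2 : R) < 1 by lra.
have n0 : e.2 - e.1.1 != 0 by apply: edge_neq eP; case: PP.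
have [x [[h _]]] := nearby_left n0 (near_edge PP eP h01).
by rewrite cross_lerp => c; exists x; split=> //; apply: region_inside; case: h.
Qed.

End Convex.

(** * Sheet numbers along an integral direction with odd coordinate sum *)

Section Periodicity.
Variables (R : realType) (A : zmodType) (u : A) (P : polygon R) (c : chart R A).
Variables (p q : int).
Hypotheses (tP : tame u P c) (pq : ~~ (2 %| p + q)%Z).
Let along (y : point R) (s : R) : point R := (y.1 + s * p%:~R, y.2 + s * q%:~R).

Let colour_next x : colour (along x 1) = ~~ colour x.
Proof.
rewrite /colour /= !mul1r !floorDrz ?intr_int // !intrKfloor.
by move: (Num.floor x.1) (Num.floor x.2) pq => k l; clear; lia.
Qed.

(* The translation by (p, q) exchanges the two colours, so that the sum of the
   sheets above a point and above its translate is locally constant. *)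
Lemma sheet_periodic (y : point R) (N : nat) :
  (forall s, 0 <= s <= (N.*2)%:R -> inside P (along y s)) ->
  (forall s, ~ integral (along y s + c.1)) ->
  c.2 (along y (N.*2)%:R) = c.2 y.
Proof.
move=> iy ny; have along0 : along y 0 = y by apply: point_eq => /=; ring.
case: N iy => [|N] iy; first by rewrite along0.
pose v : point R := (p%:~R, q%:~R).
have alongD x s t : along (along x s) t = along x (s + t).
  by apply: point_eq => /=; ring.
have along1 x : along x 1 = x + v by apply: point_eq => /=; ring.
pose L : R := (N.*2.+1)%:R.
have L0 : 0 <= L by rewrite ler0n.
have L2 : (N.+1.*2)%:R = L + 1 :> R by rewrite doubleS -natr1.
pose E x := inside P x /\ inside P (along x 1).
pose f x := c.2 x + c.2 (along x 1).
have inE s : 0 <= s <= L -> E (along y s).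
  move=> /andP[s0 s1]; split; rewrite ?alongD; apply: iy; rewrite L2;
    by apply/andP; split; lra.
have lerpE t : lerp t (along y 0) (along y L) = along y (t * L).
  by apply: point_eq => /=; ring.
have tL t : 0 <= t <= 1 -> 0 <= t * L <= L.
  by move=> /andP[t0 t1]; rewrite mulr_ge0 //= ler_piMl.
have [t t01|t G t01 nG|K HK] := @germ_const R A E f (along y 0) (along y L).
- rewrite lerpE; set z := along y _.
  (* The line avoids integral points, so one of the two numberings is locally constant at [z]; it
     also is at the translate, whose coordinates differ by integers. *)
  have [d rd] : exists d, regular d (z + c.1).
    apply: boolp.contrapT => H; apply: (ny (t * L)) => d.
    by apply: boolp.contrapT => /negP h; apply: H; exists d.
  have rd' : regular d (z + v + c.1).
    rewrite /regular (_ : coord d (z + v + c.1) =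
        coord d (z + c.1) + (if d then q else p)%:~R).
      by rewrite rpredDr ?intr_int.
    by case: (d); rewrite /=; ring.
  have [K1 g1] := tP rd; have [K2 /nearby_trans g2] := tP rd'.
  exists (K1 + K2 + u *+ ~~ d); apply: nearby2 g1 g2 => x h1 h2 [i1 i2].
  rewrite -h1 // -h2 -?along1 // /f /sheet along1.
  (* Opposite colours mean that for [d] false exactly one of the two corrections equals [u]; for [d]
     true both are zero. *)
  have cE : colour (x + v + c.1) = ~~ colour (x + c.1).
    by rewrite addrAC -along1 colour_next.
  have <- : u *+ (~~ d && colour (x + c.1)) + u *+ (~~ d && colour (x + v + c.1)) =
      u *+ ~~ d.
    by rewrite cE; case: (d); case: (colour _); rewrite /= ?mulr0n ?addr0 ?add0r.
  by rewrite [X in _ = X + _]addrACA -opprD subrK.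
- by exists (lerp t (along y 0) (along y L)); split;
    [apply: nearby_refl|rewrite lerpE; apply/inE/tL].
have {}HK s : 0 <= s <= L -> f (along y s) = K.
  move=> s01; have Lp : 0 < L by rewrite ltr0n.
  have t01 : 0 <= s / L <= 1.
    by case/andP: s01 => s0 s1; rewrite divr_ge0 //= ler_pdivrMr // mul1r.
  have := nearby_refl (HK _ t01); rewrite lerpE mulfVK ?gt_eqF // => h.
  by apply: h; apply: inE.
suff H k : (k <= N.+1)%N -> c.2 (along y (k.*2)%:R) = c.2 y by exact: H.
elim: k => [|k IHk] kN; first by rewrite along0.
rewrite -IHk; last exact: ltnW.
have k0 : 0 <= ((k.*2)%:R : R) <= L.
  by apply/andP; split; [exact: ler0n|rewrite ler_nat; lia].
have k1 : 0 <= ((k.*2)%:R + 1 : R) <= L.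
  by rewrite natr1; apply/andP; split; [exact: ler0n|rewrite ler_nat; lia].
(* The sums at 2k and at 2k + 1 are equal, and the sheet above 2k + 1 occurs in both; cancelling it
   leaves the sheets above 2k and 2k + 2. *)
have := HK _ k0; rewrite -(HK _ k1) /f !alongD [X in _ = X]addrC => /addIr ->.
by congr c.2; congr along; rewrite doubleS -!natr1.
Qed.

End Periodicity.

Lemma parallel (R : realType) (v w : point R) : v != 0 -> cross w v = 0 ->
  exists r : R, w.1 = r * v.1 /\ w.2 = r * v.2.
Proof.
rewrite /cross => v0 c.
have [e1|n1] := eqVneq v.1 0; last first.
  exists (w.1 / v.1); split; first by rewrite mulfVK.
  by rewrite mulrAC (_ : w.1 * v.2 = w.2 * v.1) ?mulfK //; lra.
have n2 : v.2 != 0.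
  by apply: contra v0 => /eqP e2; apply/eqP/point_eq.
exists (w.2 / v.2); split; last by rewrite mulfVK.
by rewrite mulrAC (_ : w.2 * v.1 = w.1 * v.2) ?mulfK //; lra.
Qed.

Lemma primitive_vector (k l : int) : (k != 0) || (l != 0) -> exists g p q a b : int,
  [/\ 0 < g, k = p * g, l = q * g & a * p + b * q = 1].
Proof.
move=> kl; have g0 : 0 < gcdz k l by rewrite lt_def gcdz_eq0 negb_and kl.
have /dvdzP[p kE] := dvdz_gcdl k l; have /dvdzP[q lE] := dvdz_gcdr k l.
have [a [b ab]] := Bezoutz k l; exists (gcdz k l), p, q, a, b; split=> //.
move: kE lE ab g0; move: (gcdz k l) => g kE lE ab g0.
apply: (mulIf (lt0r_neq0 g0)); rewrite mul1r -[RHS]ab kE lE; ring.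
Qed.

Lemma primitive_parallel (p q a b w1 w2 : int) : a * p + b * q = 1 ->
  p * w2 = q * w1 -> w1 = (a * w1 + b * w2) * p /\ w2 = (a * w1 + b * w2) * q.
Proof.
move=> ab w; split.
  transitivity (w1 * (a * p + b * q)); first by rewrite ab mulr1.
  transitivity (a * w1 * p + b * (q * w1)); first by ring.
  by rewrite -w; ring.
transitivity (w2 * (a * p + b * q)); first by rewrite ab mulr1.
transitivity (a * (p * w2) + b * w2 * q); first by ring.
by rewrite w; ring.
Qed.

Lemma addr4_eq0 (R : realDomainType) (a b c d : R) :
  0 <= a -> 0 <= b -> 0 <= c -> 0 <= d -> a + b + c + d = 0 ->
  [/\ a = 0, b = 0, c = 0 & d = 0].
Proof. by move=> ? ? ? ? ?; split; lra. Qed.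

Lemma half_integral_eq0 (R : realFieldType) (n : int) :
  0 <= (1%:~R / 2 + n%:~R : R) <= 1 -> n = 0.
Proof.
have e1 : 1%:~R = 1 :> R by [].
rewrite e1 => /andP[h1 h2]; have [n0|n0|//] := ltgtP n 0.
  have : n%:~R <= (-1)%:~R :> R by rewrite ler_int; lia.
  by rewrite mulrNz e1 => ?; exfalso; lra.
have : 1%:~R <= n%:~R :> R by rewrite ler_int; lia.
by rewrite e1 => ?; exfalso; lra.
Qed.

Lemma three_halves_even (R : realFieldType) (n : int) :
  ~ (0 <= (3%:~R / 2 + (n * 2)%:~R : R) <= 1).
Proof.
have e1 : 1%:~R = 1 :> R by [].
have e2 : 2%:~R = 2 :> R by [].
have e3 : 3%:~R = 3 :> R by [].
rewrite intrM e2 e3 => /andP[h1 h2]; have [n0|n0] := leP 0 n.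
  have : 0 <= n%:~R :> R by rewrite ler0z.
  by move=> ?; lra.
have : n%:~R <= (-1)%:~R :> R by rewrite ler_int; lia.
by rewrite mulrNz e1 => ?; lra.
Qed.

(** * A convex presentation lies in a strip of height 1, and the contradiction *)

Section ConvexPresentation.
Variables (R : realType) (A : zmodType) (u : A) (P : polygon R) (c : chart R A).
Hypotheses (u1 : u != 0) (u2 : u *+ 2 != 0).
Hypotheses (PP : is_polygon P) (gP : glued [:: P]) (cP : convex_polygon P).
Hypothesis tP : tame u P c.
Hypothesis mP : forall e e', e \in edges P -> e' \in edges P ->
  e'.1.2 = inv e.1.2 -> matched u P c e P c e'.
Hypothesis coverP : forall z K, exists x,
  [/\ inside P x, c.2 x = K & lattice (x + c.1 - z)].
Implicit Types (x y z : point R) (e : edge R).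

Let partner e : e \in edges P -> exists e',
  [/\ e' \in edges P, e'.1.2 = inv e.1.2, e'.2 - e'.1.1 = - (e.2 - e.1.1) &
      lattice (e.1.1 - e'.2)].
Proof.
move=> eP; have [j [e' [+ + l v]]] := glued_partner gP (isT : 0 < 1)%N eP.
case: j => [|//] _ e'P.
exists e'; split=> //; have [|/= L _] := mP eP e'P l (t := 1 / 2); first by lra.
move: L; congr lattice.
have v1 : e'.2.1 = e'.1.1.1 - (e.2.1 - e.1.1.1) by have /= := congr1 fst v; lra.
have v2 : e'.2.2 = e'.1.1.2 - (e.2.2 - e.1.1.2) by have /= := congr1 snd v; lra.
by apply: point_eq; rewrite /= ?v1 ?v2; field.
Qed.

(** Monodromy excludes interior points and, through the gluing with the partner side, points of open
    sides. The end of a side is the start of the next one. *)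
Let integral_vertex x : region P x -> integral (x + c.1) ->
  exists2 e, e \in edges P & x = e.1.1.
Proof.
move=> xP ix; have : on_bd P x.
  case: xP => // wx; apply: (integral_on_bd u2 tP _ ix).
  by have [] := winding01 x PP => // w0; move: wx; rewrite w0 eqxx.
move=> /on_bdE[e eP [s /andP[s0 s1] xE]].
move: s0; rewrite le_eqVlt => /orP[/eqP s0|s0].
  by exists e => //; rewrite xE -s0; apply: point_eq => /=; ring.
move: s1; rewrite le_eqVlt => /orP[/eqP s1|s1].
  have {}xE : x = e.2 by rewrite xE s1; apply: point_eq => /=; ring.
  have [i iP eE] := edgesP _ _ eP.
  have jP : (i.+1 %% size P < size P)%N by rewrite ltn_mod; apply: leq_ltn_trans iP.
  exists (vtx P (i.+1 %% size P), lab P (i.+1 %% size P), vtx P (i.+1 %% size P).+1).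
    by apply/edgesP; exists (i.+1 %% size P)%N.
  by rewrite xE eE /= /vtx modn_mod.
have [e' [e'P l v _]] := partner eP.
have s01 : 0 < s < 1 by rewrite s0.
have := integral_not_in_side u2 PP tP eP e'P v (mP eP e'P l) s01.
by rewrite -xE.
Qed.

Let edge_neq0 e : e \in edges P -> e.2 - e.1.1 != 0.
Proof. by apply: edge_neq; case: PP. Qed.

Let end_inj e e' : e \in edges P -> e' \in edges P -> e.2 = e'.2 -> e = e'.
Proof.
move=> /edgesP[i iP ->] /edgesP[j jP ->] /= E.
have [sz H] : simple_bd P by case: PP.
have kP k : (k.+1 %% size P < size P)%N by rewrite ltn_mod; lia.
have [|||ij _] := H _ _ 0 0 (kP i) (kP j); rewrite ?lexx ?ltr01 //.
  have v k : bd P (k.+1 %% size P) 0 = vtx P k.+1.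
    by rewrite /bd; apply: point_eq; rewrite /= ?mul0r ?addr0 /vtx modn_mod.
  by rewrite !v.
suff -> : i = j by [].
have [hi|hi] := eqVneq i.+1 (size P); have [hj|hj] := eqVneq j.+1 (size P).
- by lia.
- by move: ij; rewrite hi modnn modn_small; lia.
- by move: ij; rewrite hj modnn modn_small; lia.
- by move: ij; rewrite !modn_small; lia.
Qed.

Let ivec (k l : int) : point R := (k%:~R, l%:~R).

(** Each of the two sides has the polygon on its left. Applied to the start of [e] and the end of
    [f], this makes [f] parallel to [e]; a point strictly on the left of [e] excludes opposite
    directions. *)
Let long_side_pos x (k l : int) e (r : R) : integral (x + c.1) -> region P x ->
  region P (x + ivec k l + ivec k l) -> ivec k l != 0 -> e \in edges P ->
  e.1.1 = x + ivec k l -> 0 < r -> e.2.1 - e.1.1.1 = r * k%:~R ->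
  e.2.2 - e.1.1.2 = r * l%:~R ->
  exists2 f, f \in edges P & f.1.1 = x /\ exists s : R, [/\ 0 < s,
    f.2.1 - f.1.1.1 = s * k%:~R & f.2.2 - f.1.1.2 = s * l%:~R].
Proof.
move=> ix xP yP D0 eP eE r0 V1 V2; have [f fP xE] := integral_vertex xP ix.
exists f => //; split=> //.
have E1 : e.1.1.1 = f.1.1.1 + k%:~R by rewrite eE xE.
have E2 : e.1.1.2 = f.1.1.2 + l%:~R by rewrite eE xE.
have c1 := left_of_edge PP cP fP (region_edge eP).1.
have c2 := left_of_edge PP cP eP (region_edge fP).2.
have W0 : cross (f.2 - f.1.1) (ivec k l) = 0.
  apply/eqP; rewrite eq_le; apply/andP; split; last first.
    by move: c1; rewrite crossE E1 E2 /cross /=; lra.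
  rewrite -(pmulr_rle0 _ r0); move: c2; rewrite crossE V1 V2 E1 E2 /cross /=; lra.
have [s [/= s1 s2]] := parallel D0 W0; exists s; split=> //.
rewrite ltNge; apply/negP => s0.
have [z [zP cz]] := left_of_edge_exists PP eP.
have c3 := left_of_edge PP cP fP zP.
have h : 0 < k%:~R * (z.2 - f.1.1.2) - l%:~R * (z.1 - f.1.1.1).
  rewrite -(pmulr_rgt0 _ r0); move: cz; rewrite crossE V1 V2 E1 E2; lra.
have : 0 <= s * (k%:~R * (z.2 - f.1.1.2) - l%:~R * (z.1 - f.1.1.1)).
  by move: c3; rewrite crossE s1 s2; lra.
rewrite pmulr_lge0 // => s0'; have {s0 s0'}s0 : s = 0 by apply/eqP; rewrite eq_le s0.
have := edge_neq0 fP; case/eqP; apply: point_eq.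
  by rewrite /= s1 s0 mul0r.
by rewrite /= s2 s0 mul0r.
Qed.

Let on_line x (k l : int) e f (r s : R) : Prop :=
  [/\ integral (x + c.1), region P x, region P (x + ivec k l + ivec k l) &
      ivec k l != 0] /\
  [/\ e \in edges P, f \in edges P, e.1.1 = x + ivec k l & f.1.1 = x] /\
  [/\ 0 < r, e.2.1 - e.1.1.1 = r * k%:~R & e.2.2 - e.1.1.2 = r * l%:~R] /\
  [/\ 0 < s, f.2.1 - f.1.1.1 = s * k%:~R & f.2.2 - f.1.1.2 = s * l%:~R].

(* Among three points of the same lattice class two differ by an even integral
   vector. Their midpoint is integral, hence a vertex in the middle of a straight
   part of the boundary. *)
Let long_side : exists x k l e f r s, on_line x k l e f r s.
Proof.
have main x y (k1 m1 k2 m2 : int) : inside P x -> inside P y -> x != y ->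
    x + c.1 = ivec (k1 + m1) (k1 - m1) -> y + c.1 = ivec (k2 + m2) (k2 - m2) ->
    (2 %| k1 + m1 - (k2 + m2))%Z -> exists x k l e f r s, on_line x k l e f r s.
  move=> ix iy nxy xE yE /dvdzP[w wE].
  have xP := region_inside ix; have yP := region_inside iy.
  (* Twice (k, l) is y - x: the first coordinates differ by -2w, and the second difference is even
     too, as both coordinates of a lattice vector have the same parity. *)
  pose k := - w; pose l := - w + m1 - m2.
  have yx : y = x + ivec k l + ivec k l.
    have e1 := congr1 fst xE; have e2 := congr1 fst yE.
    have e3 := congr1 snd xE; have e4 := congr1 snd yE; rewrite /= in e1 e2 e3 e4.
    have z1 : (k2 + m2)%:~R = (k1 + m1)%:~R + k%:~R + k%:~R :> R.
      by rewrite -!intrD; congr intr; rewrite /k; lia.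
    have z2 : (k2 - m2)%:~R = (k1 - m1)%:~R + l%:~R + l%:~R :> R.
      by rewrite -!intrD; congr intr; rewrite /l; lia.
    by apply: point_eq => /=; lra.
  have D0 : ivec k l != 0.
    by apply: contra nxy => /eqP D0; rewrite yx D0 !addr0.
  have h01 : 0 <= (1 / 2 : R) <= 1 by apply/andP; split; lra.
  have mE : lerp (1 / 2) x y = x + ivec k l by rewrite yx; apply: point_eq => /=; field.
  have mR := cP xP yP h01; rewrite mE in mR.
  have iX : integral (x + c.1) by rewrite xE; case; apply: intr_int.
  have iY : integral (y + c.1) by rewrite yE; case; apply: intr_int.
  have iM : integral (x + ivec k l + c.1).
    by rewrite addrAC xE; case; rewrite /= -intrD; apply: intr_int.
  have [e eP eE] := integral_vertex mR iM.
  have cx := left_of_edge PP cP eP xP; have cy := left_of_edge PP cP eP yP.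
  (* The points x and y are symmetric about the start of [e] and neither is on its right, so both
     are on its line. *)
  have V0 : cross (e.2 - e.1.1) (ivec k l) = 0.
    by move: cx cy; rewrite yx -eE /cross /=; lra.
  have [r [/= r1 r2]] := parallel D0 V0.
  (* For r < 0 the side [e] runs towards x, and x and y exchange their roles. *)
  have [r0|r0|r0] := ltgtP r 0; last 1 first.
  - by have := edge_neq0 eP; case/eqP; apply: point_eq; rewrite /= ?r1 ?r2 r0 mul0r.
  - have D0' : ivec (- k) (- l) != 0.
      by rewrite -oppr_eq0 (_ : - _ = ivec k l) //; apply: point_eq; rewrite /= mulrNz opprK.
    have e1 : e.1.1 = y + ivec (- k) (- l).
      by rewrite -eE yx; apply: point_eq; rewrite /= mulrNz; ring.
    have e2 : region P (y + ivec (- k) (- l) + ivec (- k) (- l)).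
      rewrite (_ : _ + _ + _ = x) // yx; apply: point_eq; rewrite /= mulrNz; ring.
    have r0' : 0 < - r by rewrite oppr_gt0.
    have w1 : e.2.1 - e.1.1.1 = - r * (- k)%:~R by rewrite mulrNz mulrNN.
    have w2 : e.2.2 - e.1.1.2 = - r * (- l)%:~R by rewrite mulrNz mulrNN.
    have [f fP [fx [s [s0 s1 s2]]]] := long_side_pos iY yP e2 D0' eP e1 r0' w1 w2.
    by exists y, (- k), (- l), e, f, (- r), s.
  - have yP' := yP; rewrite yx in yP'.
    have [f fP [fx [s [s0 s1 s2]]]] := long_side_pos iX xP yP' D0 eP (esym eE) r0 r1 r2.
    by exists x, k, l, e, f, r, s.
(* The sheets 0, u and 2u are distinct, which gives three different points above the origin of the
   torus; two of their first coordinates have the same parity. *)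
have [x0 [i0 F0 [k0 [m0 E0]]]] := coverP 0 0.
have [x1 [i1 F1 [k1 [m1 E1]]]] := coverP 0 u.
have [x2 [i2 F2 [k2 [m2 E2]]]] := coverP 0 (u *+ 2).
rewrite subr0 in E0; rewrite subr0 in E1; rewrite subr0 in E2.
have n01 : x0 != x1 by apply: contra u1 => /eqP e; rewrite -F1 -e F0.
have n02 : x0 != x2 by apply: contra u2 => /eqP e; rewrite -F2 -e F0.
have n12 : x1 != x2.
  apply: contra u1 => /eqP e; have := F2; rewrite -e F1 mulr2n => /eqP.
  by rewrite -subr_eq0 opprD addrA subrr sub0r oppr_eq0.
have [h|h] := boolP (2 %| k0 + m0 - (k1 + m1))%Z; first exact: main i0 i1 n01 E0 E1 h.
have [h'|h'] := boolP (2 %| k0 + m0 - (k2 + m2))%Z; first exact: main i0 i2 n02 E0 E2 h'.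
apply: main i1 i2 n12 E1 E2 _; move: h h'; clear; lia.
Qed.

(** Heights are measured by the determinant with (p, q), primitive by the Bezout relation, so
    integral lines are at consecutive integral heights above x. The region has two periods (p, q) on
    the lower line and one on the upper line: this trapezium is what bounds h. *)
Let strip : exists x (a1 a2 p q a b : int),
  let h := p * a2 - q * a1 in
  [/\ a * p + b * q = 1, 1 <= h, integral (x + c.1) &
      forall z, region P z -> 0 <= p%:~R * (z.2 - x.2) - q%:~R * (z.1 - x.1) <= h%:~R] /\
  [/\ region P x, region P (x + ivec p q + ivec p q), region P (x + ivec a1 a2) &
      region P (x + ivec a1 a2 + ivec p q)].
Proof.
have [x [k [l [e [f [r [s [[ix xP yP D0] [[eP fP eE fE] [[r0 V1 V2] [s0 W1 W2]]]]]]]]]]] :=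
  long_side.
have [e' [e'P le ve [ke [me Le]]]] := partner eP.
have [f' [f'P lf vf [kf [mf Lf]]]] := partner fP.
(* The sides [e] and [f] start at different points, so they differ and so do their partners; a side
   is determined by its end point. *)
have nef : e'.2 != f'.2.
  apply/eqP => /(end_inj e'P f'P) E.
  have ll : e.1.2 = f.1.2 by rewrite -[e.1.2]invK -le E lf invK.
  have [_ ef] := label_inj gP (isT : 0 < 1)%N (isT : 0 < 1)%N eP fP ll.
  move/eqP: D0; apply; apply: (addrI x); rewrite -eE ef fE addr0 //.
have [g [p [q [a [b [g0 kE lE ab]]]]]] : exists g p q a b : int,
    [/\ 0 < g, k = p * g, l = q * g & a * p + b * q = 1].
  apply: primitive_vector; rewrite -negb_and; apply: contra D0 => /andP[/eqP -> /eqP ->].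
  by apply/eqP/point_eq.
have G0 : 0 < g%:~R :> R by rewrite ltr0z.
have kR : k%:~R = p%:~R * g%:~R :> R by rewrite kE intrM.
have lR : l%:~R = q%:~R * g%:~R :> R by rewrite lE intrM.
pose hgt z := p%:~R * (z.2 - x.2) - q%:~R * (z.1 - x.1).
have low z : region P z -> 0 <= hgt z.
  have E : cross (f.2 - f.1.1) (z - f.1.1) = s * g%:~R * hgt z.
    by rewrite crossE W1 W2 fE kR lR /hgt; ring.
  by move=> /(left_of_edge PP cP fP); rewrite E pmulr_rge0 // mulr_gt0.
have high e0 e1 (r0' : R) z : e1 \in edges P -> 0 < r0' ->
    e0.2.1 - e0.1.1.1 = r0' * k%:~R -> e0.2.2 - e0.1.1.2 = r0' * l%:~R ->
    e1.2 - e1.1.1 = - (e0.2 - e0.1.1) -> region P z -> hgt z <= hgt e1.2.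
  move=> e1P r1 h1 h2 v zP.
  have v1 : e1.1.1.1 = e1.2.1 + r0' * k%:~R by have /= := congr1 fst v; lra.
  have v2 : e1.1.1.2 = e1.2.2 + r0' * l%:~R by have /= := congr1 snd v; lra.
  have E : cross (e1.2 - e1.1.1) (z - e1.1.1) = r0' * g%:~R * (hgt e1.2 - hgt z).
    by rewrite crossE v1 v2 kR lR /hgt; ring.
  by have := left_of_edge PP cP e1P zP; rewrite E pmulr_rge0 ?mulr_gt0 // subr_ge0.
have e'R := (region_edge e'P).2; have f'R := (region_edge f'P).2.
pose b1 := k - ke - me; pose b2 := l - ke + me; pose a1 := - kf - mf; pose a2 := - kf + mf.
have e'E : e'.2 = x + ivec b1 b2.
  have h1 := congr1 fst Le; have h2 := congr1 snd Le; rewrite eE /= in h1 h2.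
  by apply: point_eq; rewrite /= /b1 /b2 ?intrD ?mulrNz in h1 h2 *; lra.
have f'E : f'.2 = x + ivec a1 a2.
  have h1 := congr1 fst Lf; have h2 := congr1 snd Lf; rewrite fE /= in h1 h2.
  by apply: point_eq; rewrite /= /a1 /a2 ?intrD ?mulrNz in h1 h2 *; lra.
clearbody a1 a2 b1 b2.
have hgtE (w1 w2 : int) : hgt (x + ivec w1 w2) = (p * w2 - q * w1)%:~R.
  by rewrite /hgt /= intrD mulrNz !intrM; ring.
(* Both partners run opposite to (k, l) with the polygon on their left, so both end points attain
   the maximal height. *)
have same : p * b2 - q * b1 = p * a2 - q * a1.
  apply/eqP; rewrite -(eqr_int R) -!hgtE -e'E -f'E eq_le.
  by rewrite (high _ _ _ _ e'P r0 V1 V2 ve f'R) (high _ _ _ _ f'P s0 W1 W2 vf e'R).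
have h1 : 1 <= p * a2 - q * a1.
  have [z [zP cz]] := left_of_edge_exists PP eP.
  rewrite -gtz0_ge1 -(ltr0z R) -hgtE -f'E.
  apply: lt_le_trans (high _ _ _ _ f'P s0 W1 W2 vf zP).
  have E : cross (e.2 - e.1.1) (z - e.1.1) = r * g%:~R * hgt z.
    by rewrite crossE V1 V2 eE /= kR lR /hgt; ring.
  by move: cz; rewrite E pmulr_rgt0 // mulr_gt0.
have bounds z : region P z -> 0 <= hgt z <= (p * a2 - q * a1)%:~R.
  by move=> zP; rewrite low // -hgtE -f'E (high _ _ _ _ f'P s0 W1 W2 vf).
(* As (k, l) is g times (p, q) with g at least 1, this point divides the segment from x to x + 2 (k,
   l) in proportion 1/g. *)
have xvv : region P (x + ivec p q + ivec p q).
  have g1 : 1 <= g%:~R :> R by rewrite -[1]/(1%:~R) ler_int -gtz0_ge1.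
  have t01 : 0 <= ((g%:~R)^-1 : R) <= 1 by rewrite invr_ge0 (ltW G0) invf_le1.
  have := cP xP yP t01; congr region; have gn := lt0r_neq0 G0.
  by apply: point_eq; rewrite /= ?kR ?lR; field.
pose t := a * (b1 - a1) + b * (b2 - a2).
have [tp tq] : b1 - a1 = t * p /\ b2 - a2 = t * q.
  apply: primitive_parallel => //; apply: subr0_eq.
  transitivity ((p * b2 - q * b1) - (p * a2 - q * a1)); last by rewrite same subrr.
  by ring.
have step (c1 c2 d1 d2 w : int) : 0 < w -> d1 - c1 = w * p -> d2 - c2 = w * q ->
    region P (x + ivec c1 c2) -> region P (x + ivec d1 d2) ->
    region P (x + ivec c1 c2 + ivec p q).
  move=> w0 E1 E2 R1 R2.
  have W0 : 0 < w%:~R :> R by rewrite ltr0z.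
  have w1 : 1 <= w%:~R :> R by rewrite -[1]/(1%:~R) ler_int -gtz0_ge1.
  have t01 : 0 <= ((w%:~R)^-1 : R) <= 1 by rewrite invr_ge0 (ltW W0) invf_le1.
  have := cP R1 R2 t01; congr region; have wn := lt0r_neq0 W0.
  have F1 : d1%:~R = c1%:~R + w%:~R * p%:~R :> R.
    by rewrite -intrM -E1 -intrD; congr intr; ring.
  have F2 : d2%:~R = c2%:~R + w%:~R * q%:~R :> R.
    by rewrite -intrM -E2 -intrD; congr intr; ring.
  by apply: point_eq; rewrite /= ?F1 ?F2; field.
have t0 : t != 0.
  apply: contra nef => /eqP t0; rewrite e'E f'E; apply/eqP; congr (_ + _).
  by move: tp tq; rewrite t0 !mul0r => /subr0_eq -> /subr0_eq ->.
rewrite e'E in e'R; rewrite f'E in f'R.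
(* The end point that comes first in the direction (p, q) is chosen; the other one is a positive
   number of periods further. *)
have [tn|tpos|te] := ltgtP t 0; last by rewrite te eqxx in t0.
  exists x, b1, b2, p, q, a, b; rewrite /= same; split=> //; split=> //.
  have t'0 : 0 < - t by rewrite oppr_gt0.
  have n1 : a1 - b1 = - t * p by rewrite mulNr -tp opprB.
  have n2 : a2 - b2 = - t * q by rewrite mulNr -tq opprB.
  exact: (step _ _ _ _ _ t'0 n1 n2 e'R f'R).
exists x, a1, a2, p, q, a, b; split=> //; split=> //.
exact: (step _ _ _ _ _ tpos tp tq f'R e'R).
Qed.

(* At height 1 the convex hull of the four points given by [strip] has width larger
   than 1, so it would contain an integral point in its interior if the strip had
   height at least 2. *)
Let height_one x (a1 a2 p q a b : int) : let h := p * a2 - q * a1 in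
  a * p + b * q = 1 -> 1 <= h -> integral (x + c.1) -> region P x ->
  region P (x + ivec p q + ivec p q) -> region P (x + ivec a1 a2) ->
  region P (x + ivec a1 a2 + ivec p q) -> h = 1.
Proof.
move=> h ab h1 ix R1 R2 R3 R4; apply/eqP; rewrite eq_le h1 andbT leNgt.
apply/negP => h2.
have abR : a%:~R * p%:~R + b%:~R * q%:~R = 1 :> R by rewrite -!intrM -intrD ab.
pose H : R := h%:~R.
have hE : H = p%:~R * a2%:~R - q%:~R * a1%:~R.
  by rewrite /H /h intrD mulrNz !intrM.
have H2 : 2 <= H by rewrite /H -[2]/(2%:~R) ler_int; lia.
have H0 : 0 < H by lra.
pose t := H^-1; have tH : t * H = 1 by rewrite /t mulVf // gt_eqF.
have t0 : 0 < t by rewrite /t invr_gt0.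
have t1 : t <= 1 / 2 by rewrite -(ler_pM2r H0) tH; lra.
(* In the basis (p, q), (-b, a), of determinant 1, the vector (a1, a2) has coordinates s0 and H. *)
pose s0 := a * a1 + b * a2.
have s0R : s0%:~R = a%:~R * a1%:~R + b%:~R * a2%:~R :> R by rewrite intrD !intrM.
have a1E : a1%:~R = s0%:~R * p%:~R - H * b%:~R :> R.
  transitivity ((a%:~R * p%:~R + b%:~R * q%:~R) * a1%:~R : R); first by rewrite abR mul1r.
  by rewrite s0R hE; ring.
have a2E : a2%:~R = s0%:~R * q%:~R + H * a%:~R :> R.
  transitivity ((a%:~R * p%:~R + b%:~R * q%:~R) * a2%:~R : R); first by rewrite abR mul1r.
  by rewrite s0R hE; ring.
(* At height 1, the proportion t = 1/H of the strip, the trapezium extends from s0 t to s0 t + 2 - t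
   in units of (p, q). The next integer j after the left end is at distance d <= 1 < 2 - t, hence
   strictly inside. *)
pose j := Num.floor (s0%:~R * t) + 1.
have j1 : s0%:~R * t < j%:~R by exact: floorD1_gt.
have j2 : j%:~R <= s0%:~R * t + 1 by rewrite intrD lerD2r floor_le.
pose d := j%:~R - s0%:~R * t.
have d0 : 0 < d by rewrite subr_gt0.
have d1 : d <= 1 by rewrite /d; lra.
pose s := d / (2 - t); have t2 : 0 < 2 - t by lra.
have sE : s * (2 - t) = d by rewrite /s mulfVK // gt_eqF.
have s_0 : 0 < s by rewrite /s divr_gt0.
have s_1 : s < 1 by rewrite /s ltr_pdivrMr // mul1r; lra.
clearbody s t j; have jE : j%:~R = s * (2 - t) + s0%:~R * t by rewrite sE /d; ring.
pose y1 := lerp s x (x + ivec p q + ivec p q).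
pose y2 := lerp s (x + ivec a1 a2) (x + ivec a1 a2 + ivec p q).
pose N := lerp t y1 y2.
have s01 : 0 <= s <= 1 by rewrite !ltW.
have t01 : 0 <= t <= 1 by apply/andP; split; lra.
have NP : region P N by apply: cP => //; apply: cP.
have NE : N = x + ivec (j * p - b) (j * q + a).
  apply: point_eq; rewrite /= intrD ?mulrNz intrM jE.
    rewrite a1E; transitivity (x.1 + (s * (2 - t) + s0%:~R * t) * p%:~R - (t * H) * b%:~R).
      by ring.
    by rewrite tH; ring.
  rewrite a2E; transitivity (x.2 + (s * (2 - t) + s0%:~R * t) * q%:~R + (t * H) * a%:~R).
    by ring.
  by rewrite tH; ring.
have iN : integral (N + c.1).
  rewrite NE => i; rewrite (_ : coord i _ = coord i (x + c.1) +
      (if i then j * q + a else j * p - b)%:~R).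
    by rewrite rpredD ?intr_int.
  by case: i; rewrite /=; ring.
have [e eP eN] := integral_vertex NP iN.
have c1 := left_of_edge PP cP eP R1; have c2 := left_of_edge PP cP eP R2.
have c3 := left_of_edge PP cP eP R3; have c4 := left_of_edge PP cP eP R4.
set V := e.2 - e.1.1 in c1 c2 c3 c4; rewrite -eN in c1 c2 c3 c4.
(* N is a combination with positive weights of four points that are not on the right of the side
   starting at N, so they lie on its line. This contradicts the independence of (p, q) and (a1, a2),
   whose determinant is H. *)
have sum0 : (1 - t) * (1 - s) * cross V (x - N) +
    (1 - t) * s * cross V (x + ivec p q + ivec p q - N) +
    t * (1 - s) * cross V (x + ivec a1 a2 - N) +
    t * s * cross V (x + ivec a1 a2 + ivec p q - N) = 0.
  by rewrite /N /y1 /y2 /cross /=; ring.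
have w1 : 0 < (1 - t) * (1 - s) by rewrite mulr_gt0 //; lra.
have w2 : 0 < (1 - t) * s by rewrite mulr_gt0 //; lra.
have w3 : 0 < t * (1 - s) by rewrite mulr_gt0 //; lra.
have w4 : 0 < t * s by rewrite mulr_gt0.
have p1 := mulr_ge0 (ltW w1) c1; have p2 := mulr_ge0 (ltW w2) c2.
have p3 := mulr_ge0 (ltW w3) c3; have p4 := mulr_ge0 (ltW w4) c4.
have [q1 q2 q3 _] := addr4_eq0 p1 p2 p3 p4 sum0.
have zero r r' : 0 < r -> r * r' = 0 -> r' = 0 :> R.
  by move=> r0 /eqP; rewrite mulf_eq0 gt_eqF //= => /eqP.
have z1 := zero _ _ w1 q1; have z2 := zero _ _ w2 q2; have z3 := zero _ _ w3 q3.
have v0 : ivec p q != 0.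
  apply/eqP => /[dup] /(congr1 fst) /= h3 /(congr1 snd) /= h4.
  by move: abR; rewrite h3 h4 !mulr0 addr0 => /eqP; rewrite eq_sym oner_eq0.
have Vv : cross V (ivec p q) = 0.
  by move: z1 z2; rewrite /cross /=; lra.
have Va : cross V (ivec a1 a2) = 0.
  by move: z1 z3; rewrite /cross /=; lra.
have [r [/= r1 r2]] := parallel v0 Vv.
have r0 : r * H = 0.
  by move: Va; rewrite hE /V /cross /= r1 r2; lra.
have {}r0 : r = 0.
  by move/eqP: r0; rewrite mulf_eq0 (gt_eqF H0) orbF => /eqP.
by have := edge_neq0 eP; case/eqP; apply: point_eq; rewrite /= ?r1 ?r2 r0 mul0r.
Qed.

Lemma convex_structure_absurd : False.
Proof.
have [x [a1 [a2 [p [q [a [b [[ab h1 ix bounds] [R1 R2 R3 R4]]]]]]]]] := strip.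
have hE := height_one ab h1 ix R1 R2 R3 R4.
rewrite hE in bounds; clear h1.
have abR : a%:~R * p%:~R + b%:~R * q%:~R = 1 :> R by rewrite -!intrM -intrD ab.
have hR : p%:~R * a2%:~R - q%:~R * a1%:~R = 1 :> R.
  by rewrite -!intrM -intrB hE.
pose hgt z := p%:~R * (z.2 - x.2) - q%:~R * (z.1 - x.1).
have {}bounds z : region P z -> 0 <= hgt z <= 1 by exact: bounds.
(* The vector (- b, a) has height 1. *)
have level (m : int) K : exists y (k l : int),
    [/\ inside P y, c.2 y = K, y.1 = x.1 - m%:~R / 2 * b%:~R + (k + l)%:~R &
     y.2 = x.2 + m%:~R / 2 * a%:~R + (k - l)%:~R].
  have [y [iy yK [k [l E]]]] :=
    coverP (x + c.1 + (- (m%:~R / 2 * b%:~R), m%:~R / 2 * a%:~R)) K.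
  have e1 := congr1 fst E; have e2 := congr1 snd E; rewrite /= in e1 e2.
  by exists y, k, l; split=> //; lra.
have hgt_level (m k l : int) y : y.1 = x.1 - m%:~R / 2 * b%:~R + (k + l)%:~R ->
    y.2 = x.2 + m%:~R / 2 * a%:~R + (k - l)%:~R ->
    hgt y = m%:~R / 2 + (p * (k - l) - q * (k + l))%:~R.
  have -> : (p * (k - l) - q * (k + l))%:~R =
      p%:~R * (k - l)%:~R - q%:~R * (k + l)%:~R :> R by rewrite -!intrM -intrB.
  move=> y1 y2; rewrite /hgt y1 y2.
  transitivity (m%:~R / 2 * (a%:~R * p%:~R + b%:~R * q%:~R) +
    (p%:~R * (k - l)%:~R - q%:~R * (k + l)%:~R) : R); first by ring.
  by rewrite abR mulr1.
(* If p + q is even, every lattice vector has even height, so points over the level 3/2 have height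
   3/2 plus an even integer, never in [0, 1]. *)
have [pq|pq] := boolP (2 %| p + q)%Z.
  have [y [k [l [iy _ y1 y2]]]] := level 3 0.
  have := bounds y (region_inside iy); rewrite (hgt_level _ _ _ _ y1 y2).
  have /dvdzP[w wE] := pq.
  have -> : p * (k - l) - q * (k + l) = (k * (w - q) - l * w) * 2.
    have pE : p = w * 2 - q by rewrite -wE; ring.
    by rewrite pE; ring.
  by move/three_halves_even.
have half y (k l : int) : inside P y -> y.1 = x.1 - 1%:~R / 2 * b%:~R + (k + l)%:~R ->
    y.2 = x.2 + 1%:~R / 2 * a%:~R + (k - l)%:~R -> p * (k - l) - q * (k + l) = 0.
  move=> iy y1 y2; have := bounds y (region_inside iy); rewrite (hgt_level _ _ _ _ y1 y2).
  exact: half_integral_eq0.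
have [y0 [k0 [l0 [i0 F0 y01 y02]]]] := level 1 0.
have [y1 [k1 [l1 [i1 F1 y11 y12]]]] := level 1 u.
have E0 := half _ _ _ i0 y01 y02; have E1 := half _ _ _ i1 y11 y12.
pose k := k1 - k0; pose l := l1 - l0; pose t := a * (k + l) + b * (k - l).
have [tp tq] : k + l = t * p /\ k - l = t * q.
  apply: primitive_parallel => //; apply: subr0_eq.
  transitivity ((p * (k1 - l1) - q * (k1 + l1)) - (p * (k0 - l0) - q * (k0 + l0))).
    by rewrite /k /l; ring.
  by rewrite E0 E1.
(* The points [y0] and [y1] lie over the same point of the torus, so t (p, q) is a lattice vector
   and t (p + q) is even, while p + q is odd. *)
have [w tE] : exists w : int, t = w * 2.
  have [r rE] : exists r : int, p + q = r * 2 + 1.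
    by exists ((p + q) %/ 2)%Z; move: pq; clear; lia.
  exists (k - t * r).
  transitivity (t * (p + q) - t * r * 2); first by rewrite rE; ring.
  by rewrite mulrDr -tp -tq; ring.
have n01 : y0 != y1 by apply: contra u1 => /eqP e; rewrite -F1 -e F0.
have diff1 : y1.1 = y0.1 + (w * 2)%:~R * p%:~R.
  rewrite -intrM -tE -tp /k /l y11 y01 !(intrD, mulrNz); ring.
have diff2 : y1.2 = y0.2 + (w * 2)%:~R * q%:~R.
  rewrite -intrM -tE -tq /k /l y12 y02 !(intrD, mulrNz); ring.
have hgt0 : hgt y0 = 1 / 2 by rewrite (hgt_level _ _ _ _ y01 y02) E0 addr0.
have w0 : w != 0.
  apply: contra n01 => /eqP w0; apply/eqP/point_eq.
    by rewrite diff1 w0 mul0r addr0.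
  by rewrite diff2 w0 mul0r addr0.
have v0 : ivec p q != 0.
  apply/eqP => /[dup] /(congr1 fst) /= h3 /(congr1 snd) /= h4.
  by move: abR; rewrite h3 h4 !mulr0 addr0 => /eqP; rewrite eq_sym oner_eq0.
have seg s : 0 <= s <= 1 -> inside P (lerp s y0 y1).
  move=> s01; have zP := cP (region_inside i0) (region_inside i1) s01.
  case/andP: s01; rewrite le_eqVlt => /orP[/eqP <- _|s0].
    by rewrite (_ : lerp 0 y0 y1 = y0) //; apply: point_eq => /=; ring.
  rewrite le_eqVlt => /orP[/eqP ->|s1].
    by rewrite (_ : lerp 1 y0 y1 = y1) //; apply: point_eq => /=; ring.
  case: zP => [/on_bdE[e eP [r _ zE]]|wz]; last first.
    by have [] := winding01 (lerp s y0 y1) PP => // w0'; rewrite w0' eqxx in wz.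
  (* A side meeting the open segment would have to lie along it, at height 1/2; but the region has
     points at heights 0 and 1, on both sides of that line. *)
  exfalso; have z0 := lerp_cross r e.1.1 e.2; rewrite -zE in z0.
  have c0 := left_of_edge PP cP eP (region_inside i0).
  have c1 := left_of_edge PP cP eP (region_inside i1).
  have c2 := left_of_edge PP cP eP R1; have c3 := left_of_edge PP cP eP R3.
  set V := e.2 - e.1.1 in z0 c0 c1 c2 c3.
  have ns : 0 < 1 - s by rewrite subr_gt0.
  have sum0 : (1 - s) * cross V (y0 - e.1.1) + s * cross V (y1 - e.1.1) + 0 + 0 = 0.
    by rewrite !addr0 -[RHS]z0 /cross /=; ring.
  have [q1 q2 _ _] := addr4_eq0 (mulr_ge0 (ltW ns) c0) (mulr_ge0 (ltW s0) c1)
    (lexx 0) (lexx 0) sum0.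
  have d0 : cross V (y0 - e.1.1) = 0.
    by apply/eqP; move/eqP: q1; rewrite mulf_eq0 (gt_eqF ns).
  have d1 : cross V (y1 - e.1.1) = 0.
    by apply/eqP; move/eqP: q2; rewrite mulf_eq0 (gt_eqF s0).
  have Vv : cross V (ivec p q) = 0.
    have : (w * 2)%:~R * cross V (ivec p q) = 0.
      transitivity (cross V (y1 - e.1.1) - cross V (y0 - e.1.1)); last by rewrite d0 d1 subrr.
      by rewrite /cross /= diff1 diff2; ring.
    move/eqP; rewrite mulf_eq0 intr_eq0 mulf_eq0 (negPf w0) /= => /eqP //.
  have [t0 [t1 t2]] := parallel v0 Vv; rewrite [(ivec p q).1]/= [(ivec p q).2]/= in t1 t2.
  have V1 z : cross V (z - e.1.1) = t0 * (hgt z - hgt y0).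
    rewrite -[LHS]subr0 -d0 /cross t1 t2 /hgt /=; ring.
  rewrite V1 hgt0 {1}/hgt !subrr !mulr0 in c2.
  have hX : hgt (x + ivec a1 a2) = 1 by rewrite -hR /hgt /=; ring.
  rewrite V1 hgt0 hX in c3.
  have t00 : t0 = 0 by lra.
  have := edge_neq0 eP; case/eqP; apply: point_eq; rewrite ?t1 ?t2 t00 mul0r //.
(* Integral points have integral height above x, so the middle line of the strip avoids them, as
   [sheet_periodic] requires. *)
have half_ne (n : int) : n%:~R <> 1 / 2 :> R.
  move=> nE; have : (n * 2)%:~R = 1%:~R :> R by rewrite intrM nE; field.
  by move=> /intr_inj; lia.
have F01 : c.2 y1 = c.2 y0.
  have main y y' (N : nat) : (0 < N)%N -> y'.1 = y.1 + (N.*2)%:R * p%:~R ->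
      y'.2 = y.2 + (N.*2)%:R * q%:~R -> hgt y = 1 / 2 ->
      (forall s, 0 <= s <= 1 -> inside P (lerp s y y')) -> c.2 y' = c.2 y.
    move=> N0 e1 e2 hy sy.
    have N2 : 0 < (N.*2)%:R :> R by rewrite ltr0n double_gt0.
    have := @sheet_periodic R A u P c p q tP pq y N.
    rewrite -e1 -e2 -surjective_pairing; apply=> [s /andP[s0 s1]|s].
      have -> : (y.1 + s * p%:~R, y.2 + s * q%:~R) = lerp (s / (N.*2)%:R) y y'.
        have nz := lt0r_neq0 N2.
        by apply: point_eq; rewrite /= ?e1 ?e2; field.
      apply: sy; rewrite ler_pdivrMr // mul1r s1 andbT.
      by rewrite divr_ge0 // ltW.
    move=> iz; have /intrP[n1 h1] := iz false; have /intrP[n2 h2] := iz true.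
    have /intrP[m1 h3] := ix false; have /intrP[m2 h4] := ix true.
    rewrite /= in h1 h2 h3 h4.
    apply: (half_ne (p * (n2 - m2) - q * (n1 - m1))).
    have -> : (p * (n2 - m2) - q * (n1 - m1))%:~R =
        p%:~R * (n2%:~R - m2%:~R) - q%:~R * (n1%:~R - m1%:~R) :> R.
      by rewrite -!intrB -!intrM -intrB.
    rewrite -hy -h1 -h2 -h3 -h4 /hgt; ring.
  (* [sheet_periodic] moves forward along (p, q) by a natural number of double periods, so [y0] and
     [y1] are exchanged when w is negative. *)
  have [wn|wp|we] := ltgtP w 0; last by rewrite we eqxx in w0.
    have wE : (w * 2)%:~R = - ((`|w|%N).*2)%:R :> R.
      by rewrite -[X in - X]/(((`|w|%N).*2)%:Z%:~R) -mulrNz; congr intr; lia.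
    symmetry; apply: (main y1 y0 `|w|%N).
    - by rewrite absz_gt0.
    - by rewrite diff1 wE; ring.
    - by rewrite diff2 wE; ring.
    - by rewrite -hgt0 /hgt diff1 diff2; ring.
    - move=> s s01; rewrite (_ : lerp s y1 y0 = lerp (1 - s) y0 y1).
        by apply: seg; lra.
      by apply: point_eq => /=; ring.
  have wE : (w * 2)%:~R = ((`|w|%N).*2)%:R :> R.
    by rewrite -[RHS]/(((`|w|%N).*2)%:Z%:~R); congr intr; lia.
  apply: (main y0 y1 `|w|%N) => //; first by rewrite absz_gt0.
    by rewrite diff1 wE.
  by rewrite diff2 wE.
by move/eqP: u1; rewrite -F1 F01 F0.
Qed.

End ConvexPresentation.

Theorem proposition10 (R : realType) (n : nat) (hn : (3 <= n)%N) :
  ~ has_convex_presentation (escher R n).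
Proof.
case: n hn => [|[|[|m]]] // _ [P [pP cP _ /(@structure_cut_paste R _ (1 : 'Z_m.+3)) [H _]]].
have [C [HR HG HU]] := H (structure_escher R m).
have PP : is_polygon P by apply: pP.1; rewrite mem_head.
(* This is where n >= 3 enters: in Z/2 the monodromy around integral points would be trivial. *)
have u2 : (1 : 'Z_m.+3) *+ 2 != 0.
  by apply/eqP => /(congr1 val); rewrite [LHS]val_Zp_nat // modn_small.
apply: (convex_structure_absurd (oner_neq0 _) u2 PP pP.2 cP (HR 0%N isT)).
  by move=> e e' eP e'P; exact: (HG 0%N 0%N e e').
move=> z K; have [j [x [jP ix xK L]]] := HU z K; exists x.
by case: j jP ix xK L.
Qed.
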